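(* Let $p$ be an odd prime and $m\ge 0$ an integer. Let $\tau$ be the $p$-content of an even partition of $2m$. Then over a field of characteristic $p$, $H^{(2^m)}_\tau$ is indecomposable. That is, $$H^{(2^m)}=\bigoplus_\tau H^{(2^m)}_\tau,$$ where the sum runs over all distinct $p$-contents $\tau$ of even partitions of $2m$, is the decomposition of the Foulkes module $H^{(2^m)}$ into indecomposable summands.
   Context: Let $F$ be a field of characteristic $p$. The Foulkes module $H^{(2^m)}$ is the permutation $FS_{2m}$-module on the cosets of the wreath product $S_2\wr S_m\le S_{2m}$, i.e. the trivial $F(S_2\wr S_m)$-module induced to $S_{2m}$. An even partition is a partition with no odd parts. The $p$-residue of a node $(i,j)$ of the Young diagram $[\lambda]=\{(i,j):1\le j\le\lambda_i\}$ is the remainder of $j-i$ modulo $p$, and the $p$-content of $\lambda$ is $C(\lambda)=(r_0,\dots,r_{p-1})$, where $r_k$ is the number of nodes of $[\lambda]$ of $p$-residue $k$. Two partitions have the same $p$-content iff they have the same $p$-core and $p$-weight. By Nakayama's conjecture (a theorem) the blocks of $FS_n$ are in bijection with the $p$-contents of partitions of $n$: the Specht module $S^\lambda$ (and the simple module $D^\mu$) lies in the block labeled by $C(\lambda)$ (respectively $C(\mu)$). For an $FS_n$-module $V$ and a sequence $\tau$, $V_\tau$ denotes the component (largest direct summand) of $V$ lying in the block labeled by $\tau$, and $V_\tau=0$ if $\tau$ is not the $p$-content of a partition of $n$. *)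

(* Defs.v *)
(* All modules are right modules: group elements act on row vectors by right
   multiplication, and permutations compose from left to right.  Classical
   choice (xget) is used only to name the block labelled by a content. *)
From HB Require Import structures.
From mathcomp Require Import all_boot all_order all_algebra.
From mathcomp Require Import all_fingroup all_solvable all_character.
From mathcomp Require boolp classical_sets.

Set Implicit Arguments.
Unset Strict Implicit.
Unset Printing Implicit Defensive.

Import GroupScope GRing.Theory.
Local Open Scope ring_scope.

Notation SymGroup n := [set: 'S_n]%G.

Section PermutationModule.
Variables (F : fieldType) (gT : finGroupType) (G : {group gT}).
Variables (T : finType) (to : {action gT &-> T}) (S : {set T}).
Hypothesis actsGS : [acts G, on S | to].

Definition basis_vec (x : T) : 'rV[F]_#|S| := \row_j (enum_val j == x)%:R.

Definition perm_module_mx (g : gT) : 'M[F]_#|S| :=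
  \matrix_(i, j) (enum_val j == to (enum_val i) g)%:R.

Lemma basis_vecE x (Sx : x \in S) : basis_vec x = delta_mx 0 (enum_rank_in Sx x).
Proof.
apply/rowP=> j; rewrite !mxE eqxx /=; congr (nat_of_bool _)%:R.
by rewrite -(inj_eq enum_val_inj) enum_rankK_in.
Qed.

Lemma row_perm_module_mx i g :
  row i (perm_module_mx g) = basis_vec (to (enum_val i) g).
Proof. by apply/rowP=> j; rewrite !mxE. Qed.

Lemma basis_vec_act x g : x \in S ->
  basis_vec x *m perm_module_mx g = basis_vec (to x g).
Proof.
by move=> Sx; rewrite basis_vecE -rowE row_perm_module_mx enum_rankK_in.
Qed.

Lemma perm_module_repr : mx_repr G perm_module_mx.
Proof.
split=> [|g h Gg Gh].
  by apply/matrixP=> i j; rewrite !mxE act1 (inj_eq enum_val_inj) eq_sym.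
apply/row_matrixP=> i; rewrite row_mul !row_perm_module_mx actM.
by rewrite basis_vec_act // (acts_act actsGS) ?enum_valP.
Qed.

(* The permutation FG-module with basis S. *)
Definition perm_module : mx_representation F G #|S| :=
  MxRepresentation perm_module_repr.

End PermutationModule.

Section Blocks.
Variables (F : fieldType) (gT : finGroupType) (G : {group gT}).

Definition central_idempotent (e : 'M[F]_#|G|) : Prop :=
  (e \in 'Z(group_ring F G))%MS /\ e *m e = e.

(* Blocks of FG are given by their idempotents: the primitive idempotents of
   the centre of FG. *)
Definition is_block (e : 'M[F]_#|G|) : Prop :=
  [/\ central_idempotent e, e != 0 &
      forall f, central_idempotent f -> f *m e = f -> f = 0 \/ f = e].

Section Module.
Variables (n : nat) (rG : mx_representation F G n).

(* The submodule U lies in the block e when e acts on it as the identity. *)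
Definition lies_in_block (e : 'M[F]_#|G|) (U : 'M[F]_n) : Prop :=
  U *m gring_op rG e = U.

(* The largest direct summand of V lying in the block e is V e: see the lemmas
   on block_component below. *)
Definition block_component (e : 'M[F]_#|G|) : 'M[F]_n := gring_op rG e.

Definition indecomposable (U : 'M[F]_n) : Prop :=
  [/\ mxmodule rG U, U != 0 &
      forall V W : 'M[F]_n, mxmodule rG V -> mxmodule rG W ->
        (V + W :=: U)%MS -> mxdirect (V + W) -> V = 0 \/ W = 0].

Lemma gring_op_central e g : central_idempotent e -> g \in G ->
  gring_op rG e *m rG g = rG g *m gring_op rG e.
Proof.
case; rewrite /center_mx sub_capmx => /andP[Re /cent_mxP Ce] _ Gg.
have Rg : (regular_repr F G g \in group_ring F G)%MS by apply: envelop_mx_id.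
by rewrite -(gring_opG rG Gg) -!gring_opM ?Ce.
Qed.

Lemma gring_op_idem e : central_idempotent e ->
  gring_op rG e *m gring_op rG e = gring_op rG e.
Proof.
case; rewrite /center_mx sub_capmx => /andP[Re _] ee.
by rewrite -gring_opM ?ee.
Qed.

Lemma block_component_module e : central_idempotent e ->
  mxmodule rG (block_component e).
Proof.
move=> ce; apply/mxmoduleP=> g Gg.
by rewrite gring_op_central ?submxMl.
Qed.

Lemma block_component_summand e : central_idempotent e ->
  exists W : 'M[F]_n, [/\ mxmodule rG W,
    (block_component e + W :=: 1%:M)%MS & mxdirect (block_component e + W)].
Proof.
move=> ce; have ee := gring_op_idem ce.
exists (1%:M - gring_op rG e); split.
- apply/mxmoduleP=> g Gg.
  by rewrite mulmxBl mul1mx gring_op_central // -{1}[rG g]mulmx1 -mulmxBr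
             submxMl.
- apply/eqmxP; rewrite submx1 /=.
  by rewrite -[X in (X <= _)%MS](subrKC (gring_op rG e)) addmx_sub_adds.
apply/mxdirect_addsP/eqP; rewrite -submx0; apply/row_subP=> i.
have := row_sub i (block_component e :&: (1%:M - gring_op rG e))%MS.
rewrite sub_capmx => /andP[/submxP[u Du] /submxP[v Dv]].
have : row i (block_component e :&: (1%:M - gring_op rG e))%MS *m gring_op rG e
       = 0.
  by rewrite Dv -mulmxA mulmxBl mul1mx ee subrr mulmx0.
by rewrite Du -mulmxA ee => ->; rewrite sub0mx.
Qed.

Lemma block_component_lies e : central_idempotent e ->
  lies_in_block e (block_component e).
Proof. exact: gring_op_idem. Qed.

Lemma block_component_max e (W : 'M[F]_n) :
  lies_in_block e W -> (W <= block_component e)%MS.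
Proof. by move=> <-; apply: submxMl. Qed.

End Module.
End Blocks.

Section SpechtModules.
Variable n : nat.

(* Partitions of n are padded with zeros to exactly n parts, so that they form
   a finite type. *)
Definition is_partition (la : n.-tuple 'I_n.+1) : bool :=
  sorted geq (map val la) && (\sum_(i < n) tnth la i == n)%N.

Definition partition_of : Type := {la : n.-tuple 'I_n.+1 | is_partition la}.
HB.instance Definition _ := Finite.on partition_of.

Definition part (la : partition_of) (i : 'I_n) : nat := tnth (val la) i.

Definition even_partition (la : partition_of) : bool :=
  [forall i, ~~ odd (part la i)].

(* Rows and columns are numbered from 0; this does not affect j - i. *)
Definition diagram (la : partition_of) : {set 'I_n * 'I_n} :=
  [set x : 'I_n * 'I_n | (x.2 < part la x.1)%N].

Definition residue (p : nat) (x : 'I_n * 'I_n) : int :=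
  modz (x.2%:Z - x.1%:Z) p%:Z.

Definition content (p : nat) (la : partition_of) : {ffun 'I_p -> nat} :=
  [ffun k : 'I_p => #|[set x in diagram la | residue p x == k%:Z]|].

(* A filling sends each entry 0, ..., n - 1 to the place it occupies; for a
   tableau the place is a node, for a tabloid it is only a row.  A permutation
   g replaces each entry x by g x. *)
Definition fill_act (T : finType) (f : {ffun 'I_n -> T}) (g : 'S_n) :
  {ffun 'I_n -> T} := [ffun x => f ((g^-1)%g x)].

Lemma fill_act1 T : @fill_act T ^~ 1%g =1 id.
Proof. by move=> f; apply/ffunP=> x; rewrite ffunE invg1 perm1. Qed.

Lemma fill_actM T f : act_morph (@fill_act T) f.
Proof. by move=> g h; apply/ffunP=> x; rewrite !ffunE invMg permM. Qed.

Definition fill_action (T : finType) : {action 'S_n &-> {ffun 'I_n -> T}} :=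
  TotalAction (@fill_act1 T) (@fill_actM T).

Definition is_tableau (la : partition_of) (t : {ffun 'I_n -> 'I_n * 'I_n}) :=
  injectiveb t && (t @: [set: 'I_n] == diagram la).

Definition tabloid (t : {ffun 'I_n -> 'I_n * 'I_n}) : {ffun 'I_n -> 'I_n} :=
  [ffun x => (t x).1].

Definition tabloids (la : partition_of) : {set {ffun 'I_n -> 'I_n}} :=
  [set tabloid t | t in is_tableau la].

Definition column_stabiliser (t : {ffun 'I_n -> 'I_n * 'I_n}) : {set 'S_n} :=
  [set s : 'S_n | [forall x, (t (s x)).2 == (t x).2]].

Lemma tabloid_act t g : tabloid (fill_act t g) = fill_act (tabloid t) g.
Proof. by apply/ffunP=> x; rewrite !ffunE. Qed.

Lemma is_tableau_act la t g : is_tableau la t -> is_tableau la (fill_act t g).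
Proof.
case/andP=> /injectiveP injt /eqP imt; apply/andP; split.
  by apply/injectiveP=> x y; rewrite !ffunE => /injt /perm_inj.
rewrite -imt; apply/eqP/setP=> y; apply/imsetP/imsetP=> -[x _ ->].
  by exists ((g^-1)%g x); rewrite ?inE ?ffunE.
by exists (g x); rewrite ?inE // ffunE permK.
Qed.

Lemma acts_tabloids la :
  [acts SymGroup n, on tabloids la | fill_action 'I_n].
Proof.
apply/subsetP=> g _; rewrite inE /= in_setT /= inE.
apply/subsetP=> _ /imsetP[t tab_t ->]; rewrite inE /= -tabloid_act.
by apply: imset_f; apply: is_tableau_act.
Qed.

Section Field.
Variable F : fieldType.

(* The Young permutation module M^la. *)
Definition young_module (la : partition_of) :
    mx_representation F (SymGroup n) #|tabloids la| :=
  perm_module F (acts_tabloids la).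

Definition polytabloid (la : partition_of) (t : {ffun 'I_n -> 'I_n * 'I_n}) :
    'rV[F]_#|tabloids la| :=
  \sum_(s in column_stabiliser t)
     (-1) ^+ s *: basis_vec F (tabloids la) (fill_act (tabloid t) s).

Definition specht (la : partition_of) : 'M[F]_#|tabloids la| :=
  (\sum_(t | is_tableau la t) <<polytabloid la t>>)%MS.

Lemma polytabloid_act la t g : is_tableau la t ->
  polytabloid la t *m young_module la g = polytabloid la (fill_act t g).
Proof.
move=> tab_t; have tabl_t : tabloid t \in tabloids la by apply: imset_f.
rewrite /polytabloid mulmx_suml [RHS](reindex_inj (@conjg_inj _ g)) /=.
apply: eq_big => [s|s _].
  rewrite !inE; apply/forallP/forallP=> Cs x.
    by rewrite !ffunE -permM -mulgA !permM permK -!permM permM (eqP (Cs _)).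
  move: (Cs (g x)); rewrite !ffunE conjgE.
  by rewrite !permM !permK.
rewrite -scalemxAl basis_vec_act; last first.
  rewrite -tabloid_act; apply: imset_f; exact: is_tableau_act.
rewrite odd_permJ tabloid_act /= -!fill_actM; congr (_ *: basis_vec F _ _).
by rewrite conjgE !mulgA mulgV mul1g.
Qed.

Lemma specht_module la : mxmodule (young_module la) (specht la).
Proof.
apply/mxmoduleP=> g _; rewrite sumsmxMr; apply/sumsmx_subP=> t tab_t.
rewrite (eqmxMr _ (genmxE _)) polytabloid_act //.
by rewrite (sumsmx_sup (fill_act t g)) ?is_tableau_act // genmxE.
Qed.

(* The block labelled by tau is the one containing the Specht modules of the
   partitions of content tau.  By Nakayama's conjecture there is exactly one if
   tau is the content of a partition of n, and by definition none otherwise. *)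
Definition block_label (p : nat) (e : 'M[F]_#|SymGroup n|)
    (tau : {ffun 'I_p -> nat}) : Prop :=
  [/\ is_block e, exists la, content p la = tau &
      forall la, content p la = tau ->
        lies_in_block (young_module la) e (specht la)].

Definition block_of_content (p : nat) (tau : {ffun 'I_p -> nat}) :
    'M[F]_#|SymGroup n| :=
  classical_sets.xget 0 (fun e => block_label e tau).

(* V_tau; it is 0 when tau is not the content of a partition of n. *)
Definition content_component (p d : nat)
    (rG : mx_representation F (SymGroup n) d) (tau : {ffun 'I_p -> nat}) :
    'M[F]_d :=
  block_component rG (block_of_content tau).

Lemma content_component0 (p d : nat)
    (rG : mx_representation F (SymGroup n) d) (tau : {ffun 'I_p -> nat}) :
  (forall la, content p la != tau) -> content_component rG tau = 0.
Proof.
move=> no_la; rewrite /content_component /block_of_content.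
rewrite classical_sets.xgetPN ?[block_component _ _]linear0 // => e.
by case=> _ [la /eqP]; rewrite (negPf (no_la la)).
Qed.

End Field.
End SpechtModules.

(* S_2 wr S_m, as the stabiliser in S_{2m} of the set partition
   {{0, 1}, {2, 3}, ...} of {0, ..., 2m - 1}. *)
Definition pairs (m : nat) : {set {set 'I_(2 * m)}} :=
  [set [set j : 'I_(2 * m) | j./2 == i./2] | i : 'I_(2 * m)].

Definition wreath (m : nat) : {group 'S_(2 * m)} := 'N(pairs m | 'P^* )%G.

Definition foulkes (F : fieldType) (m : nat) :
    mx_representation F (SymGroup (2 * m))
      #|rcosets (wreath m) (SymGroup (2 * m))| :=
  perm_module F (actsRs_rcosets (wreath m) (SymGroup (2 * m))).

(* The distinct p-contents of the even partitions of 2m. *)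
Definition even_contents (p m : nat) : seq {ffun 'I_p -> nat} :=
  undup [seq content p la | la in @even_partition (2 * m)].

(* Main.v *)
(* Proof idea.  Let J_k be the sum of the transpositions (a k) with a < k.
   Expanding symmetric polynomials in the J_k, the leading terms with respect
   to the number of moved points form single conjugacy classes, so over the
   integers every class sum is a symmetric polynomial in J_1, ..., J_n.  A
   polytabloid whose tableau is filled column by column is a common
   eigenvector of the J_k, with the contents as eigenvalues.  Hence the central
   character of a Specht module depends only on the multiset of residues, and
   conversely elementary symmetric polynomials separate these multisets: this
   gives Nakayama's conjecture.

   A permutation x is sent to its matching t0 ^ x, where t0 is the fixed
   matching.  Ordering matchings by the number of points moved by
   t0 * t0 ^ x, a second triangularity argument (with powers of 2 on the
   diagonal) shows that for odd p the centre of FS_n maps onto the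
   endomorphism ring of the Foulkes module H.  Over the rationals, H contains
   an eigenvector with the contents of each even partition, and counting double
   cosets shows that there is no room for others; reducing integral
   eigenvectors and annihilating polynomials modulo p shows that a central
   element of FS_n whose central characters vanish at all even partitions is
   nilpotent on H.  So an idempotent endomorphism of a block component of H,
   being the action of a central element, is 0 or 1. *)
From HB Require Import structures.
Require Import Defs.
From mathcomp Require Import all_boot all_order all_algebra.
From mathcomp Require Import all_fingroup all_solvable all_character.
From mathcomp Require Import zify.
From mathcomp Require boolp classical_sets.

Set Implicit Arguments.
Unset Strict Implicit.
Unset Printing Implicit Defensive.

Import GroupScope GRing.Theory.

(** * Permutations: orbits, conjugacy, star factorizations *)

(** The obstacle is reduction modulo p, which destroys both semisimplicity and the nonvanishing of
    explicit vectors. A central element that kills one eigenvector for each even partition need not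
    visibly act as zero on the Foulkes module. But a product over the even partitions of factors of
    the form class sum minus integral eigenvalue vanishes over the rationals, hence over the
    integers, hence modulo p; this gives nilpotency, and nilpotent idempotents are zero. For this
    transfer the class sums must be polynomials in the J_k with the same integral coefficients over
    every field. The number of moved points serves as the order in both triangularity arguments
    because its extremal cases are rigid: a product of transpositions (a c) that moves as many
    points as its centres allow has only one such factorization, and a permutation g for which
    [t0 * t0 ^ g] moves twice as many points as g meets each pair of t0 at most once. Oddness of p
    enters twice: the number of permutations of the latter kind with a given matching, a power of 2,
    is inverted, and a sum equal to its own negative is concluded to be zero. *)

Section Orbits.
Variable T : finType.
Implicit Types (u w v : {perm T}) (S A B : {set T}) (x y a c : T).

Definition supp w : {set T} := [set x | w x != x].

Lemma suppJ w v : supp (w ^ v) = [set v x | x in supp w].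
Proof.
apply/setP=> x; rewrite inE -{1 2}(permKV v x) conjgE !permM permK.
rewrite (inj_eq perm_inj); apply/idP/imsetP => [ne|[y]].
  by exists (v^-1 x); rewrite ?inE ?permKV.
by rewrite inE => ne ->; rewrite permK.
Qed.

Lemma conj_permP u v w : (forall x, u (w x) = v (u x)) -> w ^ u = v.
Proof.
by move=> uwv; apply/permP=> x; rewrite -[x](permKV u) conjgE !permM permK uwv.
Qed.

Lemma card_suppJ w v : #|supp (w ^ v)| = #|supp w|.
Proof. by rewrite suppJ card_imset //; apply: perm_inj. Qed.

Lemma supp_stable w x : (w x \in supp w) = (x \in supp w).
Proof. by rewrite !inE (inj_eq perm_inj). Qed.

Lemma expg_stable w S x i : {in S, forall y, w y \in S} -> x \in S ->
  (w ^+ i) x \in S.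
Proof.
by move=> wS Sx; elim: i => [|i IHi]; rewrite ?expg0 ?perm1 // expgSr permM wS.
Qed.

Lemma porbit_sub w S x : {in S, forall y, w y \in S} -> x \in S ->
  porbit w x \subset S.
Proof.
by move=> wS Sx; apply/subsetP=> _ /porbitP[i ->]; apply: expg_stable.
Qed.

Lemma porbit_eq_on w v S x : {in S, forall y, w y \in S} -> {in S, w =1 v} ->
  x \in S -> porbit w x = porbit v x.
Proof.
move=> wS wv Sx; have e i : (w ^+ i) x = (v ^+ i) x.
  elim: i => [|i IHi]; first by rewrite !expg0.
  by rewrite !expgSr !permM -IHi wv // expg_stable.
by apply/setP=> y; apply/porbitP/porbitP=> -[i ->]; exists i; rewrite e.
Qed.

Lemma porbit_step w x : w x \in porbit w x.
Proof. exact: (mem_porbit w 1). Qed.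

Lemma porbit_stable w x : {in porbit w x, forall y, w y \in porbit w x}.
Proof. by move=> y; rewrite -eq_porbit_mem => /eqP <-; apply: porbit_step. Qed.

Lemma mem_porbit_step w x y : (w y \in porbit w x) = (y \in porbit w x).
Proof. by rewrite -!eq_porbit_mem (porbit_perm w 1). Qed.

Lemma porbit_fix w x : w x = x -> porbit w x = [set x].
Proof.
move=> wx; apply/eqP; rewrite eqEsubset sub1set porbit_id andbT.
by apply: porbit_sub => [y /set1P ->|]; rewrite ?wx set11.
Qed.

Lemma card_porbit_gt1 w x : (1 < #|porbit w x|) = (x \in supp w).
Proof.
rewrite inE; have [/porbit_fix->|nx] := eqVneq; first by rewrite cards1.
rewrite (cardsD1 x) porbit_id (cardsD1 (w x)) !inE porbit_step nx.
by [].
Qed.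

Lemma porbitJ w v x : porbit (w ^ v) (v x) = [set v y | y in porbit w x].
Proof.
apply/setP=> y; apply/porbitP/imsetP=> [[i ->]|[_ /porbitP[i ->] ->]].
  exists ((w ^+ i) x); first exact: mem_porbit.
  by rewrite -conjXg conjgE !permM permK.
by exists i; rewrite -conjXg conjgE !permM permK.
Qed.

Lemma card_porbitJ w v x : #|porbit (w ^ v) (v x)| = #|porbit w x|.
Proof. by rewrite porbitJ card_imset //; apply: perm_inj. Qed.

(* A new point a is inserted in the cycle of c. *)
Section Insert.
Variables (w : {perm T}) (a c : T).
Hypotheses (wa : w a = a) (neq_ac : a != c).
Let v := tperm a c * w.

Lemma insertL : v a = w c. Proof. by rewrite permM tpermL. Qed.
Lemma insertR : v c = a. Proof. by rewrite permM tpermR. Qed.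
Lemma insertD y : y != a -> y != c -> v y = w y.
Proof. by move=> ya yc; rewrite permM tpermD // eq_sym. Qed.

Lemma porbit_insert : porbit v c = a |: porbit w c.
Proof.
apply/eqP; rewrite eqEsubset; apply/andP; split.
  apply: porbit_sub => [y|]; last by rewrite !inE porbit_id orbT.
  rewrite in_setU1 => /orP[/eqP->|yc].
    by rewrite insertL !inE porbit_step orbT.
  have [->|nyc] := eqVneq y c; first by rewrite insertR !inE eqxx.
  have [->|nya] := eqVneq y a; first by rewrite insertL !inE porbit_step orbT.
  by rewrite insertD // !inE porbit_stable ?orbT.
rewrite subUset sub1set -{1}insertR porbit_step /=.
apply: porbit_sub => [y yc|]; last exact: porbit_id.
have [->|nya] := eqVneq y a; first by rewrite wa -insertR porbit_step.
have [->|nyc] := eqVneq y c; last by rewrite -insertD ?porbit_stable.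
by rewrite -insertL mem_porbit_step -{1}insertR porbit_step.
Qed.

Lemma notin_porbit_insert : a \notin porbit w c.
Proof. by rewrite porbit_sym porbit_fix // inE eq_sym. Qed.

Lemma porbit_insertD y : y \notin a |: porbit w c -> porbit v y = porbit w y.
Proof.
rewrite -in_setC => yC; apply: porbit_eq_on yC => z.
  rewrite !inE !negb_or => /andP[za zc].
  rewrite insertD // ?mem_porbit_step; last first.
    by apply: contra zc => /eqP->; apply: porbit_id.
  by rewrite zc andbT -wa (inj_eq perm_inj).
rewrite !inE !negb_or => /andP[za zc]; rewrite insertD //.
by apply: contra zc => /eqP->; apply: porbit_id.
Qed.

Lemma supp_insert : supp v = a |: (c |: supp w).
Proof.
apply/setP=> y; rewrite !inE.
have [->|nya] /= := eqVneq y a.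
  rewrite insertL; apply: contra neq_ac => /eqP e.
  by rewrite -(inj_eq (@perm_inj _ w)) wa e.
have [->|nyc] /= := eqVneq y c; first by rewrite insertR.
by rewrite insertD.
Qed.

End Insert.

Lemma expg_mod_porbit w x i : (w ^+ (i %% #|porbit w x|)) x = (w ^+ i) x.
Proof.
rewrite {2}(divn_eq i #|porbit w x|) expgD permM; congr (fun_of_perm _ _).
elim: (_ %/ _) => [|k IHk]; first by rewrite mul0n expg0 perm1.
by rewrite mulSn expgD permM [(w ^+ #|_|) x]permX iter_porbit.
Qed.

Lemma expg_porbit_inj w x i j : i < #|porbit w x| -> j < #|porbit w x| ->
  (w ^+ i) x = (w ^+ j) x -> i = j.
Proof.
move=> lti ltj; rewrite !permX => e; apply/eqP.
rewrite -(@nth_uniq _ x (traject w x #|porbit w x|)) ?size_traject //.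
  by rewrite !nth_traject // e.
exact: uniq_traject_porbit.
Qed.

End Orbits.


(** Induction removes one cycle from A and an equally long one from B. Points are counted rather
    than cycles, k for each cycle of length k. Stable subsets are allowed because matchings need one
    cycle out of each pair. *)
Lemma orbit_matching (T : finType) (w v : {perm T}) (A B : {set T}) :
    {in A, forall x, w x \in A} -> {in B, forall x, v x \in B} ->
    (forall k : nat, #|[set x in A | #|porbit w x| == k]|
             = #|[set x in B | #|porbit v x| == k]|) ->
  exists f : T -> T, [/\ {in A, forall x, f x \in B},
    {in A &, injective f} & {in A, forall x, f (w x) = v (f x)}].
Proof.
move: {2}_.+1 (ltnSn #|A|) => N; elim: N => // N IHN in A B *.
rewrite ltnS => leAN wA vB eqAB.
have [->|[x Ax]] := set_0Vmem A; first by exists id; split=> x; rewrite inE.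
have [y By oyx]: exists2 y, y \in B & #|porbit v y| = #|porbit w x|.
  have: 0 < #|[set y in B | #|porbit v y| == #|porbit w x| ]|.
    by rewrite -eqAB card_gt0; apply/set0Pn; exists x; rewrite !inE Ax eqxx.
  rewrite card_gt0 => /set0Pn[y]; rewrite inE => /andP[By /eqP oy].
  by exists y.
have sub (u : {perm T}) (C : {set T}) z (k : nat) : {in C, forall z, u z \in C} -> z \in C ->
    #|[set x in C :\: porbit u z | #|porbit u x| == k]|
    = #|[set x in C | #|porbit u x| == k]| - (#|porbit u z| == k) * k.
  move=> uC Cz; set S := [set x in C | _].
  have [ek|nk] := eqVneq #|porbit u z| k; last first.
    rewrite mul0n subn0; apply: eq_card => t; rewrite !inE.
    have [|_] := boolP (t \in porbit u z); last by [].
    by rewrite -eq_porbit_mem => /eqP->; rewrite (negPf nk) !andbF.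
  rewrite mul1n -(cardsID (porbit u z) S) addnC.
  have ->: S :&: porbit u z = porbit u z.
    apply/setIidPr/subsetP => t tz; rewrite inE (subsetP (porbit_sub uC Cz)) //=.
    by rewrite -eq_porbit_mem in tz; rewrite (eqP tz) ek.
  by rewrite ek addnK; apply: eq_card => t; rewrite !inE andbA.
have stab (u : {perm T}) (C : {set T}) z : {in C, forall z, u z \in C} ->
    {in C :\: porbit u z, forall t, u t \in C :\: porbit u z}.
  by move=> uC t; rewrite !inE mem_porbit_step => /andP[-> /uC].
have [||||f [fB f_inj fw]] := IHN (A :\: porbit w x) (B :\: porbit v y).
- apply: leq_trans leAN; apply: proper_card.
  by apply/properP; split; [apply: subsetDl | exists x; rewrite // inE porbit_id].
- exact: stab.
- exact: stab.
- by move=> k; rewrite !sub // eqAB oyx.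
(* On the removed cycle g sends [(w ^+ i) x] to [(v ^+ i) y]; the exponent i is read off as an index
   in the trajectory of x. *)
pose g z := if z \in porbit w x then
  (v ^+ index z (traject w x #|porbit w x|)) y else f z.
have gO z : z \in porbit w x -> g z \in porbit v y.
  by move=> zx; rewrite /g zx mem_porbit.
have gE i : g ((w ^+ i) x) = (v ^+ i) y.
  have lt : i %% #|porbit w x| < #|porbit w x|.
    by rewrite ltn_mod lt0n card_porbit_neq0.
  have e : (w ^+ i) x = nth x (traject w x #|porbit w x|) (i %% #|porbit w x|).
    by rewrite nth_traject // -permX expg_mod_porbit.
  rewrite /g mem_porbit {1}e index_uniq ?size_traject ?uniq_traject_porbit //.
  by rewrite -oyx expg_mod_porbit.
have gN z : z \in A -> z \notin porbit w x -> g z \in B :\: porbit v y.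
  by move=> Az nz; rewrite /g (negPf nz) fB // inE nz.
have gOE z : z \in A -> (g z \in porbit v y) = (z \in porbit w x).
  move=> Az; apply/idP/idP; last exact: gO.
  by apply: contraLR => /(gN z Az); rewrite inE => /andP[].
exists g; split=> [z Az|z t Az At e|z Az].
- have [zx|/(gN z Az)] := boolP (z \in porbit w x); last by rewrite inE => /andP[].
  by rewrite (subsetP (porbit_sub vB By)) ?gO.
- have [zx|zx] := boolP (z \in porbit w x); last first.
    have tx : t \notin porbit w x by rewrite -gOE // -e gOE.
    by move: e; rewrite /g (negPf zx) (negPf tx) => /f_inj-> //; rewrite inE ?zx ?tx.
  have tx : t \in porbit w x by rewrite -gOE // -e gOE.
  move: zx tx e => /porbitP[i ->] /porbitP[j ->].
  rewrite !gE -(expg_mod_porbit w x i) -(expg_mod_porbit w x j).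
  rewrite -(expg_mod_porbit v y i) -(expg_mod_porbit v y j) oyx.
  have lt k : k %% #|porbit w x| < #|porbit w x|.
    by rewrite ltn_mod lt0n card_porbit_neq0.
  by move/expg_porbit_inj=> -> //; rewrite oyx.
- have [/porbitP[i ->]|zx] := boolP (z \in porbit w x).
    by rewrite -permM -expgSr !gE expgSr permM.
  by rewrite /g mem_porbit_step (negPf zx) fw // inE zx.
Qed.

Lemma conj_of_orbit_sizes (T : finType) (w v : {perm T}) :
    (forall k : nat, #|[set x | #|porbit w x| == k]| = #|[set x | #|porbit v x| == k]|) ->
  exists u, v = w ^ u.
Proof.
move=> eq_wv.
have [k|f [_ f_inj fw]] := @orbit_matching T w v setT setT (fun _ _ => in_setT _)
  (fun _ _ => in_setT _).
  transitivity #|[set x | #|porbit w x| == k]|; last rewrite eq_wv.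
    by apply: eq_card => x; rewrite !inE.
  by apply: eq_card => x; rewrite !inE.
have inj_f : injective f by move=> x y; apply: f_inj; rewrite inE.
exists (perm inj_f); apply/permP=> x.
by rewrite -[x](permKV (perm inj_f)) conjgE !permM permK !permE fw ?inE.
Qed.

(** * Products of transpositions with prescribed larger points *)

Section StarFactorizations.
Variable n : nat.
Implicit Types (w v : 'S_n) (cs : seq 'I_n) (a c i : 'I_n).

(* The number of ways to write w as a product of transpositions (a_1 c_1),
   (a_2 c_2), ... with a_j < c_j, where the c_j are the prescribed centres. *)
Fixpoint nwords cs w : nat :=
  if cs is c :: cs' then \sum_(a : 'I_n | a < c) nwords cs' (tperm a c * w)
  else w == 1.

Definition top w c := [forall i in porbit w c, i <= c].

(** Cycle lengths minus one, recorded at the cycle maxima: the exponents of the monomial in the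
    Jucys-Murphy elements that has w as a leading term. *)
Definition cyc w c : nat := if top w c then #|porbit w c|.-1 else 0.

(** A centre occurring k times accounts for at most k + 1 moved points, so this bounds the support
    of any product with centres [cs]. *)
Definition weight cs := size cs + size (undup cs).

Lemma topP w c : reflect {in porbit w c, forall i, i <= c} (top w c).
Proof. exact: (iffP forall_inP). Qed.

Lemma cyc_gt0 w c : (0 < cyc w c) = top w c && (c \in supp w).
Proof.
by rewrite /cyc -card_porbit_gt1; case: top => //; case: #|_| => // -[].
Qed.

Lemma top_fix w c : c \notin supp w -> top w c.
Proof.
rewrite inE negbK => /eqP /porbit_fix e.
by apply/topP=> i; rewrite e => /set1P->.
Qed.

Lemma cyc_insert w a c i : a \notin supp w -> a < c -> top w c ->
  cyc (tperm a c * w) i = (i == c) + cyc w i.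
Proof.
rewrite inE negbK => /eqP wa lt_ac tc.
have nac : a != c by rewrite neq_ltn lt_ac.
have [->|nic] := eqVneq i c.
  rewrite /cyc tc porbit_insert // cardsU1 notin_porbit_insert //=.
  have := card_porbit_neq0 w c; case: #|_| => //= k _; case: topP => // -[] j.
  by rewrite porbit_insert // !inE => /orP[/eqP->|/(topP _ _ tc) //]; apply: ltnW.
rewrite add0n; have [ic|ic] := boolP (i \in a |: porbit w c); last first.
  by rewrite /cyc /top porbit_insertD.
have lt_ic : i < c.
  move: ic; rewrite !inE => /orP[/eqP->//|/(topP _ _ tc)].
  by rewrite leq_eqVlt => /orP[/eqP/val_inj e|//]; rewrite e eqxx in nic.
rewrite {1}/cyc; case: topP => [/(_ c)|_].
  rewrite porbit_sym porbit_insert // => /(_ ic).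
  by rewrite leqNgt lt_ic.
move: ic; rewrite !inE => /orP[/eqP->|ic].
  by rewrite /cyc porbit_fix // cards1; case: ifP.
rewrite /cyc; case: topP => // /(_ c); rewrite porbit_sym => /(_ ic).
by rewrite leqNgt lt_ic.
Qed.

(** The extremal products: every letter brings a new lower point, and its centre is either already a
    centre or a new point, so stars with different centres stay disjoint. *)
Inductive disjoint_stars : seq 'I_n -> 'S_n -> Prop :=
| DisjointNil : disjoint_stars [::] 1
| DisjointCons cs w a c : disjoint_stars cs w -> a < c -> a \notin supp w ->
    (c \in cs) || (c \notin supp w) -> disjoint_stars (c :: cs) (tperm a c * w).

Lemma disjoint_stars_cyc cs w : disjoint_stars cs w ->
  forall i, cyc w i = count_mem i cs.
Proof.
elim=> [i|{}cs {}w a c _ IH lt_ac aw cc i] /=.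
  by rewrite /cyc porbit_fix ?perm1 // cards1; case: ifP.
rewrite cyc_insert ?IH //; first by rewrite eq_sym.
case/orP: cc => [ccs|]; last exact: top_fix.
have: 0 < cyc w c by rewrite IH -has_count has_pred1.
by rewrite cyc_gt0 => /andP[].
Qed.

Lemma disjoint_stars_sub cs w : disjoint_stars cs w -> {subset cs <= supp w}.
Proof.
move=> dw c cc; have: 0 < cyc w c.
  by rewrite (disjoint_stars_cyc dw) -has_count has_pred1.
by rewrite cyc_gt0 => /andP[].
Qed.

Lemma weight_cons c cs : weight (c :: cs) = (c \notin cs).+1 + weight cs.
Proof.
rewrite /weight /=; case: (c \in cs) => /=; first by rewrite addSn.
by rewrite addSn addnS.
Qed.

Lemma card_supp_insert w a c : a \notin supp w -> a != c ->
  #|supp (tperm a c * w)| = (c \notin supp w).+1 + #|supp w|.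
Proof.
move=> aw nac; rewrite supp_insert //; last by move: aw; rewrite inE negbK => /eqP.
by rewrite !cardsU1 in_setU1 (negPf nac) (negPf aw).
Qed.

Lemma disjoint_stars_weight cs w : disjoint_stars cs w -> #|supp w| = weight cs.
Proof.
elim=> [|{}cs {}w a c dw IH lt_ac aw cc].
  by apply: eq_card0 => x; rewrite inE perm1 eqxx.
rewrite card_supp_insert ?neq_ltn ?lt_ac // weight_cons IH.
have [ccs|ncs] := boolP (c \in cs); first by rewrite (disjoint_stars_sub dw).
by case/orP: cc => [|->//]; rewrite (negPf ncs).
Qed.

(** The witness L retains the centres even if cancellation removes them from the support; otherwise
    repeating such a centre could add a point that the weight does not count. *)
Definition small_support cs w :=
  exists L : {set 'I_n}, [/\ {subset cs <= L}, supp w \subset L & #|L| < weight cs].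

Lemma supp_mul_tperm w a c : supp (tperm a c * w) \subset a |: (c |: supp w).
Proof.
apply/subsetP=> x; rewrite !inE permM.
by case: tpermP => [->|->|_ _ ->]; rewrite ?eqxx ?orbT.
Qed.

(** A letter enlarges L by at most the increase of the weight, so a deficit is never made up. A
    letter added to an extremal product creates a deficit unless it brings the points that
    extremality requires. *)
Lemma star_step cs w a c : a < c ->
    disjoint_stars cs w \/ small_support cs w ->
    (disjoint_stars cs w /\ (a \notin supp w) && ((c \in cs) || (c \notin supp w)))
  \/ small_support (c :: cs) (tperm a c * w).
Proof.
move=> lt_ac dw.
have wit (L : {set 'I_n}) : {subset cs <= L} -> supp w \subset L ->
    #|a |: (c |: L)| < weight (c :: cs) -> small_support (c :: cs) (tperm a c * w).
  move=> csL wL lt; exists (a |: (c |: L)); split=> //.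
    move=> x; rewrite inE => /orP[/eqP->|/csL xL]; rewrite !inE ?eqxx ?orbT //.
    by rewrite xL !orbT.
  by apply: subset_trans (supp_mul_tperm _ _ _) _; rewrite !setUS.
case: dw => [dw|[L [csL wL lt]]]; last first.
  right; apply: (wit L) => //; rewrite weight_cons.
  have [cc|_] /= := boolP (c \in cs).
    rewrite (_ : c |: L = L); first by rewrite cardsU1; case: (a \in L); rewrite ?ltnS // ltnW.
    by apply/setUidPr; rewrite sub1set csL.
  rewrite !cardsU1; case: (a \in _); case: (c \in _) => /=; move: lt; move: #|L| (weight cs) => l k; lia.
have [h|h] := boolP (_ && _); first by left.
right; apply: (wit (supp w)) => //; first exact: disjoint_stars_sub.
rewrite weight_cons -(disjoint_stars_weight dw).
have := disjoint_stars_sub dw (x := c); move: h.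
rewrite !cardsU1 in_setU1 (negbTE (_ : a != c)) ?neq_ltn ?lt_ac //=.
case: (a \in supp w); case: (c \in cs); case: (c \in supp w) => //= _ H; try lia.
all: by have := H isT.
Qed.

Lemma nwords_gt0 cs w : 0 < nwords cs w ->
  disjoint_stars cs w \/ small_support cs w.
Proof.
elim: cs w => [|c cs IH] w /=.
  by case: eqP => // -> _; left; constructor.
rewrite lt0n sum_nat_eq0 negb_forall_in => /existsP[a /andP[lt_ac]].
rewrite -lt0n => /IH/(star_step lt_ac) []; last by rewrite tpermKg; right.
by case=> dw /andP[aw cw]; left; rewrite -(tpermKg a c w); constructor.
Qed.

Lemma small_support_lt cs w : small_support cs w -> #|supp w| < weight cs.
Proof. by case=> L [_ /subset_leq_card le lt]; apply: leq_ltn_trans lt. Qed.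

Lemma nwords_supp cs w : 0 < nwords cs w -> #|supp w| <= weight cs.
Proof.
by move/nwords_gt0=> [/disjoint_stars_weight->|/small_support_lt/ltnW].
Qed.

Lemma disjoint_stars_nwords cs w : disjoint_stars cs w -> nwords cs w = 1%N.
Proof.
elim=> [|{}cs {}w a c dw IH lt_ac aw cw] /=; first by rewrite eqxx.
rewrite (bigD1 a) //= tpermKg IH big1 // => b /andP[lt_bc nba].
(* Another first letter [tperm b c] would have to leave a remainder fixing b, but that remainder
   sends b to a. *)
apply/eqP; rewrite -leqn0 leqNgt; apply/negP=> /nwords_gt0/(star_step lt_bc).
rewrite tpermKg => -[[_ /andP[]]|/small_support_lt]; last first.
  rewrite -(@disjoint_stars_weight (c :: cs) (tperm a c * w)) ?ltnn //.
  by constructor.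
rewrite inE negbK !permM tpermL tpermR.
move: aw; rewrite inE negbK => /eqP-> /eqP e.
by rewrite e eqxx in nba.
Qed.

Lemma cyc_eq0 w : (forall i, cyc w i = 0%N) -> w = 1.
Proof.
move=> w0; apply/permP=> x; rewrite perm1; apply/eqP/negPn/negP=> nx.
case: (@arg_maxnP _ x (mem (porbit w x)) val (porbit_id w x)) => c cx cmax.
have e : porbit w c = porbit w x by apply/eqP; rewrite eq_porbit_mem.
have: 0 < cyc w c; last by rewrite w0.
rewrite cyc_gt0 -card_porbit_gt1 e card_porbit_gt1 inE nx andbT.
by apply/topP=> i; rewrite e => /cmax.
Qed.

(** If c is the largest point of a nontrivial cycle, cutting [w c] out of the cycle lowers the
    exponent at c by one and leaves the other exponents alone. *)
Lemma cyc_disjoint_stars cs w : (forall i, cyc w i = count_mem i cs) ->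
  disjoint_stars cs w.
Proof.
elim: cs w => [|c cs IH] w cw; first by rewrite (cyc_eq0 cw); constructor.
have: 0 < cyc w c by rewrite cw /= eqxx.
rewrite cyc_gt0 inE => /andP[tc wc]; set a := w c.
have lt_ac : a < c by rewrite ltn_neqAle wc (topP _ _ tc) ?porbit_step.
have nac : a != c by [].
pose v := tperm a c * w; have ew : w = tperm a c * v by rewrite tpermKg.
have va : v a = a by rewrite permM tpermL.
have av : a \notin supp v by rewrite inE va eqxx.
have tv : top v c.
  by apply/topP=> i iv; apply: (topP _ _ tc); rewrite ew porbit_insert // !inE iv orbT.
have cv i : cyc v i = count_mem i cs.
  have := cw i; rewrite {1}ew cyc_insert //= eq_sym => /eqP.
  by rewrite eqn_add2l => /eqP.
rewrite ew; constructor=> //; first exact: IH.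
have [cs'|] := boolP (c \in supp v); last by rewrite orbT.
by rewrite -has_pred1 has_count -cv cyc_gt0 tv cs'.
Qed.

Definition centres (f : 'I_n -> nat) : seq 'I_n :=
  flatten [seq nseq (f i) i | i <- enum 'I_n].

Lemma count_centres f i : count_mem i (centres f) = f i.
Proof.
rewrite /centres count_flatten -map_comp sumnE big_map.
rewrite (eq_bigr (fun j => ((j == i) * f j)%N)) => [|j _]; last first.
  by rewrite /= count_nseq /= eq_sym.
rewrite big_enum /= (bigD1 i) //= eqxx mul1n big1 ?addn0 // => j /negPf->.
by rewrite mul0n.
Qed.

Definition xweight (f : 'I_n -> nat) : nat := \sum_i f i + #|[set i | 0 < f i]|.

Lemma weight_centres f : weight (centres f) = xweight f.
Proof.
congr (_ + _).
  rewrite /centres size_flatten /shape -map_comp sumnE big_map big_enum /=.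
  by apply: eq_bigr => i _; rewrite /= size_nseq.
rewrite -(card_uniqP (undup_uniq _)); apply: eq_card => i.
by rewrite mem_undup -has_pred1 has_count count_centres inE.
Qed.

Lemma xweight_perm f (s : 'S_n) : xweight (fun i => f (s i)) = xweight f.
Proof.
congr (_ + _); first by rewrite [RHS](reindex_inj (@perm_inj _ s)).
rewrite -(card_imset _ (@perm_inj _ s)); apply: eq_card => i.
rewrite inE; apply/imsetP/idP=> [[j]|fi]; first by rewrite inE => fj ->.
by exists (s^-1 i); rewrite ?inE permKV.
Qed.

Lemma xweight_cyc w : xweight (cyc w) = #|supp w|.
Proof.
rewrite -weight_centres; apply/esym/disjoint_stars_weight/cyc_disjoint_stars.
by move=> i; rewrite count_centres.
Qed.

Lemma nwords_centres_supp f w : xweight f < #|supp w| -> nwords (centres f) w = 0%N.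
Proof.
rewrite -weight_centres ltnNge => h; apply/eqP; rewrite -leqn0 leqNgt.
by apply: contra h; apply: nwords_supp.
Qed.

Lemma nwords_centres_top f w : xweight f = #|supp w| ->
  nwords (centres f) w = [forall i, f i == cyc w i].
Proof.
move=> ef; case: forallP => [e|ne].
  apply/disjoint_stars_nwords/cyc_disjoint_stars=> i.
  by rewrite count_centres (eqP (e i)).
apply/eqP; rewrite -leqn0 leqNgt; apply/negP=> /nwords_gt0[dw|]; last first.
  by move/small_support_lt; rewrite weight_centres ef ltnn.
by case: ne => i; rewrite (disjoint_stars_cyc dw) count_centres.
Qed.

(** Each cycle has exactly one largest point, so the points on cycles of length k + 1 are fibred
    over the indices where [cyc] is k. *)
Lemma card_orbits_cyc w k : 0 < k ->
  #|[set x | #|porbit w x| == k.+1]| = (#|[set i | cyc w i == k]| * k.+1)%N.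
Proof.
move=> k_gt0; pose mx x := [arg max_(i > x in porbit w x) (i : nat)].
have mxP x : (mx x \in porbit w x) /\ top w (mx x).
  rewrite /mx; case: arg_maxnP => [|c cx cmax]; first exact: porbit_id.
  split=> //; apply/topP=> i; have /eqP-> : porbit w c == porbit w x.
    by rewrite eq_porbit_mem.
  exact: cmax.
have mxE x c : top w c -> (mx x == c) = (x \in porbit w c).
  have [xm tm] := mxP x => tc; apply/eqP/idP=> [<-|xc]; first by rewrite porbit_sym.
  have e : porbit w (mx x) = porbit w c.
    by apply/eqP; rewrite eq_porbit_mem -eq_porbit_mem in xc *; rewrite -(eqP xc).
  apply/val_inj/eqP; rewrite eqn_leq (topP _ _ tc) -?e ?porbit_id //.
  by rewrite (topP _ _ tm) // e porbit_id.
rewrite -sum1_card (partition_big mx (fun i => cyc w i == k)) /=; last first.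
  move=> x; rewrite inE => /eqP ex; have [xm tm] := mxP x; rewrite /cyc tm.
  by move: xm; rewrite -eq_porbit_mem => /eqP->; rewrite ex.
rewrite -sum_nat_const [LHS]big_mkcond [RHS]big_mkcond /=; apply: eq_bigr => c _.
rewrite inE; case: eqP => // ec.
have: 0 < cyc w c by rewrite ec.
rewrite cyc_gt0 => /andP[tc _]; move: ec; rewrite /cyc tc => ec.
have {}ec : #|porbit w c| = k.+1 by rewrite -ec prednK // lt0n card_porbit_neq0.
rewrite -{2}ec -sum1_card; apply: eq_bigl => x; rewrite inE mxE // andbC.
by have [|//] := boolP (x \in _); rewrite -eq_porbit_mem => /eqP->; rewrite ec eqxx.
Qed.

(** Exponents are compared up to a renumbering s of the variables because the polynomials sought are
    symmetric. *)
Lemma conj_of_cyc w v (s : 'S_n) : (forall i, cyc v i = cyc w (s i)) ->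
  exists u, v = w ^ u.
Proof.
move=> e; apply: conj_of_orbit_sizes => -[|[|k]].
- by rewrite !eq_card0 // => x; rewrite inE (negPf (card_porbit_neq0 _ _)).
(* [cyc] is 0 at fixed points and also at points that are not maximal, so fixed points are counted
   as the complement of the support. *)
- have aux (u : 'S_n) : #|[set x | #|porbit u x| == 1%N]| = n - #|supp u|.
    have <- : #|~: supp u| = n - #|supp u|.
      by rewrite cardsCs setCK card_ord.
    apply: eq_card => x; rewrite inE in_setC -card_porbit_gt1.
    by have := card_porbit_neq0 u x; case: #|_| => // -[].
  rewrite !aux -!xweight_cyc -(xweight_perm _ s); congr (_ - _).
  rewrite /xweight; congr (_ + _); first by apply: eq_bigr.
  by apply: eq_card => i; rewrite !inE e.
rewrite !card_orbits_cyc //; congr (_ * _)%N.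
rewrite -[RHS](card_imset _ (@perm_inj _ s)); apply: eq_card => i.
rewrite inE; apply/eqP/imsetP=> [ei|[j]]; last by rewrite inE e => /eqP <- ->.
by exists (s^-1 i); rewrite ?inE ?e ?permKV ?ei.
Qed.

End StarFactorizations.

(** * Perfect matchings *)

Section Matchings.
Variables (T : finType) (t0 : {perm T}).
Hypotheses (t0K : involutive t0) (t0_fpf : forall z, t0 z != z).
Implicit Types (x y g b : {perm T}) (z : T) (X : {set T}).

(* Perfect matchings are the conjugates t0 ^ x; the cycles of matching_diff x
   come in pairs exchanged by t0, one pair for each connected component of the
   union of the matchings t0 and t0 ^ x. *)
Definition matching_diff x : {perm T} := t0 * t0 ^ x.

Lemma matchingK x : involutive (t0 ^ x).
Proof.
have t02 : t0 * t0 = 1 by apply/permP=> z; rewrite permM t0K perm1.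
by move=> z; rewrite -permM -conjMg t02 conj1g perm1.
Qed.

Lemma matching_fpf x z : (t0 ^ x) z != z.
Proof.
rewrite -{1 2}(permKV x z) conjgE !permM permK (inj_eq perm_inj).
exact: t0_fpf.
Qed.

Lemma diffE x z : matching_diff x z = (t0 ^ x) (t0 z).
Proof. exact: permM. Qed.

Lemma diff_t0 x z : t0 (matching_diff x z) = (matching_diff x)^-1 (t0 z).
Proof. by apply: (@perm_inj _ (matching_diff x)); rewrite permKV !diffE t0K matchingK. Qed.

Lemma diffX_t0 x i z : t0 ((matching_diff x ^+ i) z) = (matching_diff x ^- i) (t0 z).
Proof.
elim: i z => [|i IHi] z; first by rewrite invg1 !perm1.
by rewrite [in LHS]expgSr permM diff_t0 IHi -permM -invMg -expgS.
Qed.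

Lemma porbit_diff_t0 x z : porbit (matching_diff x) (t0 z) = [set t0 u | u in porbit (matching_diff x) z].
Proof.
apply/setP=> u; apply/idP/imsetP=> [|[_ /porbitP[i ->] ->]].
  rewrite -porbitV => /porbitP[i ->]; exists ((matching_diff x ^+ i) z); first exact: mem_porbit.
  by rewrite diffX_t0 expgVn.
by rewrite diffX_t0 -expgVn -porbitV mem_porbit.
Qed.

Lemma card_porbit_diff_t0 x z : #|porbit (matching_diff x) (t0 z)| = #|porbit (matching_diff x) z|.
Proof. by rewrite porbit_diff_t0 card_imset //; apply: perm_inj. Qed.

(** If t0 mapped a cycle to itself, it would act on it as a reflection. At the midpoint between z
    and [t0 z], either t0 or [t0 ^ x] would have a fixed point, according to the parity of the
    distance. *)
Lemma t0_notin_porbit x z : t0 z \notin porbit (matching_diff x) z.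
Proof.
apply/negP=> /porbitP[i]; rewrite -(odd_double_half i) addnC.
set j := i./2; set u := (matching_diff x ^+ j) z => e.
have eu : t0 u = (matching_diff x ^- j) (t0 z) by rewrite diffX_t0.
have e2 k : (matching_diff x ^- j) ((matching_diff x ^+ (j.*2 + k)) z) = (matching_diff x ^+ (j + k)) z.
  by rewrite -addnn -addnA -permM [_ + (j + k)]addnC expgD mulgK.
move: eu; rewrite e e2; case: (odd i) => /=.
  rewrite addn1 expgSr permM -/u diffE => e'.
  by have := matching_fpf x (t0 u); rewrite -e' eqxx.
by rewrite addn0 -/u => e'; have := t0_fpf u; rewrite e' eqxx.
Qed.

Definition transversal_for x X :=
  {in X, forall z, matching_diff x z \in X} /\ forall z, (t0 z \in X) = (z \notin X).

(** The enumeration of sets serves to choose one cycle in each pair exchanged by t0. *)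
Definition half_points x : {set T} :=
  [set z | enum_rank (porbit (matching_diff x) z) < enum_rank (porbit (matching_diff x) (t0 z))].

Lemma half_pointsP x : transversal_for x (half_points x).
Proof.
split=> [z|z]; rewrite !inE.
  rewrite diff_t0 (porbit_perm _ 1).
  suff -> : porbit (matching_diff x) ((matching_diff x)^-1 (t0 z)) = porbit (matching_diff x) (t0 z) by [].
  by rewrite -!(porbitV (matching_diff x)) (porbit_perm _ 1).
rewrite t0K -leqNgt [RHS]leq_eqVlt; case: eqP => [/val_inj/enum_rank_inj e|//].
by have := t0_notin_porbit x z; rewrite -e porbit_id.
Qed.

Lemma card_transversal x X : transversal_for x X -> #|X| + #|X| = #|T|.
Proof.
case=> _ XP; rewrite -(cardC (mem X)); congr (_ + _).
rewrite -(card_imset _ (@perm_inj _ t0)); apply: eq_card => z; rewrite !inE /=.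
apply/imsetP/idP=> [[u Xu ->]|nz]; first by rewrite XP Xu.
by exists (t0 z); rewrite ?XP ?t0K.
Qed.

Lemma diff_conj x b : t0 ^ b = t0 -> matching_diff x ^ b = matching_diff (x * b).
Proof. by move=> tb; rewrite /matching_diff conjMg -conjgM tb. Qed.

Lemma diff_inj x y : matching_diff x = matching_diff y -> t0 ^ x = t0 ^ y.
Proof. exact: mulgI. Qed.

Lemma matching_conj x y X Y : transversal_for x X -> transversal_for y Y ->
    (forall k, #|[set z in X | #|porbit (matching_diff x) z| == k]|
             = #|[set z in Y | #|porbit (matching_diff y) z| == k]|) ->
  exists2 b, t0 ^ b = t0 & t0 ^ (x * b) = t0 ^ y.
Proof.
move=> [Xq Xt] [Yq Yt] /(orbit_matching Xq Yq)[f [fY f_inj fq]].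
have Xqi z : z \in X -> (matching_diff x)^-1 z \in X.
  have : matching_diff x @: X = X.
    apply/eqP; rewrite eqEcard card_imset ?leqnn ?andbT; last exact: perm_inj.
    by apply/subsetP=> _ /imsetP[u Xu ->]; apply: Xq.
  by move=> e; rewrite -{1}e => /imsetP[u Xu ->]; rewrite permK.
have fqi z : z \in X -> f ((matching_diff x)^-1 z) = (matching_diff y)^-1 (f z).
  move=> Xz; apply: (@perm_inj _ (matching_diff y)); rewrite permKV -fq ?permKV //.
  exact: Xqi.
pose h z := if z \in X then f z else t0 (f (t0 z)).
have hY z : (h z \in Y) = (z \in X).
  rewrite /h; case: ifP => [/fY //|nz]; rewrite Yt.
  by apply/negbTE; rewrite negbK fY // Xt nz.
have ht z : h (t0 z) = t0 (h z).
  by rewrite /h Xt t0K; case: (z \in X); rewrite ?t0K.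
have hq z : h (matching_diff x z) = matching_diff y (h z).
  have qX : (matching_diff x z \in X) = (z \in X).
    by apply/idP/idP=> [/Xqi|/Xq //]; rewrite permK.
  rewrite {1}/h qX {1}/h; have [Xz|nXz] := boolP (z \in X).
    by rewrite fq // /h Xz.
  have tX : t0 z \in X by rewrite Xt.
  rewrite /= diff_t0 fqi //.
  by apply: (can_inj t0K); rewrite t0K diff_t0 t0K.
have h_inj : injective h.
  move=> z u e; have := hY u; rewrite -e hY => Xzu.
  move: e; rewrite /h Xzu; case: ifP => Xu; first by apply: f_inj; rewrite ?Xzu.
  by move/(can_inj t0K)/f_inj/(can_inj t0K); apply; rewrite Xt ?Xu ?Xzu ?Xu.
have conj_h (u v : {perm T}) : (forall z, h (u z) = v (h z)) -> u ^ perm h_inj = v.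
  by move=> huv; apply: conj_permP => z; rewrite !permE.
have tb : t0 ^ perm h_inj = t0 by apply: conj_h.
exists (perm h_inj) => //; apply: diff_inj; rewrite -diff_conj //.
exact: conj_h.
Qed.

Lemma supp_diff_t0 x z : (t0 z \in supp (matching_diff x)) = (z \in supp (matching_diff x)).
Proof. by rewrite -!card_porbit_gt1 card_porbit_diff_t0. Qed.

(** The difference of g is the commutator of t0 and g, a product of g with a t0-conjugate of its
    inverse. This condition makes the two supports disjoint, and it characterises the g for which
    the commutator moves twice as many points as g. *)
Definition half_perm g := [forall z in supp g, t0 z \notin supp g].

Lemma diff_commutator g z : matching_diff g z = g (t0 (g^-1 (t0 z))).
Proof. by rewrite diffE conjgE !permM. Qed.

Lemma fix_inv g z : z \notin supp g -> g^-1 z = z.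
Proof. by rewrite inE negbK => /eqP {1}<-; rewrite permK. Qed.

Lemma t0_imset (A : {set T}) z : (z \in t0 @: A) = (t0 z \in A).
Proof.
apply/imsetP/idP=> [[u Au ->]|Az]; first by rewrite t0K.
by exists (t0 z); rewrite ?t0K.
Qed.

Lemma supp_diff_sub g : supp (matching_diff g) \subset supp g :|: t0 @: supp g.
Proof.
apply/subsetP=> z; apply: contraLR; rewrite in_setU t0_imset negb_or => /andP[z1 z2].
by rewrite inE diff_commutator fix_inv // t0K negbK; rewrite inE negbK in z1.
Qed.

Lemma card_t0 (A : {set T}) : #|t0 @: A| = #|A|.
Proof. exact/card_imset/perm_inj. Qed.

Lemma leq_supp_diff g : #|supp (matching_diff g)| <= #|supp g|.*2.
Proof.
apply: leq_trans (subset_leq_card (supp_diff_sub g)) _.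
by rewrite -addnn -{2}(card_t0 (supp g)) leq_card_setU.
Qed.

Lemma half_of_card g : #|supp (matching_diff g)| = #|supp g|.*2 -> half_perm g.
Proof.
move=> e; apply/forall_inP=> z gz; apply/negP=> gtz.
have := subset_leq_card (supp_diff_sub g).
rewrite e cardsU card_t0 addnn leqNgt ltn_subrL double_gt0.
rewrite !card_gt0; case/negP; apply/andP; split; apply/set0Pn; exists z => //.
by rewrite inE gz t0_imset.
Qed.

Lemma half_diffL g z : half_perm g -> z \in supp g -> matching_diff g z = g z.
Proof.
move=> /forall_inP hg gz; rewrite diff_commutator fix_inv ?t0K //; exact: hg.
Qed.

Lemma half_supp g : half_perm g -> supp (matching_diff g) = supp g :|: t0 @: supp g.
Proof.
move=> hg; apply/eqP; rewrite eqEsubset supp_diff_sub /=; apply/subsetP=> z.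
have aux u : u \in supp g -> u \in supp (matching_diff g).
  by move=> gu; rewrite inE half_diffL //; rewrite inE in gu.
by rewrite in_setU t0_imset => /orP[/aux //|/aux]; rewrite supp_diff_t0.
Qed.

Lemma card_half g : half_perm g -> #|supp (matching_diff g)| = #|supp g|.*2.
Proof.
move=> hg; rewrite half_supp // -addnn -{2}(card_t0 (supp g)).
apply/eqP; rewrite -cardsUI -[eqbLHS]addn0 eqn_add2l eq_sym cards_eq0.
rewrite -subset0; apply/subsetP=> z; rewrite inE t0_imset => /andP[gz gtz].
by have /forall_inP/(_ z gz) := hg; rewrite gtz.
Qed.

Lemma half_conj g g' u : half_perm g -> half_perm g' -> g' = g ^ u ->
  exists2 b, t0 ^ b = t0 & t0 ^ (g * b) = t0 ^ g'.
Proof.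
(* On this transversal the difference acts as g on [supp g] and trivially elsewhere, so the cycle
   type of g determines that of the matching. *)
pose X g := supp g :|: (half_points g :\: supp (matching_diff g)).
have XP w : half_perm w -> transversal_for w (X w).
  move=> hw; have [hq ht] := half_pointsP w; split=> z; last first.
    rewrite !in_setU !in_setD supp_diff_t0 ht half_supp // in_setU t0_imset.
    have /forall_inP hz := hw.
    have [wz|nwz] := boolP (z \in supp w); first by rewrite (negPf (hz z wz)).
    by case: (t0 z \in supp w).
  rewrite !in_setU !in_setD => /orP[wz|/andP[nz zh]].
    by rewrite half_diffL // supp_stable wz.
  by rewrite supp_stable nz hq // orbT.
have cX w (k : nat) : half_perm w -> k != 1%N ->
    #|[set z in X w | #|porbit (matching_diff w) z| == k]| = #|[set z | #|porbit w z| == k]|.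
  move=> hw k1; have k1' : (1%N == k) = false by rewrite eq_sym; apply/negbTE.
  apply: eq_card => z; rewrite !inE.
  have [wz|nwz] := boolP (w z != z).
    rewrite (@porbit_eq_on _ (matching_diff w) w (supp w)) //=; last by rewrite inE.
      by move=> y wy; rewrite half_diffL // supp_stable.
    by move=> y wy; rewrite half_diffL.
  rewrite negbK in nwz; rewrite (porbit_fix (eqP nwz)) cards1 k1' /=.
  apply/negbTE/negP=> /andP[/andP[/negPn/eqP/porbit_fix-> _]].
  by rewrite cards1 k1'.
have cX1 w : half_perm w -> #|[set z in X w | #|porbit (matching_diff w) z| == 1%N]| = #|X w| - #|supp w|.
  move=> hw; have sX : supp w \subset X w by apply: subsetUl.
  rewrite -(cardsDS sX); apply: eq_card => z; rewrite !inE.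
  have [wz|nwz] /= := boolP (w z != z).
    apply/negbTE; rewrite neq_ltn card_porbit_gt1 inE half_diffL ?wz ?orbT //.
    by rewrite inE.
  case: (boolP (matching_diff w z != z)) => //= /negPn/eqP/porbit_fix->.
  by rewrite cards1 eqxx andbT.
move=> hg hg' eg; apply: (matching_conj (XP g hg) (XP g' hg')) => k.
have cS : #|supp g'| = #|supp g| by rewrite eg card_suppJ.
have cXX : #|X g| = #|X g'|.
  by have := card_transversal (XP g hg); rewrite -(card_transversal (XP g' hg')); lia.
have [->|k1] := eqVneq k 1%N; first by rewrite !cX1 // cXX cS.
rewrite !cX // eg -(card_imset _ (@perm_inj _ u)); apply: eq_card => z.
rewrite inE; apply/imsetP/idP=> [[y]|].
  by rewrite inE => ey ->; rewrite card_porbitJ.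
by rewrite -{1}(permKV u z) card_porbitJ => ez; exists (u^-1 z); rewrite ?inE ?permKV.
Qed.

End Matchings.

Section Halves.
Variables (T : finType) (t0 : {perm T}).
Hypotheses (t0K : involutive t0) (t0_fpf : forall z, t0 z != z).
Implicit Types (x y g b : {perm T}) (z : T).
Local Notation diff := (matching_diff t0).
Local Notation half := (half_perm t0).

Definition halves y : {set {perm T}} := [set g | half g && (t0 ^ g == t0 ^ y)].

Lemma porbit_diff_step x z : porbit (diff x) (t0 (diff x z)) = porbit (diff x) (t0 z).
Proof. by rewrite diff_t0 // -!(porbitV (diff x)) (porbit_perm _ 1). Qed.

Lemma half_points_diff x z : (diff x z \in half_points t0 x) = (z \in half_points t0 x).
Proof. by rewrite !inE porbit_diff_step (porbit_perm _ 1). Qed.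

(* A half with matching t0 ^ y chooses one cycle in each pair of nontrivial
   cycles of diff y exchanged by t0. *)
Lemma card_halves y : exists r, #|halves y| = (2 ^ r)%N.
Proof.
pose q := diff y; pose U := half_points t0 y :&: supp q.
have [hq ht] := half_pointsP t0K t0_fpf y.
have st z : (t0 z \in supp q) = (z \in supp q) by apply: supp_diff_t0.
have Ut z : z \in supp q -> (t0 z \in U) = (z \notin U).
  by move=> qz; rewrite /U !in_setI ht st qz !andbT.
have Us z : z \in U -> z \in supp q by rewrite in_setI => /andP[].
have oq z : porbit q (q z) = porbit q z by apply: (porbit_perm _ 1).
have otq z : porbit q (t0 (q z)) = porbit q (t0 z) by apply: porbit_diff_step.
have Uo z u : porbit q z = porbit q u -> (z \in U) = (u \in U).
  move=> /eqP; rewrite eq_porbit_mem => /porbitP[i ->].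
  elim: i => [|i IHi]; first by rewrite perm1.
  by rewrite expgSr permM -IHi /U !in_setI half_points_diff supp_stable.
have Uq z : (q z \in U) = (z \in U) by apply: Uo.
have Utq z : (t0 (q z) \in U) = (t0 z \in U) by apply: Uo.
pose P := [set porbit q z | z in U]; exists #|P|; rewrite -card_powerset.
(* A cycle in U is selected when it belongs to A, and its mirror image under t0 is selected when it
   does not. The half attached to A follows q on selected cycles and fixes all other points. *)
pose sel (A : {set {set T}}) z := ((z \in U) && (porbit q z \in A))
  || ((t0 z \in U) && (porbit q (t0 z) \notin A)).
have selq A z : sel A (q z) = sel A z by rewrite /sel Uq Utq oq otq.
have g_inj A : injective (fun z => if sel A z then q z else z).
  move=> z u; case: ifP => sz; case: ifP => su e //; first exact: perm_inj e.
    by move: su; rewrite -e selq sz.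
  by move: sz; rewrite e selq su.
pose g A := perm (g_inj A).
have gE A z : g A z = if sel A z then q z else z by rewrite permE.
have selt A z : z \in supp q -> sel A (t0 z) = ~~ sel A z.
  move=> qz; rewrite /sel t0K Ut //; case: (z \in U) => /=; last by rewrite orbF negbK.
  by rewrite orbF.
have selU A z : z \in U -> sel A z = (porbit q z \in A).
  by move=> Uz; rewrite /sel Uz Ut ?Us // Uz orbF.
have gS A z : (z \in supp (g A)) = sel A z && (z \in supp q).
  by rewrite !inE gE; case: (sel A z) => //=; rewrite eqxx.
have suppE h : h \in halves y -> supp q = supp h :|: t0 @: supp h /\ {in supp h, q =1 h}.
  rewrite inE => /andP[hh /eqP e]; have -> : q = diff h by rewrite /q /matching_diff e.
  by split; [apply: half_supp | move=> z; apply: half_diffL].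
rewrite -(card_in_imset (f := g) (D := powerset P)) => [|A B]; last first.
  rewrite !powersetE => /subsetP AP /subsetP BP e; apply/setP=> O.
  apply/idP/idP=> OA.
    have /imsetP[z Uz eO] := AP O OA; rewrite eO -selU //.
    have : z \in supp (g B) by rewrite -e gS selU // -eO OA Us.
    by rewrite gS => /andP[].
  have /imsetP[z Uz eO] := BP O OA; rewrite eO -selU //.
  have : z \in supp (g A) by rewrite e gS selU // -eO OA Us.
  by rewrite gS => /andP[].
apply: eq_card => h; apply/idP/imsetP=> [hh|[A _ ->]].
  have [sq qh] := suppE h hh; move: hh; rewrite inE => /andP[/forall_inP hh _].
  have sub z : z \in supp h -> z \in supp q by move=> hz; rewrite sq inE hz.
  have hq' z u : porbit q z = porbit q u -> z \in supp h -> u \in supp h.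
    move=> /esym/eqP; rewrite eq_porbit_mem => /porbitP[i ->] hz.
    by apply: expg_stable => // w hw; rewrite qh // supp_stable.
  pose A := [set porbit q z | z in U :&: supp h].
  have AP z : z \in U -> (porbit q z \in A) = (z \in supp h).
    move=> Uz; apply/imsetP/idP=> [[u]|hz]; last by exists z; rewrite // in_setI Uz.
    by rewrite in_setI => /andP[_ hu] e; apply: hq' hu.
  exists A; first by rewrite powersetE; apply/imsetS/subsetIl.
  apply/permP=> z; rewrite gE; have [qz|nqz] := boolP (z \in supp q); last first.
    have -> : h z = z by apply/eqP/negPn; apply: contra nqz => hz; apply: sub; rewrite inE.
    by move: nqz; rewrite inE negbK => /eqP->; case: ifP.
  have s : sel A z = (z \in supp h).
    rewrite /sel; have := Ut z qz; case: (boolP (z \in U)) => /= [Uz ->|nUz Utz].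
      by rewrite orbF AP.
    rewrite Utz AP //; move: qz; rewrite sq in_setU t0_imset //.
    have [hz|nhz] := boolP (z \in supp h); last by move=> /= ->.
    by rewrite (hh z hz).
  rewrite s; case: ifP => [hz|]; first by rewrite qh.
  by rewrite inE => /negbT; rewrite negbK => /eqP.
rewrite inE; apply/andP; split.
  by apply/forall_inP=> z; rewrite !gS => /andP[sz qz]; rewrite selt // sz.
apply/eqP/conj_permP=> u; rewrite !gE.
have qE v : q v = (t0 ^ y) (t0 v) by apply: diffE.
have [qu|nqu] := boolP (u \in supp q).
  rewrite selt //; case: (sel A u) => /=.
    by rewrite qE matchingK.
  by rewrite qE t0K.
have q1 v : v \notin supp q -> q v = v by rewrite inE negbK => /eqP.
rewrite !q1 ?st // !if_same -{2}(q1 u nqu) qE matchingK //.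
Qed.

End Halves.

(** * From class functions onto functions on double cosets *)

Section Surjectivity.
Variables (T : finType) (t0 : {perm T}).
Hypotheses (t0K : involutive t0) (t0_fpf : forall z, t0 z != z).
Implicit Types (x y g b : {perm T}) (z : T).
Local Notation diff := (matching_diff t0).
Local Notation half := (half_perm t0).

Local Open Scope ring_scope.
Variable F : fieldType.
Hypothesis char_odd : (2%:R : F) != 0.

(** Functions on the double cosets of the centraliser of t0: the coordinates of endomorphisms of the
    permutation module on matchings. *)
Definition biinvariant (h : {perm T} -> F) :=
  forall b x, (t0 ^ b)%g = t0 -> h (b * x)%g = h x /\ h (x * b)%g = h x.

Lemma half_conjB g b : (t0 ^ b)%g = t0 -> half (g ^ b)%g = half g.
Proof.
move=> tb; have bt z : b (t0 z) = t0 (b z).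
  by rewrite -{2}tb conjgE !permM permK.
apply/forall_inP/forall_inP=> hg z.
  move=> gz; have := hg (b z); rewrite suppJ !(mem_imset, bt) -?bt; last exact: perm_inj.
  by rewrite !mem_imset; [apply | apply: perm_inj].
rewrite suppJ => /imsetP[u gu ->]; rewrite -bt mem_imset; last exact: perm_inj.
exact: hg.
Qed.

Lemma biinvariant_matching h x y : biinvariant h -> (t0 ^ x)%g = (t0 ^ y)%g -> h x = h y.
Proof.
move=> hB e; rewrite -(mulgKV y x).
by have [|-> //] := hB (x * y^-1)%g y; rewrite conjgM e conjgK.
Qed.

Lemma card_halvesB b y : (t0 ^ b)%g = t0 ->
  #|halves t0 (b * y)%g| = #|halves t0 y| /\ #|halves t0 (y * b)%g| = #|halves t0 y|.
Proof.
move=> tb; split.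
  by congr #|pred_of_set _|; apply/setP=> g; rewrite !inE [(t0 ^ (b * y))%g]conjgM tb.
rewrite -[RHS](card_imset _ (@conjg_inj _ b)); apply: eq_card => g.
rewrite -(conjgKV b g); move: (g ^ b^-1)%g => {}g.
have -> : (g ^ b \in [set (x ^ b)%g | x in halves t0 y])%g = (g \in halves t0 y).
  by apply: (@mem_imset _ _ (conjg^~ b)); apply: conjg_inj.
rewrite !inE half_conjB //; congr (_ && _).
by rewrite -{1}tb -conjJg conjgM (inj_eq (@conjg_inj _ b)).
Qed.

(** This count is the diagonal entry of the triangular system solved below. *)
Lemma sum_halves y : (\sum_(b | (t0 ^ b)%g == t0) half (b * y)%g)%N = #|halves t0 y|.
Proof.
rewrite -sum1_card big_mkcond [RHS](reindex_inj (mulIg y)) /= [RHS]big_mkcond /=.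
apply: eq_bigr => b _; rewrite inE conjgM (inj_eq (@conjg_inj _ y)).
by case: eqP => _; rewrite ?andbT ?andbF //; case: half.
Qed.

(** Descending induction on the largest number N of points moved by [diff y] with h y nonzero. As
    [diff g] moves at most twice as many points as g, with equality only for halves, a class
    function supported on classes of halves with N/2 moved points corrects h at level N and leaves
    higher levels untouched. *)
Lemma class_function_of_biinvariant (h : {perm T} -> F) : biinvariant h ->
  exists2 z : {perm T} -> F, forall w g, z (w ^ g)%g = z w &
    forall y, h y = \sum_(b | (t0 ^ b)%g == t0) z (b * y)%g.
Proof.
move=> hB; have: forall y, (#|T|.+1 <= #|supp (diff y)|)%N -> h y = 0.
  by move=> y; rewrite ltnNge max_card.
move: _.+1 => N; elim: N => [|N IHN] in h hB * => h0.
  exists (fun=> 0) => // y; rewrite h0 // big1 //.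
pose P g g' := [&& [exists u, g' == (g ^ u)%g], half g' & #|supp (diff g')| == N].
(* The sum over b meets the chosen class once for each half with the matching of y; their number is
   a power of 2, hence invertible. *)
pose h' y := h y / #|halves t0 y|%:R.
have h'B : biinvariant h'.
  move=> b x tb; have [h1 h2] := hB b x tb; have [c1 c2] := card_halvesB x tb.
  by rewrite /h' h1 h2 c1 c2.
(* [P g] depends only on the class of g, so z is a class function whatever [pick] returns;
   [half_conj] shows that the value does not depend on the half chosen. *)
pose z g : F := if [pick g' | P g g'] is Some g' then h' g' else 0.
have zJ w g : z (w ^ g)%g = z w.
  rewrite /z (@eq_pick _ _ (P w)) // => g'; congr (_ && _).
  apply/existsP/existsP=> -[u /eqP->]; first by exists (g * u)%g; rewrite conjgM.
  by exists (g^-1 * u)%g; rewrite conjgM conjgK.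
pose S y := \sum_(b | (t0 ^ b)%g == t0) z (b * y)%g.
have diffB b y : (t0 ^ b)%g = t0 -> diff (b * y)%g = diff y.
  by move=> tb; rewrite /matching_diff conjgM tb.
(* A conjugate half g' forces g to move N/2 points, so the lower bound N on [diff g] is attained and
   g is itself a half. *)
have zE g : (N <= #|supp (diff g)|)%N ->
    z g = if half g && (#|supp (diff g)| == N) then h' g else 0.
  move=> leN; rewrite /z; case: pickP => [g'|/(_ g)]; last first.
    by rewrite /P => /negbT; rewrite negb_and; case: existsP => [_ /negPf-> //|[]];
       exists 1%g; rewrite conjg1.
  case/and3P=> /existsP[u /eqP eg] hg' /eqP eN.
  have e : (#|supp g|.*2 = N)%N by rewrite -eN card_half // eg card_suppJ.
  have e2 : #|supp (diff g)| = N.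
    by apply/eqP; rewrite eqn_leq leN andbT -e leq_supp_diff.
  have hg : half g by apply: half_of_card; rewrite // e2 e.
  rewrite hg e2 eqxx; have [b tb tgb] := half_conj t0K t0_fpf hg hg' eg.
  by rewrite -(biinvariant_matching h'B tgb); have [_ ->] := h'B b g tb.
have SE y : (N <= #|supp (diff y)|)%N -> h y = S y.
  move=> leN; rewrite /S (eq_bigr (fun b =>
      if half (b * y)%g && (#|supp (diff y)| == N) then h' y else 0)); last first.
    move=> b /eqP tb; rewrite zE diffB //; case: ifP => // _.
    by have [-> _] := h'B b y tb.
  have [eN|nN] := eqVneq; last first.
    rewrite h0 ?ltn_neqAle 1?eq_sym ?nN // big1 // => b _.
    by rewrite andbF.
  rewrite (eq_bigr (fun b => h' y *+ half (b * y)%g)) => [|b _]; last first.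
    by rewrite andbT; case: half.
  rewrite sumrMnr sum_halves -[RHS]mulr_natr /h' divfK //.
  have [r ->] := card_halves t0K t0_fpf y.
  by rewrite natrX expf_neq0.
have SB : biinvariant S.
  move=> b x tb; have tb' : (t0 ^ b^-1)%g = t0 by rewrite -{1}tb conjgK.
  split.
    rewrite /S [RHS](reindex_inj (mulIg b)) /=; apply: eq_big => [u|u _].
      by rewrite conjgM; have := inj_eq (@conjg_inj _ b) (t0 ^ u)%g t0; rewrite /= tb.
    by rewrite mulgA.
  rewrite /S [RHS](reindex_inj (mulgI b)) /=; apply: eq_big => [u|u _].
    by rewrite conjgM tb.
  by rewrite -[RHS](zJ _ b) conjgE !mulgA mulVg mul1g.
have [|y leN|z' z'J z'E] := IHN (fun y => h y - S y).
- move=> b x tb; have [h1 h2] := hB b x tb; have [s1 s2] := SB b x tb.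
  by rewrite h1 h2 s1 s2.
- by rewrite SE // subrr.
exists (fun g => z g + z' g) => [w g|y]; first by rewrite zJ z'J.
by rewrite big_split /= -z'E -/(S y) subrKC.
Qed.

End Surjectivity.

(** * Even partitions as types of matchings *)

Section PartitionsAndTypes.

Local Open Scope nat_scope.

Lemma partition_of_seq n (s : seq nat) : sumn s = n -> size s <= n ->
  exists la : partition_of n, forall v, 0 < v -> #|[set i | part la i == v]| = count_mem v s.
Proof.
move=> sum_s size_s; pose s' := sort geq (s ++ nseq (n - size s) 0).
have ps : perm_eq s' (s ++ nseq (n - size s) 0) by rewrite perm_sort.
have sz : size s' = n by rewrite (perm_size ps) size_cat size_nseq subnKC.
have le v : v \in s' -> v <= n.
  rewrite (perm_mem ps) mem_cat => /orP[vs|/nseqP[->] //].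
  by rewrite -sum_s sumnE (big_rem v) //= leq_addr.
pose l : n.-tuple 'I_n.+1 := [tuple inord (nth 0 s' i) | i < n].
have lE i : tnth l i = nth 0 s' i :> nat.
  by rewrite tnth_mktuple inordK // ltnS le // mem_nth // sz.
have ml : map val l = s'.
  apply: (@eq_from_nth _ 0); rewrite size_map size_tuple ?sz // => i lt_i.
  rewrite (nth_map ord0) ?size_tuple // -[i]/(val (Ordinal lt_i)) -tnth_nth.
  exact: lE.
have Pl : is_partition l.
  rewrite /is_partition ml; apply/andP; split.
    by apply: sort_sorted => a b; rewrite /= orbC leq_total.
  apply/eqP; rewrite -[RHS]sum_s; transitivity (sumn s'); last first.
    by rewrite (perm_sumn ps) sumn_cat sumn_nseq mul0n addn0.
  by rewrite -ml sumnE big_map big_tuple.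
exists (exist _ l Pl) => v v_gt0; transitivity (count_mem v s').
  rewrite -ml count_map -sum1_count big_tuple -sum1_card; apply: eq_bigl => i.
  by rewrite inE.
by rewrite (seq.permP ps) count_cat count_nseq /= eq_sym (gtn_eqF v_gt0) mul0n addn0.
Qed.

Section MatchingType.
Variables (n : nat) (t0 : 'S_n).
Hypotheses (t0K : involutive t0) (t0_fpf : forall z, t0 z != z).
Implicit Types (x y b : 'S_n) (z : 'I_n).
Local Notation X := (half_points t0).

Definition half_orbits x : {set {set 'I_n}} := [set porbit (matching_diff t0 x) z | z in X x].

Lemma sum_half_orbits x (f : {set 'I_n} -> nat) :
  \sum_(z in X x) f (porbit (matching_diff t0 x) z) = \sum_(O in half_orbits x) #|O| * f O.
Proof.
have [hq _] := half_pointsP t0K t0_fpf x.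
rewrite (partition_big (porbit (matching_diff t0 x)) (mem (half_orbits x))) /=; last first.
  by move=> z Xz; apply: imset_f.
apply: eq_bigr => _ /imsetP[z Xz ->]; rewrite -sum_nat_const.
apply: eq_big => [u|u /andP[_ /eqP-> //]].
apply/andP/idP=> [[_ /eqP <-]|uz]; first exact: porbit_id.
split; first by apply: (subsetP (porbit_sub hq Xz)).
by rewrite eq_porbit_mem.
Qed.

Lemma card_half_orbits x k : #|[set z in X x | #|porbit (matching_diff t0 x) z| == k]|
  = k * #|[set O in half_orbits x | #|O| == k]|.
Proof.
rewrite -sum1_card; transitivity (\sum_(z in X x) (#|porbit (matching_diff t0 x) z| == k)).
  by rewrite big_mkcond [RHS]big_mkcond; apply: eq_bigr => z _; rewrite inE; case: (z \in _); case: eqP.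
rewrite (sum_half_orbits x (fun O => #|O| == k)) -sum1_card big_distrr /= [LHS]big_mkcond [RHS]big_mkcond.
apply: eq_bigr => O _; rewrite inE; case: (O \in _) => //=.
by case: eqP => [->|]; rewrite ?muln0.
Qed.

(** The part attached to a cycle also counts its mirror image under t0; hence the doubling, and the
    parts sum to n. *)
Lemma exists_matching_type x : exists2 la : partition_of n, even_partition la &
  forall k, 0 < k ->
    #|[set i | part la i == k.*2]| = #|[set O in half_orbits x | #|O| == k]|.
Proof.
have [hq _] := half_pointsP t0K t0_fpf x.
have sX : \sum_(O in half_orbits x) #|O| = #|X x|.
  have := sum_half_orbits x (fun=> 1); rewrite sum1_card => ->.
  by apply: eq_bigr => O _; rewrite muln1.
have cX := card_transversal t0K (half_pointsP t0K t0_fpf x); rewrite card_ord in cX.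
pose s := map (fun O : {set 'I_n} => #|O|.*2) (enum (half_orbits x)).
have sum_s : sumn s = n.
  rewrite sumnE big_map -[RHS]cX addnn -sX big_enum /= -mul2n big_distrr.
  by apply: eq_bigr => O _; rewrite /= mul2n.
have size_s : size s <= n.
  rewrite size_map -cardE -[X in _ <= X]sum_s -sum1_card sumnE big_map big_enum /=.
  apply: leq_sum => _ /imsetP[z _ ->]; rewrite double_gt0 lt0n; exact: card_porbit_neq0.
have [la laE] := partition_of_seq sum_s size_s.
exists la => [|k k_gt0]; last first.
  rewrite laE ?double_gt0 // count_map -sum1_count big_enum_cond -sum1_card.
  by apply: eq_bigl => O; rewrite inE /= (inj_eq double_inj).
apply/forallP=> i; have [->//|nz] := eqVneq (part la i) 0.
have : 0 < count_mem (part la i) s.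
  by rewrite -laE ?lt0n // -lt0n card_gt0; apply/set0Pn; exists i; rewrite inE.
by rewrite -has_count has_pred1 => /mapP[O _ ->]; rewrite odd_double.
Qed.

(** Bounds the number of double cosets of the centraliser of t0 by the number of even partitions. *)
Lemma matching_types : exists2 ty : 'S_n -> partition_of n,
  forall x, even_partition (ty x) &
  forall x y, ty x = ty y ->
    exists2 b, (t0 ^ b)%g = t0 & (t0 ^ (x * b))%g = (t0 ^ y)%g.
Proof.
have [ty tyE tyP] := fin_all_exists2 exists_matching_type.
exists ty => // x y e.
apply: (matching_conj t0K (half_pointsP t0K t0_fpf x) (half_pointsP t0K t0_fpf y)) => k.
rewrite !card_half_orbits; case: k => [|k]; first by rewrite !mul0n.
by rewrite -!tyP // e.
Qed.

End MatchingType.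

End PartitionsAndTypes.

Local Open Scope ring_scope.

(** * Jucys-Murphy elements and the centre of the group algebra *)

(** The relations are those of a degenerate affine Hecke algebra. They make s commute with x + y and
    x y, hence with all power sums by Newton's recursion, and the expression is a power of x y times
    a power sum. *)
Lemma comm_symmetric_pair (A : pzRingType) (x y s : A) a b :
    GRing.comm x y -> s * x = y * s - 1 -> s * y = x * s + 1 ->
  GRing.comm s (x ^+ a * y ^+ b + x ^+ b * y ^+ a).
Proof.
move=> cxy sx sy.
have csp : GRing.comm s (x * y).
  rewrite /GRing.comm mulrA sx mulrBl -mulrA sy mulrDr mulrA mulr1 mul1r -cxy.
  by rewrite addrK.
have css : GRing.comm s (x + y).
  by rewrite /GRing.comm mulrDr sx sy addrACA addNr addr0 -mulrDl addrC.
have cpow d : GRing.comm s (x ^+ d + y ^+ d) /\ GRing.comm s (x ^+ d.+1 + y ^+ d.+1).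
  elim: d => [|d [IH0 IH1]].
    by split; [apply: commrD; apply: commr1 | rewrite !expr1].
  split=> //.
  have ->: x ^+ d.+2 + y ^+ d.+2 =
    (x + y) * (x ^+ d.+1 + y ^+ d.+1) - (x * y) * (x ^+ d + y ^+ d).
    have e1 : x * y * x ^+ d = y * x ^+ d.+1 by rewrite cxy -mulrA -exprS.
    have e2 : x * y * y ^+ d = x * y ^+ d.+1 by rewrite -mulrA -exprS.
    rewrite [X in _ - X]mulrDr e1 e2 mulrDl !mulrDr -!exprS.
    apply/esym/eqP; rewrite subr_eq; apply/eqP.
    by rewrite [X in _ + X = _]addrC addrACA; congr (_ + _); rewrite addrC.
  by apply: commrB; apply: commrM.
wlog le_ab : a b / (a <= b)%N.
  by move=> IH; case/orP: (leq_total a b) => /IH //; rewrite addrC.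
have -> : x ^+ a * y ^+ b + x ^+ b * y ^+ a
        = (x * y) ^+ a * (x ^+ (b - a) + y ^+ (b - a)).
  have cX : y ^+ a * x ^+ (b - a) = x ^+ (b - a) * y ^+ a.
    exact/commrX/commr_sym/commrX/commr_sym/commr_sym.
  by rewrite exprMn_comm // mulrDr -!mulrA cX mulrA -!exprD subnKC // addrC.
apply: commrM; first exact: commrX.
by have [] := cpow (b - a)%N.
Qed.

Section JucysMurphy.
Variables (n : nat) (A : pzRingType) (rho : 'S_n -> A).
Hypotheses (rho1 : rho 1%g = 1) (rhoM : {morph rho : g h / (g * h)%g >-> g * h}).
Implicit Types (g w : 'S_n) (i j k : 'I_n).

Definition jm k : A := \sum_(a : 'I_n | (a < k)%N) rho (tperm a k).

Lemma rho_sqr a b : rho (tperm a b) * rho (tperm a b) = 1.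
Proof. by rewrite -rhoM tperm2 rho1. Qed.

Lemma rho_jm g k : rho g * jm k = \sum_(a : 'I_n | (a < k)%N) rho (tperm ((g^-1)%g a) ((g^-1)%g k)) * rho g.
Proof.
rewrite /jm mulr_sumr; apply: eq_bigr => a _.
by rewrite -!rhoM -tpermJ conjgE invgK mulgA mulgKV.
Qed.

Lemma comm_rho_jm g k : g k = k -> (forall a : 'I_n, (a < k)%N = (g a < k)%N) ->
  GRing.comm (rho g) (jm k).
Proof.
move=> gk gP; rewrite /GRing.comm rho_jm -mulr_suml; congr (_ * _).
rewrite (reindex_inj (@perm_inj _ g)) /=; apply: eq_big => a; first by rewrite -gP.
by move=> _; rewrite (permK g) -[X in (g^-1)%g X]gk (permK g).
Qed.

Lemma comm_jm j k : GRing.comm (jm j) (jm k).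
Proof.
wlog lt_jk: j k / (j < k)%N => [IH|].
  case: (ltngtP j k) => [/IH//|/IH/commr_sym//|/val_inj->]; exact: commr_refl.
apply/commr_sym/commr_sum => a lt_aj; apply/commr_sym/comm_rho_jm.
  by rewrite tpermD // neq_ltn ?lt_jk // (ltn_trans lt_aj).
move=> b; have lt_ak := ltn_trans lt_aj lt_jk.
by case: tpermP => [->|->|//]; rewrite lt_jk lt_ak.
Qed.

Definition jm_mon (f : 'I_n -> nat) : A := \prod_k jm k ^+ f k.

Lemma jm_mon_centres f : jm_mon f = \prod_(c <- centres f) jm c.
Proof.
rewrite /centres big_flatten big_map /jm_mon enumT [index_enum _]unlock; apply: eq_bigr => k _.
by rewrite big_nseq; elim: (f k) => [|m IHm]; rewrite ?expr0 // exprS IHm.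
Qed.

Lemma prod_jm cs : \prod_(c <- cs) jm c = \sum_w rho w *+ nwords cs w.
Proof.
elim: cs => [|c cs IH].
  rewrite big_nil (bigD1 1%g) //= eqxx mulr1n rho1 big1 ?addr0 //.
  by move=> w /negPf->; rewrite mulr0n.
rewrite big_cons {}IH /jm mulr_suml /=.
rewrite [RHS](eq_bigr (fun w => \sum_(a : 'I_n | (a < c)%N)
    rho w *+ nwords cs (tperm a c * w)%g)) => [|w _]; last by rewrite sumrMnr.
rewrite [RHS]exchange_big; apply: eq_bigr => a _.
rewrite [RHS](reindex_inj (mulgI (tperm a c))) mulr_sumr; apply: eq_bigr => w _.
by rewrite tpermKg mulrnAr rhoM.
Qed.

Section AdjacentTransposition.
Variables (k k' : 'I_n) (kk' : k' = k.+1 :> nat).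
Let s := tperm k k'.

Lemma adj_jm : rho s * jm k = jm k' * rho s - 1.
Proof.
have nk : k != k' by rewrite -val_eqE /= kk' neq_ltn ltnSn.
have lt : (k < k')%N by rewrite kk'.
have -> : jm k' = rho s + \sum_(a : 'I_n | (a < k')%N && (a != k)) rho (tperm a k').
  by rewrite /jm (bigD1 k).
rewrite rho_jm -mulr_suml tpermV tpermL.
rewrite mulrDl rho_sqr addrC addKr; congr (_ * _).
apply: eq_big => a; first by rewrite kk' ltnS ltn_neqAle andbC.
move=> lta; rewrite tpermD //; first by rewrite neq_ltn lta orbT.
by rewrite neq_ltn (ltn_trans lta lt) orbT.
Qed.

Lemma adj_jm' : rho s * jm k' = jm k * rho s + 1.
Proof.
have := congr1 (fun x => rho s * x * rho s) adj_jm.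
rewrite mulrA rho_sqr mul1r mulrBr mulrBl mulr1 rho_sqr -!mulrA rho_sqr mulr1.
by move->; rewrite subrK.
Qed.

Lemma adj_jmD j : j != k -> j != k' -> GRing.comm (rho s) (jm j).
Proof.
move=> nk nk'; apply: comm_rho_jm => [|a]; first by rewrite tpermD // eq_sym.
have e : (k < j)%N = (k' < j)%N.
  apply/idP/idP; last by apply: ltn_trans; rewrite kk'.
  by rewrite kk' leq_eqVlt => /orP[/eqP e|//]; rewrite -val_eqE /= kk' e eqxx in nk'.
by case: tpermP => [->|->|//]; rewrite e.
Qed.

Definition nat_ext (V : Type) (v0 : V) (F : 'I_n -> V) (i : nat) : V :=
  if insub i is Some j then F j else v0.

Lemma nat_extE V v0 (F : 'I_n -> V) j : nat_ext v0 F j = F j.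
Proof. by rewrite /nat_ext valK. Qed.

(** The remaining factors commute with s, so the product in index order reduces to the two adjacent
    factors treated by [comm_symmetric_pair]. *)
Lemma comm_adj_jm_mon f :
  GRing.comm (rho s) (jm_mon f + jm_mon (fun i => f (s i))).
Proof.
pose J := nat_ext 0 jm; pose e (f : 'I_n -> nat) := nat_ext 0%N f.
have E h : jm_mon h = \prod_(0 <= i < n) J i ^+ e h i.
  by rewrite big_mkord; apply: eq_bigr => i _; rewrite /J /e !nat_extE.
have ltk : (k < n)%N by []. have ltk' : (k.+1 < n)%N by rewrite -kk'.
have split h : jm_mon h = (\prod_(0 <= i < k) J i ^+ e h i) *
    ((jm k ^+ h k * jm k' ^+ h k') * \prod_(k.+2 <= i < n) J i ^+ e h i).
  rewrite E (@big_cat_nat _ _ _ k) //=; last exact: ltnW.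
  congr (_ * _); rewrite big_ltn // big_ltn // mulrA.
  by rewrite -kk' /J /e !nat_extE.
have out (a b : nat) : (b <= k)%N || (k.+1 < a)%N -> (b <= n)%N ->
    \prod_(a <= i < b) J i ^+ e (fun i => f (s i)) i = \prod_(a <= i < b) J i ^+ e f i
    /\ GRing.comm (rho s) (\prod_(a <= i < b) J i ^+ e f i).
  move=> ab bn; have sub (i : nat) : (a <= i < b)%N -> exists2 j : 'I_n, i = j :> nat & (j != k) && (j != k').
    move=> iab; have lt : (i < n)%N by case/andP: iab => _ /leq_trans->.
    exists (Ordinal lt) => //.
    apply/andP; split; apply/eqP=> /(congr1 val) /=.
      by move: ab iab; lia.
    by rewrite kk'; move: ab iab; lia.
  split; first apply: eq_big_nat => i /sub[j -> /andP[jk jk']].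
    by rewrite /J /e !nat_extE tpermD // eq_sym.
  rewrite big_nat_cond; apply: commr_prod => i; rewrite andbT => /sub[j -> /andP[jk jk']].
  by rewrite /J nat_extE; apply/commrX/adj_jmD.
have [e1 c1] := out 0%N k (@introT _ _ orP (or_introl (leqnn k))) (ltnW ltk).
have [e2 c2] := out k.+2 n (@introT _ _ orP (or_intror (ltnSn k.+1))) (leqnn n).
rewrite !split e1 e2 -mulrDr -mulrDl tpermL tpermR; apply: commrM => //.
apply: commrM => //; apply: comm_symmetric_pair; first exact: comm_jm.
  exact: adj_jm.
exact: adj_jm'.
Qed.

End AdjacentTransposition.

Lemma comm_rho_generated (X : A) :
    (forall k k' : 'I_n, k' = k.+1 :> nat -> GRing.comm (rho (tperm k k')) X) ->
  forall g, GRing.comm (rho g) X.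
Proof.
move=> cX.
have cM g h : GRing.comm (rho g) X -> GRing.comm (rho h) X ->
    GRing.comm (rho (g * h)%g) X.
  by move=> cg ch; rewrite rhoM; apply/commr_sym/commrM; apply/commr_sym.
(* A transposition at distance d + 1 is the conjugate of one at distance d by an adjacent
   transposition. *)
have cT (d : nat) (i j : 'I_n) : (j = i + d :> nat)%N -> GRing.comm (rho (tperm i j)) X.
  elim: d i j => [|d IH] i j ij.
    have -> : i = j by apply/val_inj; rewrite /= ij addn0.
    by rewrite tperm1 rho1; apply/commr_sym/commr1.
  have lt : (i + d < n)%N by rewrite (leq_trans _ (ltn_ord j)) // ij addnS.
  pose j' := Ordinal lt.
  have cj : GRing.comm (rho (tperm j' j)) X by apply: cX; rewrite ij addnS.
  have [->|nij'] := eqVneq i j'; first exact: cj.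
  have nij : i != j by rewrite -val_eqE /= neq_ltn ij addnS ltnS leq_addr.
  have -> : tperm i j = (tperm j' j * (tperm i j' * tperm j' j))%g.
    rewrite -{1}(tpermV j' j) -conjgE tpermJ tpermL tpermD // eq_sym //.
  by apply: (cM) => //; apply: cM => //; apply: IH.
move=> g; have [ts -> _] := prod_tpermP g.
elim: ts => [|t ts IH]; first by rewrite big_nil rho1; apply/commr_sym/commr1.
rewrite big_cons; apply: cM => //; case: (leqP t.1 t.2) => [le|/ltnW le].
  by apply: (cT (t.2 - t.1)%N); rewrite subnKC.
by rewrite tpermC; apply: (cT (t.1 - t.2)%N); rewrite subnKC.
Qed.

End JucysMurphy.

(** * Class functions as symmetric polynomials in the Jucys-Murphy elements *)

Section SymmetricPolynomials.
Variable n : nat.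
Implicit Types (s g w : 'S_n).

(** Exponents up to n suffice, since [cyc w i] is at most n, and they leave only finitely many
    monomials. *)
Local Notation expo := {ffun 'I_n -> 'I_n.+1}.
Implicit Types (f : expo) (a : expo -> int).

Definition fperm s f : expo := [ffun i => f (s i)].

Definition symmetric_coefs a := forall s f, a (fperm s f) = a f.

Definition monomial (R : comPzRingType) (c : 'I_n -> R) f : R := \prod_i c i ^+ f i.

Definition poly_eval (R : comPzRingType) a (c : 'I_n -> R) : R :=
  \sum_f monomial c f *~ a f.

(** The coefficient of w when the polynomial with coefficients a is evaluated at the Jucys-Murphy
    elements. *)
Definition word_coef a w : int :=
  \sum_f a f *+ nwords (centres (fun i => f i)) w.

Lemma fperm_inj s : injective (fperm s).
Proof.
move=> f1 f2 /ffunP e; apply/ffunP=> i; have := e ((s^-1)%g i).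
by rewrite !ffunE permKV.
Qed.

Lemma poly_eval_perm (R : comPzRingType) a s (c : 'I_n -> R) :
  symmetric_coefs a -> poly_eval a (fun i => c (s i)) = poly_eval a c.
Proof.
move=> sym_a; rewrite /poly_eval (reindex_inj (@fperm_inj s)) /=.
apply: eq_bigr => f _; rewrite sym_a /monomial; congr (_ *~ _).
rewrite [RHS](reindex_inj (@perm_inj _ s)) /=.
by apply: eq_bigr => i _; rewrite ffunE.
Qed.

Lemma eq_poly_eval (R : comPzRingType) a (c c' : 'I_n -> R) :
  c =1 c' -> poly_eval a c = poly_eval a c'.
Proof.
move=> e; apply: eq_bigr => f _; congr (_ *~ _).
by apply: eq_bigr => i _; rewrite e.
Qed.

Lemma rmorph_poly_eval (R S : comPzRingType) (h : {rmorphism R -> S}) a (c : 'I_n -> R) :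
  h (poly_eval a c) = poly_eval a (fun i => h (c i)).
Proof.
rewrite rmorph_sum; apply: eq_bigr => f _; rewrite rmorphMz rmorph_prod.
by congr (_ *~ _); apply: eq_bigr => i _; rewrite rmorphXn.
Qed.

Lemma sum_jm_mon (A : pzRingType) (rho : 'S_n -> A) a :
    rho 1%g = 1 -> {morph rho : g h / (g * h)%g >-> g * h} ->
  \sum_(f : expo) jm_mon rho (fun i => f i) *~ a f = \sum_w rho w *~ word_coef a w.
Proof.
move=> rho1 rhoM; rewrite [RHS](eq_bigr (fun w => \sum_(f : expo)
    rho w *+ nwords (centres (fun i => f i)) w *~ a f)) => [|w _]; last first.
  rewrite mulrz_sumr; apply: eq_bigr => f _.
  by rewrite -mulr_natr natz mulrC mulrzA.
rewrite exchange_big; apply: eq_bigr => f _ /=.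
by rewrite jm_mon_centres prod_jm // mulrz_suml.
Qed.

Lemma comm_sum_jm_mon (A : pzRingType) (rho : 'S_n -> A) a :
    rho 1%g = 1 -> {morph rho : g h / (g * h)%g >-> g * h} ->
    (forall x : A, x *+ 2 = 0 -> x = 0) -> symmetric_coefs a ->
  forall g, GRing.comm (rho g) (\sum_(f : expo) jm_mon rho (fun i => f i) *~ a f).
Proof.
move=> rho1 rhoM tf sym_a; set X := \sum_(f : expo) _.
apply: comm_rho_generated => // k k' kk'; set s := tperm k k'.
(* Doubling X pairs each monomial with its image under s; the factor 2 is cancelled afterwards by
   [tf]. *)
have: GRing.comm (rho s) (X *+ 2).
  rewrite mulr2n {2}/X (reindex_inj (@fperm_inj s)) -big_split /=.
  apply: commr_sum => f _; rewrite sym_a -mulrzDl; apply: commrMz.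
  have -> : jm_mon rho (fun i => fperm s f i) = jm_mon rho (fun i => f (s i)).
    by apply: eq_bigr => i _; rewrite ffunE.
  exact: (comm_adj_jm_mon rho1 rhoM kk' (fun i => f i)).
rewrite /GRing.comm mulrnAr mulrnAl => /eqP; rewrite -subr_eq0 -mulrnBl => /eqP/tf/eqP.
by rewrite subr_eq0 => /eqP.
Qed.

Lemma regular_coef (R : comUnitRingType) (z : 'S_n -> R) w :
  (\sum_g z g *: regular_repr R (SymGroup n) g)
     (gring_index (SymGroup n) 1) (gring_index (SymGroup n) w) = z w.
Proof.
rewrite summxE (bigD1 w) //= big1 ?addr0 => [|g ngw].
  by rewrite !mxE gring_indexK ?group1 // mul1g !eqxx mulr1.
rewrite !mxE gring_indexK ?group1 // mul1g eqxx /=.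
case: eqP => [/(congr1 enum_val)|_]; last by rewrite mulr0.
by rewrite !gring_indexK ?inE // => e; rewrite e eqxx in ngw.
Qed.

(** The evaluated polynomial is central. In the rational regular representation group elements are
    linearly independent, so its integral coefficients can be compared there. *)
Lemma word_coef_class a w g : symmetric_coefs a -> word_coef a (w ^ g)%g = word_coef a w.
Proof.
move=> sym_a; pose rho := regular_repr rat (SymGroup n) : 'S_n -> 'M_ _.
have rho1 : rho 1%g = 1 by apply: repr_mx1.
have rhoM : {morph rho : g h / (g * h)%g >-> g * h}.
  by move=> x y; rewrite /rho repr_mxM ?in_setT.
have tf (x : 'M[rat]_#|SymGroup n|) : x *+ 2 = 0 -> x = 0.
  by move/eqP; rewrite -scaler_nat scaler_eq0 => /orP[//|/eqP].
have := comm_sum_jm_mon rho1 rhoM tf sym_a (g^-1)%g.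
rewrite sum_jm_mon // => /(congr1 (fun x => x * rho g)).
rewrite -[RHS]mulrA -rhoM mulVg rho1 mulr1 => e.
have {}e : \sum_x (word_coef a (x ^ g^-1)%g)%:~R *: rho x
         = \sum_x (word_coef a x)%:~R *: rho x.
  rewrite (reindex_inj (@conjg_inj _ g)) /=.
  transitivity (\sum_w rho w *~ word_coef a w); last first.
    by apply: eq_bigr => x _; rewrite scaler_int.
  rewrite -e mulr_sumr mulr_suml; apply: eq_bigr => x _.
  by rewrite conjgK scaler_int mulrzAr mulrzAl -!rhoM conjgE mulgA.
have := regular_coef (fun x => (word_coef a (x ^ g^-1)%g)%:~R : rat) (w ^ g)%g.
rewrite e regular_coef conjgK => /eqP; rewrite eqr_int => /eqP.
exact.
Qed.

(* Triangularity with respect to the number of moved points: by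
   nwords_centres_top the leading coefficients are 0 or 1. *)
Theorem class_function_word_coef (z : 'S_n -> int) :
    (forall w g, z (w ^ g)%g = z w) ->
  exists2 a, symmetric_coefs a & forall w, z w = word_coef a w.
Proof.
move=> zJ.
have: forall w, (n.+1 <= #|supp w|)%N -> z w = 0.
  by move=> w; rewrite ltnNge (leq_trans (max_card _)) // card_ord.
move: {1}n.+1 => N; elim: N => [|N IHN] in z zJ * => z0.
  exists (fun=> 0) => [//|w]; rewrite z0 // /word_coef big1 // => f _.
  exact: mul0rn.
(* The exponents f receive the value of z at a permutation moving N points whose [cyc] is f up to
   renumbering; all such permutations are conjugate by [conj_of_cyc]. *)
pose P f w := [exists s : 'S_n, [forall i, f i == cyc w (s i) :> nat]] && (#|supp w| == N).
pose a f : int := if [pick w | P f w] is Some w then z w else 0.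
have sym_a : symmetric_coefs a.
  move=> s f; rewrite /a (@eq_pick _ _ (P f)) // => w; congr (_ && _).
  apply/existsP/existsP=> -[t /forallP ft].
    exists (s^-1 * t)%g; apply/forallP=> i; rewrite permM -(eqP (ft _)) ffunE.
    by rewrite permKV.
  by exists (s * t)%g; apply/forallP=> i; rewrite permM ffunE.
have xwP f w : P f w -> xweight (fun i => f i) = N.
  case/andP=> /existsP[s /forallP fs] /eqP <-.
  rewrite -xweight_cyc -[RHS](xweight_perm _ s) /xweight; congr (_ + _)%N.
    by apply: eq_bigr => i _; rewrite (eqP (fs i)).
  by apply: eq_card => i; rewrite !inE (eqP (fs i)).
have xw f : a f != 0 -> xweight (fun i => f i) = N.
  by rewrite /a; case: pickP => [w /xwP-> //|_]; rewrite eqxx.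
have aP w : (N <= #|supp w|)%N -> z w = word_coef a w.
  rewrite leq_eqVlt => /orP[/eqP eN|lt]; last first.
    rewrite z0 // /word_coef big1 // => f _; have [->|/xw ef] := eqVneq (a f) 0.
      exact: mul0rn.
    by rewrite nwords_centres_supp ?ef ?mulr0n.
  pose f0 : expo := [ffun i => inord (cyc w i)].
  have f0E i : f0 i = cyc w i :> nat.
    rewrite ffunE inordK // ltnS /cyc; case: ifP => // _.
    by rewrite (leq_trans (leq_pred _)) // (leq_trans (max_card _)) // card_ord.
  have P0 : P f0 w.
    rewrite /P -eN eqxx andbT; apply/existsP; exists 1%g.
    by apply/forallP=> i; rewrite f0E perm1.
  rewrite /word_coef (bigD1 f0) //= big1 ?addr0 => [|f nf]; last first.
    have [->|/xw ef] := eqVneq (a f) 0; first exact: mul0rn.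
    rewrite nwords_centres_top ?ef //; case: forallP => // e.
    by case/eqP: nf; apply/ffunP=> i; apply/val_inj; rewrite /= f0E (eqP (e i)).
  rewrite nwords_centres_top ?(xwP _ _ P0) //; case: forallP => [_|[i]]; last by rewrite f0E.
  rewrite mulr1n /a; case: pickP => [w' /andP[/existsP[s /forallP ws] _]|/(_ w)].
    have [i|u ->] := @conj_of_cyc _ w' w s; last exact: zJ.
    by rewrite -f0E (eqP (ws i)).
  by rewrite P0.
have [|w lew|b sym_b bE] := IHN (fun w => z w - word_coef a w).
- by move=> w g; rewrite zJ word_coef_class.
- by rewrite aP // subrr.
exists (fun f => a f + b f) => [s f|w]; first by rewrite sym_a sym_b.
apply/eqP; rewrite eq_sym -subr_eq0 /word_coef; under eq_bigr do rewrite mulrnDl.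
by rewrite big_split /= -[\sum_i b _ *+ _]/(word_coef b w) -bE subrKC subrr.
Qed.

End SymmetricPolynomials.

Section SeparatingCoefficients.
Variables (n : nat) (F : fieldType).
Local Notation expo := {ffun 'I_n -> 'I_n.+1}.

Definition elementary_coefs (k : nat) (f : expo) : int :=
  [forall i, f i <= 1]%N && (\sum_i f i == k)%N.

Lemma elementary_coefs_sym k : symmetric_coefs (elementary_coefs k).
Proof.
move=> s f; rewrite /elementary_coefs; congr (nat_of_bool (_ && _)).
  apply/forallP/forallP=> h i; last by rewrite ffunE.
  by have := h ((s^-1)%g i); rewrite ffunE permKV.
rewrite [X in _ = (X == _)](reindex_inj (@perm_inj _ s)) /=.
by under eq_bigr do rewrite ffunE.
Qed.

Lemma prod_XaddC (c : 'I_n -> F) :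
  \prod_i ('X + (c i)%:P) =
  \sum_(k < n.+1) poly_eval (elementary_coefs k) c *: 'X^(n - k).
Proof.
(* The exponents 0 and 1 are taken in ['I_n.+1] so that the expanded product ranges over [expo]. *)
have e1 i : 'X + (c i)%:P = \sum_(j < n.+1 | (j <= 1)%N) (c i ^+ j) *: 'X^(1 - j).
  have n_gt0 : (0 < n)%N by apply: leq_ltn_trans (ltn_ord i).
  rewrite -(prednK n_gt0) big_mkcond 2!big_ord_recl big1 /= => [|j _]; last first.
    by [].
  by rewrite expr0 scale1r expr1 addr0 alg_polyC.
under eq_bigr do rewrite e1.
rewrite (bigA_distr_big (fun j : 'I_n.+1 => (j <= 1)%N)) /=.
have onE (f : expo) : (f \in ffun_on (fun j : 'I_n.+1 => (j <= 1)%N)) = [forall i, f i <= 1]%N.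
  exact/ffun_onP/forallP.
have fE (f : expo) : [forall i, f i <= 1]%N ->
    \prod_i (c i ^+ f i *: 'X^(1 - f i)) = monomial c f *: 'X^(n - \sum_i f i).
  move=> /forallP f1; rewrite scaler_prod; congr (_ *: _).
  rewrite prodrXr; congr ('X^_); rewrite -[X in _ = (X - _)%N](card_ord n).
  by rewrite -sum1_card sumnB.
transitivity (\sum_(f : expo | [forall i, f i <= 1]%N)
    monomial c f *: 'X^(n - \sum_i f i)).
  by apply: eq_big => [f|f]; rewrite ?onE // => /fE.
have lt (f : expo) : [forall i, f i <= 1]%N -> (\sum_i f i < n.+1)%N.
  move=> /forallP f1; rewrite ltnS -[n in (_ <= n)%N](card_ord n) -sum1_card.
  exact: leq_sum.
rewrite (partition_big (fun f : expo => inord (\sum_i f i) : 'I_n.+1) predT) //=.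
apply: eq_bigr => k _; rewrite /poly_eval scaler_suml big_mkcond /=.
apply: eq_bigr => f _; rewrite /elementary_coefs.
case: (boolP [forall i, _]) => [/lt h|] /=; last by rewrite mulr0z scale0r.
rewrite -val_eqE /= inordK //; case: eqP => [->|]; first by rewrite mulr1z.
by rewrite mulr0z scale0r.
Qed.

Lemma perm_of_elementary (c c' : 'I_n -> F) :
    (forall k : 'I_n.+1, poly_eval (elementary_coefs k) c = poly_eval (elementary_coefs k) c') ->
  exists s : 'S_n, forall i, c' i = c (s i).
Proof.
move=> e; have: \prod_i ('X + (c i)%:P) = \prod_i ('X + (c' i)%:P).
  by rewrite !prod_XaddC; apply: eq_bigr => k _; rewrite e.
have P (b : 'I_n -> F) : \prod_i ('X + (b i)%:P)
    = \prod_(x <- [tuple - b i | i < n]) ('X - x%:P).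
  by rewrite big_tuple; apply: eq_bigr => i _; rewrite tnth_mktuple polyCN opprK.
rewrite !P => /prod_XsubC_eq; rewrite perm_sym => /tuple_permP[s es].
exists s => i; apply: oppr_inj; have := congr1 (fun t => tnth t i) (val_inj es).
by rewrite !tnth_mktuple.
Qed.

End SeparatingCoefficients.

(** * Central elements acting on Jucys-Murphy eigenvectors *)

Section CentralElements.
Variables (n : nat) (F : fieldType).
Local Notation G := (SymGroup n).
Local Notation expo := {ffun 'I_n -> 'I_n.+1}.

Lemma mulmx_exp_eigen d (A : 'M[F]_d) (v : 'rV_d) a k :
  v *m A = a *: v -> v *m (A ^+ k) = a ^+ k *: v.
Proof.
move=> vA; elim: k => [|k IH]; first by rewrite !expr0 scale1r mulmx1.
by rewrite !exprSr [X in _ *m X]/GRing.mul /= mulmxA IH -scalemxAl vA scalerA.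
Qed.

Definition jm_eigen d (rG : mx_representation F G d) (v : 'rV_d) (c : 'I_n -> F) :=
  forall k, v *m jm rG k = c k *: v.

Lemma repr_morph d (rG : mx_representation F G d) :
  {morph (rG : 'S_n -> 'M[F]_d) : g h / (g * h)%g >-> (g * h)%R}.
Proof. by move=> x y; rewrite repr_mxM ?in_setT. Qed.

Lemma jm_eigen_poly d (rG : mx_representation F G d) v c a : jm_eigen rG v c ->
  v *m (\sum_w rG w *~ word_coef a w) = poly_eval a c *: v.
Proof.
move=> vc; have vX k m : v *m jm rG k ^+ m = c k ^+ m *: v.
  exact: mulmx_exp_eigen.
have vm (f : expo) : v *m jm_mon rG (fun i => f i) = monomial c f *: v.
  rewrite /jm_mon /monomial; elim: (index_enum _) => [|k s IH].
    by rewrite !big_nil scale1r mulmx1.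
  by rewrite !big_cons mulmxA vX -scalemxAl IH scalerA.
rewrite -sum_jm_mon ?repr_mx1 //; last exact: repr_morph.
rewrite mulmx_sumr scaler_suml; apply: eq_bigr => f _.
by rewrite -!scaler_int -scalemxAr vm !scalerA -[X in _ = X *: _]mulrzl.
Qed.

Definition class_sum (R : pzRingType) (rho : 'S_n -> R) (K : {set 'S_n}) : R :=
  \sum_(g in K) rho g.

(** The coefficients are integers independent of any field, so the same W gives eigenvalues of class
    sums over the rationals and modulo p. *)
Lemma class_weights : exists W : {set 'S_n} -> expo -> int,
  forall K, K \in classes G -> symmetric_coefs (W K) /\
    forall w, word_coef (W K) w = (w \in K)%:R.
Proof.
have h (K : {set 'S_n}) : exists a : expo -> int, K \in classes G ->
    symmetric_coefs a /\ forall w, word_coef a w = (w \in K)%:R.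
  have [/imsetP[x _ ->]|_] := boolP (K \in classes G); last by exists (fun=> 0).
  have [w g|a sym_a ea] := @class_function_word_coef n (fun w => (w \in x ^: G)%:R).
    by rewrite memJ_norm // (subsetP (class_norm _ _)) ?in_setT.
  by exists a => _; split=> // w; rewrite ea.
by have [W WP] := fin_all_exists h; exists W.
Qed.

Lemma class_function_of_central (e : 'M[F]_#|G|) : (e \in 'Z(group_ring F G))%MS ->
  exists2 z : 'S_n -> F, forall w g, z (w ^ g)%g = z w &
    forall d (rG : mx_representation F G d), gring_op rG e = \sum_g z g *: rG g.
Proof.
rewrite sub_capmx memmx_cent_envelop => /andP[/envelop_mxP[z ez] /centgmxP ce].
have {}ez : e = \sum_g z g *: regular_repr F G g.
  by rewrite ez; apply: eq_bigl => g; rewrite in_setT.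
exists z => [w g|d rG]; last first.
  rewrite ez linear_sum; apply: eq_bigr => g _.
  by rewrite linearZ /= gring_opG ?in_setT.
have <- := regular_coef z w.
rewrite -(regular_coef (fun w => z (w ^ g)%g) w); congr (fun_of_matrix _ _ _).
have := ce g (in_setT g); rewrite ez => cg.
transitivity (regular_repr F G g *m (\sum_g z g *: regular_repr F G g)
    *m regular_repr F G (g^-1)%g); last first.
  by rewrite -cg -mulmxA -repr_mxM ?in_setT // mulgV repr_mx1 mulmx1.
rewrite mulmx_sumr mulmx_suml [LHS](reindex_inj (@conjg_inj _ (g^-1)%g)) /=.
apply: eq_bigr => h _; rewrite -scalemxAr -scalemxAl -!repr_mxM ?in_setT //.
by rewrite conjgKV conjgE invgK mulgA.
Qed.

Lemma class_function_sum (V : lmodType F) (z : 'S_n -> F) (rho : 'S_n -> V) :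
    (forall w g, z (w ^ g)%g = z w) ->
  \sum_g z g *: rho g = \sum_(K in classes G) z (repr K) *: \sum_(g in K) rho g.
Proof.
move=> zJ; rewrite (partition_big (class^~ G) (mem (classes G))) /=; last first.
  by move=> g _; apply: mem_classes; rewrite in_setT.
apply: eq_bigr => _ /imsetP[x _ ->]; rewrite scaler_sumr.
apply: eq_big => [g|g /eqP <-].
  by apply/eqP/idP=> [<-|/class_eqP//]; apply: class_refl.
by have [h _ ->] := repr_class G g; rewrite zJ.
Qed.

Lemma central_of_class_function (z : 'S_n -> F) :
    (forall w g, z (w ^ g)%g = z w) ->
  exists2 e : 'M[F]_#|G|, (e \in 'Z(group_ring F G))%MS &
    forall d (rG : mx_representation F G d), gring_op rG e = \sum_g z g *: rG g.
Proof.
move=> zJ; exists (\sum_g z g *: regular_repr F G g); last first.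
  move=> d rG; rewrite linear_sum; apply: eq_bigr => g _.
  by rewrite linearZ /= gring_opG ?in_setT.
rewrite sub_capmx; apply/andP; split.
  rewrite linear_sum summx_sub // => g _.
  by rewrite linearZ scalemx_sub // envelop_mx_id ?in_setT.
rewrite memmx_cent_envelop; apply/centgmxP=> h _.
rewrite mulmx_suml mulmx_sumr [RHS](reindex_inj (@conjg_inj _ h)) /=.
apply: eq_bigr => g _; rewrite zJ -scalemxAl -scalemxAr -!repr_mxM ?in_setT //.
by rewrite conjgC.
Qed.

(** One symmetric function phi serves all representations, so scalars found on Specht modules can be
    used on the Foulkes module. *)
Lemma central_scalar (e : 'M[F]_#|G|) : (e \in 'Z(group_ring F G))%MS ->
  exists phi : ('I_n -> F) -> F, (forall s c, phi (fun i => c ((s : 'S_n) i)) = phi c) /\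
    forall d (rG : mx_representation F G d) v c, jm_eigen rG v c ->
      v *m gring_op rG e = phi c *: v.
Proof.
move=> /class_function_of_central[z zJ ez]; have [W WP] := class_weights.
exists (fun c => \sum_(K in classes G) z (repr K) * poly_eval (W K) c); split.
  move=> s c; apply: eq_bigr => K KG; congr (_ * _).
  by apply: poly_eval_perm; have [] := WP K KG.
move=> d rG v c vc; rewrite ez class_function_sum // mulmx_sumr scaler_suml.
apply: eq_bigr => K KG; rewrite -scalemxAr -scalerA; congr (_ *: _).
rewrite -(jm_eigen_poly (W K) vc); congr (_ *m _); rewrite big_mkcond /=.
apply: eq_bigr => g _; have [_ ->] := WP K KG.
by case: (g \in K); rewrite ?mulr1z ?mulr0z.
Qed.

(** The integral matrix B is recorded because powers of its reduction modulo p are eventually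
    periodic, which later produces idempotents. *)
Lemma central_of_symmetric a : symmetric_coefs a ->
  exists2 e : 'M[F]_#|G|,
    (e \in 'Z(group_ring F G))%MS /\ exists B : 'M[int]_#|G|, e = map_mx intr B &
    forall d (rG : mx_representation F G d) v c, jm_eigen rG v c ->
      v *m gring_op rG e = poly_eval a c *: v.
Proof.
move=> sym_a.
have [w g|e Ze eE] := @central_of_class_function (fun w => (word_coef a w)%:~R).
  by rewrite word_coef_class.
exists e; last first.
  move=> d rG v c vc; rewrite eE -(jm_eigen_poly a vc); congr (_ *m _).
  by apply: eq_bigr => w _; rewrite scaler_int.
split=> //; exists (\sum_w word_coef a w *: regular_repr int G w).
have Re : (e \in group_ring F G)%MS by move: Ze; rewrite sub_capmx => /andP[].
rewrite -(gring_op_id Re) eE raddf_sum; apply: eq_bigr => w _ /=.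
by rewrite map_mxZ; congr (_ *: _); rewrite -(map_regular_repr intr) map_reprE.
Qed.

End CentralElements.

(** * Tableaux, Specht modules, contents *)

Section Tableaux.
Variables (n : nat) (la : partition_of n).
Implicit Types (x y k a : 'I_n) (t : {ffun 'I_n -> 'I_n * 'I_n}) (s g : 'S_n).

Lemma part_nonincreasing (i i' : 'I_n) : (i' <= i)%N -> (part la i <= part la i')%N.
Proof.
have /andP[srt _] := valP la => le; rewrite /part.
have trans : transitive geq by move=> b a c /= ab bc; apply: leq_trans bc ab.
have := sorted_leq_nth trans leqnn 0%N srt.
move=> /(_ (val i') (val i)); rewrite !inE size_map size_tuple !ltn_ord.
move=> /(_ isT isT le); rewrite !(nth_map ord0) ?size_tuple //=.
by rewrite -!(tnth_nth ord0).
Qed.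

Lemma diagram_down (i j i' j' : 'I_n) : (i, j) \in diagram la ->
  (i' <= i)%N -> (j' <= j)%N -> (i', j') \in diagram la.
Proof.
rewrite !inE /= => ij lei lej; apply: leq_ltn_trans lej _.
exact: leq_trans ij (part_nonincreasing lei).
Qed.

Lemma card_diagram : #|diagram la| = n.
Proof.
rewrite -sum1_card (eq_bigl (fun p : 'I_n * 'I_n => true && (p.2 < part la p.1)%N));
  last by move=> p; rewrite inE.
rewrite -(pair_big_dep predT (fun i j : 'I_n => (j < part la i)%N) (fun _ _ => 1%N)) /=.
have /andP[_ /eqP e] := valP la; rewrite -[RHS]e; apply: eq_bigr => i _.
have le : (part la i <= n)%N by rewrite -ltnS ltn_ord.
rewrite -(big_ord_widen n (fun=> 1%N) le) sum1_card card_ord //.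
Qed.

(** In this order the entries smaller than k are those of the columns to its left and those above it
    in its own column. *)
Definition column_filled t := forall x y, (x < y)%N ->
  ((t x).2 < (t y).2)%N || ((t x).2 == (t y).2) && ((t x).1 < (t y).1)%N.

Definition lexcol (p q : 'I_n * 'I_n) : bool :=
  (p.2 < q.2)%N || ((p.2 == q.2 :> nat) && (p.1 <= q.1))%N.

Lemma exists_column_filled : exists2 t, is_tableau la t & column_filled t.
Proof.
have tot : total lexcol.
  by move=> p q; rewrite /lexcol; lia.
have tr : transitive lexcol.
  by move=> p q r; rewrite /lexcol; lia.
pose l := sort lexcol (enum (diagram la)).
have sz : size l = n by rewrite size_sort -cardE card_diagram.
have ul : uniq l by rewrite sort_uniq enum_uniq.
have meml p : (p \in l) = (p \in diagram la) by rewrite mem_sort mem_enum.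
pose t : {ffun 'I_n -> 'I_n * 'I_n} := [ffun x => nth (x, x) l x].
have tE x p : t x = nth p l x by rewrite ffunE (set_nth_default p) ?sz.
exists t.
  apply/andP; split.
    apply/injectiveP=> x y; rewrite (tE x (x, x)) (tE y (x, x)) => /eqP.
    by rewrite nth_uniq ?sz // => /eqP/val_inj.
  rewrite eqEcard card_diagram card_imset; last first.
    move=> x y; rewrite (tE x (x, x)) (tE y (x, x)) => /eqP.
    by rewrite nth_uniq ?sz // => /eqP/val_inj.
  rewrite cardsT card_ord leqnn andbT; apply/subsetP=> _ /imsetP[x _ ->].
  by rewrite (tE x (x, x)) -meml mem_nth ?sz.
move=> x y lt_xy; have := sort_sorted tot (enum (diagram la)).
rewrite -/l => srt.
have := sorted_ltn_nth tr (x, x) srt; move=> /(_ (val x) (val y)); rewrite !inE sz !ltn_ord.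
move=> /(_ isT isT lt_xy); rewrite -!tE /lexcol; case: ltnP => //= _ /andP[/eqP/val_inj e2 le].
rewrite e2 eqxx ltn_neqAle le andbT; apply: contraTneq lt_xy => /val_inj e1.
suff -> : x = y by rewrite ltnn.
have: t x = t y by rewrite [t x]surjective_pairing [t y]surjective_pairing e1 e2.
by rewrite (tE x (x, x)) (tE y (x, x)) => /eqP; rewrite nth_uniq ?sz // => /eqP/val_inj.
Qed.

End Tableaux.

Lemma card_lt_ord n m : (m <= n)%N -> #|[set i : 'I_n | (i < m)%N]| = m.
Proof.
move=> le; rewrite -sum1_card (eq_bigl (fun i : 'I_n => (i < m)%N)); last first.
  by move=> i; rewrite inE.
by rewrite -(big_ord_widen n (fun=> 1%N) le) sum1_card card_ord.
Qed.

(** * Column antisymmetrised vectors as Jucys-Murphy eigenvectors *)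

Section ColumnAntisymmetriser.
Variables (n : nat) (la : partition_of n) (t : {ffun 'I_n -> 'I_n * 'I_n}).
Hypotheses (tab_t : is_tableau la t) (col_t : column_filled t).
Variables (F : fieldType) (d : nat) (rG : mx_representation F (SymGroup n) d).
Variable h : 'rV[F]_d.
Hypothesis char_odd : (2%:R : F) != 0.
Hypothesis hR : forall g : 'S_n, (forall x, (t (g x)).1 = (t x).1) -> h *m rG g = h.
Implicit Types (x y k a : 'I_n) (s g : 'S_n).

Lemma tableau_inj : injective t.
Proof. by case/andP: tab_t => /injectiveP. Qed.

Lemma tableau_mem x : t x \in diagram la.
Proof. by case/andP: tab_t => _ /eqP <-; apply: imset_f. Qed.

Lemma tableauP p : p \in diagram la -> exists x, t x = p.
Proof. by case/andP: tab_t => _ /eqP <- /imsetP[x _ ->]; exists x. Qed.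

Lemma column_filled_lt x y :
  (x < y)%N = ((t x).2 < (t y).2)%N || ((t x).2 == (t y).2) && ((t x).1 < (t y).1)%N.
Proof.
apply/idP/idP; first exact: col_t.
apply: contraTT; rewrite -leqNgt leq_eqVlt => /orP[/eqP/val_inj->|/col_t].
  by rewrite eqxx !ltnn.
by rewrite -!val_eqE /=; lia.
Qed.

(** The vector h may be any vector fixed by the row permutations: a tabloid gives the polytabloid,
    and a row sum of matchings gives eigenvectors in the Foulkes module. *)
Definition column_sum : 'rV[F]_d :=
  \sum_(s in column_stabiliser t) (-1) ^+ s *: (h *m rG s).

Lemma column_stabP s : reflect (forall x, (t (s x)).2 = (t x).2) (s \in column_stabiliser t).
Proof. by rewrite inE; apply: (iffP forallP) => st x; apply/eqP. Qed.

Lemma column_stabM s g : s \in column_stabiliser t ->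
  (s * g)%g \in column_stabiliser t = (g \in column_stabiliser t).
Proof.
move=> /column_stabP st; apply/column_stabP/column_stabP=> gt x; last first.
  by rewrite permM gt st.
by have := gt ((s^-1)%g x); rewrite permM permKV => ->; rewrite -st permKV.
Qed.

Lemma column_stabMr s g : g \in column_stabiliser t ->
  (s * g)%g \in column_stabiliser t = (s \in column_stabiliser t).
Proof.
move=> /column_stabP gt; apply/column_stabP/column_stabP=> st x.
  by rewrite -[RHS]st permM gt.
by rewrite permM gt st.
Qed.

Lemma column_sum_act g : g \in column_stabiliser t ->
  column_sum *m rG g = (-1) ^+ g *: column_sum.
Proof.
move=> gt; rewrite /column_sum mulmx_suml scaler_sumr.
rewrite [RHS](reindex_inj (mulIg g)) /=; apply: eq_big => s.
  by rewrite column_stabMr.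
move=> _; rewrite -scalemxAl -mulmxA -repr_mxM ?in_setT // scalerA.
by rewrite odd_permM signr_addb mulrCA -expr2 sqrr_sign mulr1.
Qed.

Section Garnir.
Variables (k : 'I_n) (c : 'I_n).
Hypothesis lt_c : (c < (t k).2)%N.

(* The entry of column c which lies in the same row as k in the tableau t s. *)
Definition partner s : 'I_n :=
  s (odflt k [pick x | t x == ((t ((s^-1)%g k)).1, c)]).

Lemma partnerE s : s \in column_stabiliser t ->
  t ((s^-1)%g (partner s)) = ((t ((s^-1)%g k)).1, c).
Proof.
move=> /column_stabP st; rewrite /partner permK; case: pickP => [x /eqP //|no].
have e := st ((s^-1)%g k); rewrite permKV in e.
have := tableau_mem ((s^-1)%g k); rewrite [t ((s^-1)%g k)]surjective_pairing -e.
move=> /diagram_down/(_ (leqnn _) (ltnW lt_c)) /tableauP[x ex].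
by have := no x; rewrite ex eqxx.
Qed.

Lemma partner_col s : s \in column_stabiliser t -> (t (partner s)).2 = c.
Proof.
move=> st; have /column_stabP sP := st.
by rewrite -[partner s](permKV s) sP partnerE.
Qed.

Lemma neq_col x : (t x).2 = c -> x != k.
Proof. by move=> ex; apply: contraTneq lt_c => <-; rewrite ex ltnn. Qed.

Lemma partner_act s : s \in column_stabiliser t ->
  h *m rG s *m rG (tperm (partner s) k) = h *m rG s.
Proof.
move=> st; set i := partner s.
have -> : h *m rG s *m rG (tperm i k)
        = h *m rG (tperm ((s^-1)%g i) ((s^-1)%g k)) *m rG s.
  rewrite -!mulmxA -!repr_mxM ?in_setT // -tpermJ conjgE invgK.
  by rewrite -!mulgA mulVg mulg1.
congr (_ *m _); apply: hR => x; have e := partnerE st.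
by case: tpermP => [->|->|//]; rewrite e.
Qed.

(* After cancelling the terms a = partner s, the involution
   (s, a) |-> (s * tperm a (partner s), partner s) reverses signs. *)
Lemma garnir : \sum_(a | (t a).2 == c) column_sum *m rG (tperm a k) = column_sum.
Proof.
pose P (q : 'S_n * 'I_n) := [&& q.1 \in column_stabiliser t, (t q.2).2 == c & q.2 != partner q.1].
pose w (q : 'S_n * 'I_n) := (-1) ^+ q.1 *: (h *m rG q.1 *m rG (tperm q.2 k)).
have -> : \sum_(a | (t a).2 == c) column_sum *m rG (tperm a k)
        = column_sum + \sum_(q | P q) w q.
  under eq_bigr do rewrite /column_sum mulmx_suml.
  rewrite exchange_big /=.
  rewrite [\sum_(q | P q) _](eq_bigl (fun q => (q.1 \in column_stabiliser t) &&
     (((t q.2).2 == c) && (q.2 != partner q.1)))) //.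
  rewrite -(pair_big_dep (mem (column_stabiliser t))
     (fun s a => ((t a).2 == c) && (a != partner s)) (fun s a => w (s, a))) /=.
  rewrite /column_sum -big_split /=; apply: eq_bigr => s st.
  rewrite (bigD1 (partner s)) /=; last by rewrite partner_col.
  rewrite -scalemxAl partner_act //; congr (_ + _).
  by apply: eq_bigr => a _; rewrite -scalemxAl.
suff -> : \sum_(q | P q) w q = 0 by rewrite addr0.
pose phi (q : 'S_n * 'I_n) : 'S_n * 'I_n :=
  ((q.1 * tperm q.2 (partner q.1))%g, partner q.1).
have phiP q : P q -> [/\ P (phi q), phi (phi q) = q & w (phi q) = - w q].
  case: q => s a /= /and3P[/= st /eqP ac nai]; set i := partner s.
  have ic : (t i).2 = c by apply: partner_col.
  have tt : tperm a i \in column_stabiliser t.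
    by apply/column_stabP=> x; case: tpermP => [->|->|]; rewrite ?ac ?ic.
  have st' : (s * tperm a i)%g \in column_stabiliser t by rewrite column_stabM.
  have pi : partner (s * tperm a i)%g = a.
    rewrite /partner invMg tpermV !permM [tperm a i k]tpermD ?neq_col //.
    by rewrite -/(partner s) tpermR.
  have e : phi (s, a) = ((s * tperm a i)%g, i) by [].
  split; first by rewrite /P /= -/i st' ic eqxx pi /= eq_sym.
    by rewrite e /phi /= pi tpermC -mulgA tpermC tperm2 mulg1.
  rewrite /w e /= odd_permM odd_tperm nai signr_addb mulrN1 scaleNr; congr (- (_ *: _)).
  rewrite -[in RHS](partner_act st) -/i -!mulmxA -!repr_mxM ?in_setT //.
  congr (_ *m rG _); rewrite -mulgA; congr (_ * _)%g.
  apply/permP=> x; rewrite !permM.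
  have nak := neq_col ac; have nik := neq_col ic.
  case: (tpermP a i x) => [->|->|xa xi].
  - by rewrite tpermL [tperm i k a]tpermD ?tpermL // eq_sym.
  - by rewrite tpermL tpermR [tperm i k a]tpermD // eq_sym.
  have [->|nxk] := eqVneq x k; first by rewrite !tpermR [tperm a k i]tpermD // eq_sym.
  have nax : a != x by apply/eqP=> ea; apply: xa.
  have nix : i != x by apply/eqP=> ei; apply: xi.
  by rewrite !tpermD // eq_sym.
have e : \sum_(q | P q) w q = - \sum_(q | P q) w q.
  rewrite {1}(reindex_onto phi phi) => [|q /phiP[]//].
  rewrite -sumrN; apply: eq_big => q.
    apply/andP/idP=> [[/phiP[Pq _ _] /eqP e]|/phiP[-> -> _]]; last by rewrite eqxx.
    by rewrite -e.
  by move=> /andP[/phiP[Pq _ _] /eqP e]; rewrite e in Pq; case: (phiP _ Pq).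
(* Division by 2 takes the place of choosing one term in each pair exchanged by [phi]. *)
have: (2%:R : F) *: (\sum_(q | P q) w q) = 0.
  by rewrite scaler_nat mulr2n {1}e addNr.
by move/eqP; rewrite scaler_eq0 (negPf char_odd) => /eqP.
Qed.

End Garnir.

Definition node_content (x : 'I_n) : int := (t x).2%:Z - (t x).1%:Z.

(** Each column to the left of k contributes 1 by [garnir], and each entry above k contributes -1 by
    antisymmetry; the total is the column index minus the row index. *)
Lemma column_sum_eigen : jm_eigen rG column_sum (fun k => (node_content k)%:~R).
Proof.
move=> k; rewrite /jm mulmx_sumr (bigID (fun a => (t a).2 == (t k).2)) /= addrC.
have -> : \sum_(a : 'I_n | (a < k)%N && ((t a).2 != (t k).2)) column_sum *m rG (tperm a k)
        = (t k).2%:R *: column_sum.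
  rewrite (eq_bigl (fun a => ((t a).2 < (t k).2)%N)); last first.
    by move=> a; rewrite column_filled_lt -!val_eqE /=; lia.
  rewrite (partition_big (fun a => (t a).2) (fun c => (c < (t k).2)%N)) //=.
  rewrite (eq_bigr (fun=> column_sum)) => [|c lt_c]; last first.
    rewrite -[RHS](garnir lt_c); apply: eq_bigl => a.
    by case: eqP => [->|//]; rewrite ?lt_c ?andbF.
  rewrite sumr_const scaler_nat; congr (_ *+ _).
  by rewrite -[RHS](card_lt_ord (ltnW (ltn_ord (t k).2))) cardsE.
have -> : \sum_(a : 'I_n | (a < k)%N && ((t a).2 == (t k).2)) column_sum *m rG (tperm a k)
        = - ((t k).1%:R *: column_sum).
  set S := [set a : 'I_n | (a < k)%N && ((t a).2 == (t k).2)].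
  rewrite (eq_bigr (fun=> - column_sum)) => [|a /andP[lt_ak /eqP eak]]; last first.
    rewrite column_sum_act ?odd_tperm; last first.
      by apply/column_stabP=> x; case: tpermP => [->|->|]; rewrite ?eak.
    by rewrite neq_ltn lt_ak scaleN1r.
  have inj : {in S &, injective (fun a => (t a).1)}.
    move=> a b; rewrite !inE => /andP[_ /eqP ea] /andP[_ /eqP eb] e.
    by apply: tableau_inj; rewrite [t a]surjective_pairing [t b]surjective_pairing e ea eb.
  have cS : #|S| = (t k).1.
    rewrite -(card_in_imset inj) -[RHS](card_lt_ord (ltnW (ltn_ord (t k).1))).
    apply: eq_card => i; rewrite [RHS]inE; apply/imsetP/idP=> [[a]|lt_i].
      rewrite inE column_filled_lt => /andP[h1 /eqP e] ->.
      by move: h1; rewrite e ltnn eqxx.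
    have := tableau_mem k; rewrite [t k]surjective_pairing.
    move=> /diagram_down/(_ (ltnW lt_i) (leqnn _)) /tableauP[a ea].
    exists a; last by rewrite ea.
    by rewrite inE column_filled_lt ea eqxx lt_i orbT.
  by rewrite sumr_const mulNrn scaler_nat -cS cardsE.
by rewrite -scalerBl /node_content rmorphB.
Qed.

End ColumnAntisymmetriser.

Section SpechtModule.
Variables (n : nat) (la : partition_of n) (t : {ffun 'I_n -> 'I_n * 'I_n}).
Hypotheses (tab_t : is_tableau la t) (col_t : column_filled t).
Variable F : fieldType.
Hypothesis char_odd : (2%:R : F) != 0.

Let tabloid_mem : tabloid t \in tabloids la. Proof. exact: imset_f. Qed.

Lemma polytabloid_column_sum : polytabloid F la t =
  column_sum t (young_module F la) (basis_vec F (tabloids la) (tabloid t)).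
Proof. by apply: eq_bigr => s _; rewrite basis_vec_act. Qed.

Lemma polytabloid_eigen :
  jm_eigen (young_module F la) (polytabloid F la t) (fun k => (node_content t k)%:~R).
Proof.
rewrite polytabloid_column_sum; apply: (column_sum_eigen tab_t col_t char_odd) => g gR.
rewrite basis_vec_act //; congr basis_vec; apply/ffunP=> x.
by rewrite !ffunE -[in RHS](permKV g x) gR.
Qed.

Lemma polytabloid_neq0 : polytabloid F la t != 0.
Proof.
apply/eqP=> /rowP/(_ (enum_rank_in tabloid_mem (tabloid t))) /eqP; apply/negP.
rewrite summxE (bigD1 1%g) /=; last by apply/column_stabP=> x; rewrite perm1.
rewrite big1 ?addr0 => [|s /andP[/column_stabP st ns]].
  by rewrite !mxE enum_rankK_in // fill_act1 eqxx odd_perm1 mul1r oner_eq0.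
rewrite !mxE enum_rankK_in //; case: eqP => [/ffunP e|_]; last by rewrite mulr0.
case/eqP: ns; apply/permP=> x; rewrite perm1; apply: (tableau_inj tab_t).
rewrite [t x]surjective_pairing -st; have := e (s x); rewrite !ffunE permK => <-.
by rewrite -surjective_pairing.
Qed.

Lemma tableau_fill_act t' : is_tableau la t' -> exists g, t' = fill_act t g.
Proof.
move=> tab_t'; have ex x : exists y, t' y = t x.
  by apply: (tableauP tab_t'); apply: tableau_mem.
pose g x := odflt x [pick y | t' y == t x].
have gE x : t' (g x) = t x.
  by rewrite /g; case: pickP => [y /eqP //|no]; have [y /eqP] := ex x; rewrite no.
have g_inj : injective g.
  by move=> x y e; apply: (tableau_inj tab_t); rewrite -!gE e.
exists (perm g_inj); apply/ffunP=> x; rewrite ffunE.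
by rewrite -{1}(permKV (perm g_inj) x) permE gE.
Qed.

(** The translates of one polytabloid span the Specht module, and e commutes with translation. *)
Lemma specht_lies_in_block (e : 'M[F]_#|SymGroup n|) : central_idempotent e ->
    polytabloid F la t *m gring_op (young_module F la) e = polytabloid F la t ->
  lies_in_block (young_module F la) e (specht F la).
Proof.
move=> ce te; apply/row_matrixP=> i; rewrite row_mul.
have: (row i (specht F la) <= specht F la)%MS by apply: row_sub.
move: (row i _) => v; have fixE (A : 'M_#|tabloids la|) :
    A *m gring_op (young_module F la) e = A ->
    forall u : 'rV_#|tabloids la|, (u <= A)%MS -> u *m gring_op (young_module F la) e = u.
  by move=> Ae u /submxP[D ->]; rewrite -mulmxA Ae.
move=> /sub_sumsmxP[u ->]; rewrite mulmx_suml; apply: eq_bigr => t' tab_t'.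
have [g ->] := tableau_fill_act tab_t'.
have: (u (fill_act t g) *m <<polytabloid F la (fill_act t g)>> <= polytabloid F la (fill_act t g))%MS.
  by rewrite (submx_trans (submxMl _ _)) ?genmxE.
case/sub_rVP=> a ->; rewrite -scalemxAl; congr (_ *: _).
by rewrite -polytabloid_act // -mulmxA -gring_op_central ?in_setT // mulmxA te.
Qed.

Lemma lies_in_block_polytabloid (e : 'M[F]_#|SymGroup n|) :
    lies_in_block (young_module F la) e (specht F la) ->
  polytabloid F la t *m gring_op (young_module F la) e = polytabloid F la t.
Proof.
move=> le; have /submxP[D ->] : (polytabloid F la t <= specht F la)%MS.
  by rewrite (sumsmx_sup t) ?genmxE.
by rewrite -mulmxA le.
Qed.

End SpechtModule.

Lemma perm_of_card_fibres (V : eqType) n (f g : 'I_n -> V) :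
    (forall v, #|[set i | f i == v]| = #|[set i | g i == v]|) ->
  exists s : 'S_n, forall i, g i = f (s i).
Proof.
move=> e; have cnt (h : 'I_n -> V) v : count_mem v (mktuple h) = #|[set i | h i == v]|.
  rewrite -sum1_count big_tuple -sum1_card; apply: eq_bigl => i.
  by rewrite tnth_mktuple inE.
have: perm_eq (mktuple g) (mktuple f).
  by apply/allP => v _; apply/eqP; rewrite -[LHS]/(count_mem v _) -[RHS]/(count_mem v _) !cnt e.
case/tuple_permP=> s es; exists s => i.
by have := congr1 (fun t => tnth t i) (val_inj es); rewrite !tnth_mktuple.
Qed.

Definition tableau_contents n (tab : partition_of n -> {ffun 'I_n -> 'I_n * 'I_n})
    (R : pzRingType) (la : partition_of n) (k : 'I_n) : R :=
  (node_content (tab la) k)%:~R.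

(** * Partitions and their contents *)

Section Contents.
Variable n : nat.
Implicit Types (la mu : partition_of n) (t : {ffun 'I_n -> 'I_n * 'I_n}).

Definition diagonal la (d : int) : {set 'I_n * 'I_n} :=
  [set x in diagram la | x.2%:Z - x.1%:Z == d].

Lemma card_tableau la t (P : pred ('I_n * 'I_n)) : is_tableau la t ->
  #|[set k | P (t k)]| = #|[set x in diagram la | P x]|.
Proof.
move=> tab_t; rewrite -(card_imset _ (tableau_inj tab_t)); apply: eq_card => x.
rewrite [RHS]inE; apply/imsetP/andP=> [[k]|[/(tableauP tab_t)[k <-] Pk]].
  by rewrite inE => Pk ->; rewrite tableau_mem.
by exists k; rewrite ?inE.
Qed.

Lemma down_closed_ord (A : {set 'I_n}) x :
  (forall y z : 'I_n, z \in A -> (y <= z)%N -> y \in A) -> (x \in A) = (x < #|A|)%N.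
Proof.
move=> dA; apply/idP/idP=> [Ax|].
  rewrite -(card_lt_ord (ltn_ord x)); apply: subset_leq_card.
  by apply/subsetP=> y; rewrite inE ltnS => le; apply: dA le.
apply: contraLR => nAx; rewrite -leqNgt -(card_lt_ord (ltnW (ltn_ord x))).
apply: subset_leq_card; apply/subsetP=> y Ay; rewrite inE ltnNge.
by apply: contra nAx => le; apply: dA le.
Qed.

(** The smaller coordinate numbers the nodes along a diagonal, and a diagram meets the diagonal in
    an initial segment. A partition is thus determined by its diagonal lengths, that is, by its
    multiset of integral contents. *)
Lemma mem_diagram_diagonal la (x : 'I_n * 'I_n) :
  (x \in diagram la) = (minn x.1 x.2 < #|diagonal la (x.2%:Z - x.1%:Z)|)%N.
Proof.
set d := _ - _; pose f (y : 'I_n * 'I_n) : 'I_n := if (y.1 <= y.2)%N then y.1 else y.2.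
have fE y : f y = minn y.1 y.2 :> nat by rewrite /f; case: leqP.
have f_inj : {in [pred y : 'I_n * 'I_n | y.2%:Z - y.1%:Z == d] &, injective f}.
  move=> [a b] [a' b']; rewrite !inE /= => /eqP e1 /eqP e2 /(congr1 val) /=.
  by rewrite !fE /= => e; congr (_, _); apply/val_inj; rewrite /=; lia.
have dE y : (y \in diagonal la d) = (y \in diagram la) && (y.2%:Z - y.1%:Z == d).
  by rewrite inE.
pose A := f @: diagonal la d.
have cA : #|A| = #|diagonal la d|.
  apply: card_in_imset => y z; rewrite !dE => /andP[_ hy] /andP[_ hz].
  exact: f_inj.
have memA (y : 'I_n * 'I_n) : y.2%:Z - y.1%:Z == d -> (f y \in A) = (y \in diagram la).
  move=> yd; apply/imsetP/idP=> [[z]|yl]; last by exists y; rewrite // dE yl.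
  by rewrite dE => /andP[zl zd] /f_inj-> //; rewrite inE.
rewrite -memA // -cA -fE; apply: down_closed_ord => i j /imsetP[[a b]].
rewrite dE /= => /andP[abl abd] -> le.
move: le; rewrite fE /= => le.
have lt1 : (a - (minn a b - i) < n)%N by rewrite (leq_ltn_trans (leq_subr _ _)).
have lt2 : (b - (minn a b - i) < n)%N by rewrite (leq_ltn_trans (leq_subr _ _)).
have -> : i = f (Ordinal lt1, Ordinal lt2).
  by apply/val_inj; rewrite /= fE /=; lia.
rewrite memA /=; last by move: abd; lia.
by apply: (diagram_down abl); rewrite /= leq_subr.
Qed.

Lemma diagram_inj la mu : diagram la = diagram mu -> la = mu.
Proof.
move=> e; apply/val_inj/eq_from_tnth => i; apply/val_inj.
have cE nu : part nu i = #|[set j | (i, j) \in diagram nu]|.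
  have le : (part nu i <= n)%N by rewrite -ltnS ltn_ord.
  by rewrite -[LHS](card_lt_ord le); apply: eq_card => j; rewrite !inE.
by rewrite -[LHS]/(part la i) -[RHS]/(part mu i) !cE e.
Qed.

Lemma node_content_inj la mu t t' (s : 'S_n) : is_tableau la t -> is_tableau mu t' ->
  (forall k, node_content t' k = node_content t (s k)) -> la = mu.
Proof.
move=> tab_t tab_t' e; apply: diagram_inj; apply/setP=> x.
rewrite !mem_diagram_diagonal; congr (_ < _)%N; set d := _ - _.
rewrite -(card_tableau (fun x => x.2%:Z - x.1%:Z == d) tab_t).
rewrite -(card_tableau (fun x => x.2%:Z - x.1%:Z == d) tab_t').
rewrite -[RHS](card_imset _ (@perm_inj _ s)); apply: eq_card => k.
rewrite inE -/(node_content t k); apply/idP/imsetP=> [ek|[j]].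
  by exists ((s^-1)%g k); rewrite ?permKV // inE -/(node_content t' _) e permKV.
by rewrite inE -/(node_content t' _) e => ej ->.
Qed.

Section Modular.
Variables (p : nat) (F : fieldType).
Hypothesis charF : p \in [pchar F].

Lemma intr_eq_mod (a b : int) : (a%:~R == b%:~R :> F) = (modz a p == modz b p).
Proof.
by rewrite -subr_eq0 -rmorphB -(dvdz_pcharf charF) eqz_mod_dvd.
Qed.

Lemma content_tableau la t (r : 'I_p) : is_tableau la t ->
  content p la r = #|[set k | modz (node_content t k) p == r%:Z]|.
Proof.
by move=> tab_t; rewrite ffunE (card_tableau (fun x => residue p x == r%:Z) tab_t).
Qed.

Lemma content_eqP la mu t t' : is_tableau la t -> is_tableau mu t' ->
  (content p la = content p mu <->
   exists s : 'S_n, forall k, (node_content t' k)%:~R = (node_content t (s k))%:~R :> F).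
Proof.
move=> tab_t tab_t'; have p_gt0 : (0 < p)%N by rewrite prime_gt0 // (pcharf_prime charF).
have modE (a : int) : exists r : 'I_p, modz a p = r%:Z.
  have p0 : p%:Z != 0 by rewrite -lt0n.
  have := modz_ge0 a p0; have := @ltz_pmod a p%:Z p_gt0.
  case: (modz a p) => // k lt _; have ltk : (k < p)%N by [].
  by exists (Ordinal ltk).
split=> [e|[s es]].
  apply: (@perm_of_card_fibres F n (fun k => (node_content t k)%:~R)
    (fun k => (node_content t' k)%:~R)) => v.
  have key a : v = a%:~R -> #|[set i | (node_content t i)%:~R == v]|
      = #|[set i | (node_content t' i)%:~R == v]|.
    have [r er] := modE a; move=> ->; transitivity (content p la r); last rewrite e.
      rewrite (content_tableau _ tab_t); apply: eq_card => i.
      by rewrite !inE intr_eq_mod er.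
    rewrite (content_tableau _ tab_t'); apply: eq_card => i.
    by rewrite !inE intr_eq_mod er.
  case: (pickP (fun i => (node_content t i)%:~R == v)) => [i /eqP/esym/key //|no].
  case: (pickP (fun i => (node_content t' i)%:~R == v)) => [i /eqP/esym/key //|no'].
  by rewrite !eq_card0 // => i; rewrite inE.
apply/ffunP=> r; rewrite (content_tableau _ tab_t) (content_tableau _ tab_t').
rewrite -[RHS](card_imset _ (@perm_inj _ s)); apply: eq_card => k.
have em j : modz (node_content t' j) p = modz (node_content t (s j)) p.
  by apply/eqP; rewrite -intr_eq_mod es.
rewrite inE; apply/idP/imsetP=> [ek|[j]].
  by exists ((s^-1)%g k); rewrite ?permKV // inE em permKV.
by rewrite inE em => ej ->.
Qed.

End Modular.
End Contents.

(** * The Foulkes module *)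

Section Wreath.
Variable m : nat.
Implicit Types (i j : 'I_(2 * m)) (g x y b : 'S_(2 * m)).

Lemma flip_proof i : (i./2.*2 + ~~ odd i < 2 * m)%N.
Proof. by have := ltn_ord i; have := odd_double_half i; case: odd => /=; lia. Qed.

Definition flip_fun i : 'I_(2 * m) := Ordinal (flip_proof i).

Lemma flip_fun_half i : (flip_fun i)./2 = i./2.
Proof. by rewrite /= addnC half_bit_double. Qed.

Lemma flip_fun_odd i : odd (flip_fun i) = ~~ odd i.
Proof. by rewrite /= oddD odd_double oddb. Qed.

Lemma flip_funK : involutive flip_fun.
Proof.
move=> i; apply/val_inj; rewrite /= -/(flip_fun i) -[X in X./2]/(val (flip_fun i)).
by rewrite flip_fun_half -[X in odd X]/(val (flip_fun i)) flip_fun_odd negbK addnC odd_double_half.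
Qed.

(** The fixed matching as an involution exchanging 2k and 2k + 1. The wreath product is its
    centraliser, so right cosets correspond to the conjugates [flip m ^ x]. *)
Definition flip : 'S_(2 * m) := perm (can_inj flip_funK).

Lemma flipK : involutive flip.
Proof. by move=> i; rewrite !permE flip_funK. Qed.

Lemma flip_fpf i : flip i != i.
Proof.
apply/eqP=> /(congr1 (fun k : 'I_(2 * m) => odd k)).
by rewrite permE flip_fun_odd; case: odd.
Qed.

Lemma half_eq_flip i j : (j./2 == i./2) = (j == i) || (j == flip i).
Proof.
apply/eqP/orP=> [e|[/eqP->//|/eqP->]]; last by rewrite permE flip_fun_half.
have [ej|nej] := eqVneq (odd j) (odd i).
  by left; apply/eqP/val_inj; rewrite /= -[LHS]odd_double_half ej e odd_double_half.
right; apply/eqP/val_inj; rewrite /= -[LHS]odd_double_half -[RHS]odd_double_half.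
rewrite permE flip_fun_half flip_fun_odd e; congr (nat_of_bool _ + _)%N.
by move: nej; case: odd; case: odd.
Qed.

Lemma wreathP g : reflect (flip ^ g = flip)%g (g \in wreath m).
Proof.
have blockE i : [set j : 'I_(2 * m) | j./2 == i./2] = [set i; flip i].
  by apply/setP=> j; rewrite !inE half_eq_flip.
have imE i : ('P^*)%act [set i; flip i] g = [set g i; g (flip i)].
  apply/setP=> j; apply/imsetP/idP=> [[k]|].
    by rewrite !inE => /orP[] /eqP-> -> /=; rewrite /aperm eqxx ?orbT.
  rewrite !inE => /orP[]/eqP->; [exists i | exists (flip i)]; rewrite ?inE ?eqxx ?orbT //.
rewrite inE in_setT /= inE; apply: (iffP subsetP) => [gN|gE _ /imsetP[i _ ->]].
  apply: conj_permP => i.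
  have /gN : [set i; flip i] \in pairs m by apply/imsetP; exists i => //; rewrite blockE.
  rewrite inE imE => /imsetP[k _]; rewrite blockE => e.
  have gi : g i \in [set k; flip k] by rewrite -e !inE eqxx.
  have gfi : g (flip i) \in [set k; flip k] by rewrite -e !inE eqxx orbT.
  have ne : g (flip i) != g i by rewrite (inj_eq perm_inj) flip_fpf.
  move: gi gfi ne; rewrite !inE => /orP[]/eqP-> /orP[]/eqP-> //; rewrite ?eqxx //.
  by rewrite flipK.
rewrite blockE inE imE; apply/imsetP; exists (g i) => //.
have -> : g (flip i) = flip (g i) by rewrite -{2}gE conjgE !permM permK.
by rewrite blockE.
Qed.

Lemma wreathE g : (g \in wreath m) = ((flip ^ g)%g == flip).
Proof. exact/wreathP/eqP. Qed.

Lemma rcoset_wreathP x y : (wreath m :* x == wreath m :* y) = ((flip ^ x)%g == (flip ^ y)%g).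
Proof.
rewrite (sameP eqP (rcoset_eqP)) mem_rcoset wreathE conjgM.
by rewrite -{2}(conjgK y flip) (inj_eq (@conjg_inj _ _)).
Qed.

End Wreath.

Section FoulkesBasis.
Variables (m : nat) (F : fieldType).
Local Notation G := (SymGroup (2 * m)).
Local Notation S := (rcosets (wreath m) G).
Implicit Types (g x y b : 'S_(2 * m)) (v w : 'rV[F]_#|S|).

Lemma coset_mem x : wreath m :* x \in S.
Proof. by rewrite mem_rcosets mulSGid ?subsetT ?in_setT. Qed.

Definition bvec x : 'rV[F]_#|S| := basis_vec F S (wreath m :* x).

Definition coef v x : F := v 0 (enum_rank_in (coset_mem x) (wreath m :* x)).

Lemma enum_val_coset (i : 'I_#|S|) : exists x, enum_val i = wreath m :* x.
Proof. by have /rcosetsP[x _ ->] := enum_valP i; exists x. Qed.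

Lemma coefE v i x : enum_val i = wreath m :* x -> v 0 i = coef v x.
Proof.
by move=> e; congr (v 0 _); apply: enum_val_inj; rewrite enum_rankK_in ?coset_mem.
Qed.

Lemma coef_matching v x y : (flip m ^ x)%g = (flip m ^ y)%g -> coef v x = coef v y.
Proof.
move=> e; apply/esym/coefE; rewrite enum_rankK_in ?coset_mem //.
by apply/eqP; rewrite rcoset_wreathP e.
Qed.

Lemma coef_inj v w : coef v =1 coef w -> v = w.
Proof.
by move=> e; apply/rowP=> i; have [x ex] := enum_val_coset i; rewrite !(coefE _ ex) e.
Qed.

Lemma coef_bvec x y : coef (bvec x) y = ((flip m ^ y)%g == (flip m ^ x)%g)%:R.
Proof. by rewrite /coef mxE enum_rankK_in ?coset_mem // rcoset_wreathP. Qed.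

Lemma coef_sum I (r : seq I) (P : pred I) (v : I -> 'rV[F]_#|S|) y :
  coef (\sum_(i <- r | P i) v i) y = \sum_(i <- r | P i) coef (v i) y.
Proof. exact: summxE. Qed.

Lemma coefZ a v y : coef (a *: v) y = a * coef v y.
Proof. by rewrite /coef mxE. Qed.

Lemma bvec_act x g : bvec x *m foulkes F m g = bvec (x * g)%g.
Proof. by rewrite basis_vec_act ?coset_mem //= rcosetE -rcosetM. Qed.

Lemma bvec_eq x y : (flip m ^ x)%g = (flip m ^ y)%g -> bvec x = bvec y.
Proof. by move=> e; apply: coef_inj => z; rewrite !coef_bvec e. Qed.

Lemma coef_act v g x : coef (v *m foulkes F m g) x = coef v (x * g^-1)%g.
Proof.
rewrite {1}/coef mxE (bigD1 (enum_rank_in (coset_mem (x * g^-1)%g) (wreath m :* (x * g^-1)))) //=.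
rewrite big1 ?addr0 => [|i ni]; rewrite mxE enum_rankK_in ?coset_mem //= rcosetE.
  by rewrite enum_rankK_in ?coset_mem // -rcosetM mulgKV eqxx mulr1.
case: eqP => [e|_]; last by rewrite mulr0.
case/eqP: ni; apply: enum_val_inj; rewrite enum_rankK_in ?coset_mem //.
by rewrite rcosetM e -rcosetM mulgV rcoset1.
Qed.

Lemma bvec_mx_eq (P Q : 'M[F]_#|S|) : (forall x, bvec x *m P = bvec x *m Q) -> P = Q.
Proof.
move=> e; apply/row_matrixP=> i; rewrite !rowE; have [x ex] := enum_val_coset i.
have -> : delta_mx 0 i = bvec x; last exact: e.
rewrite /bvec (basis_vecE _ (coset_mem x)); congr delta_mx.
by apply: enum_val_inj; rewrite enum_rankK_in ?coset_mem.
Qed.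

Lemma equivariant_mx_eq (P Q : 'M[F]_#|S|) :
    (forall g, foulkes F m g *m P = P *m foulkes F m g) ->
    (forall g, foulkes F m g *m Q = Q *m foulkes F m g) ->
  bvec 1 *m P = bvec 1 *m Q -> P = Q.
Proof.
move=> cP cQ e; apply: bvec_mx_eq => x.
by rewrite -[x]mul1g -bvec_act -!mulmxA cP cQ !mulmxA e.
Qed.

Hypothesis char_odd : (2%:R : F) != 0.

Lemma central_comm d (rG : mx_representation F G d) e g :
  (e \in 'Z(group_ring F G))%MS -> rG g *m gring_op rG e = gring_op rG e *m rG g.
Proof.
rewrite sub_capmx memmx_cent_envelop => /andP[Re /centgmxP ce].
have Gg : g \in G by rewrite in_setT.
have Rg : (regular_repr F G g \in group_ring F G)%MS by apply: envelop_mx_id.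
by rewrite -(gring_opG rG Gg) -!gring_opM // ce.
Qed.

(** An endomorphism is determined by the image of the base coset, whose coordinates are biinvariant.
    The formula of [class_function_of_biinvariant] is exactly the coordinate at y of the base coset
    acted on by the central element z. *)
Theorem foulkes_endomorphism_central (P : 'M[F]_#|S|) :
    (forall g, foulkes F m g *m P = P *m foulkes F m g) ->
  exists2 e, (e \in 'Z(group_ring F G))%MS & P = gring_op (foulkes F m) e.
Proof.
move=> cP; pose h y := coef (bvec 1 *m P) y.
have hB : biinvariant (flip m) h.
  move=> b x tb; split.
    by apply: coef_matching; rewrite conjgM tb.
  rewrite /h -[b]invgK -coef_act -mulmxA -cP mulmxA bvec_act mul1g.
  have -> : bvec (b^-1)%g = bvec 1 by apply: bvec_eq; rewrite -{1}tb conjgK conjg1.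
  by [].
have [z zJ hE] := class_function_of_biinvariant (@flipK m) (@flip_fpf m) char_odd hB.
have [e Ze eE] := central_of_class_function zJ.
exists e; first exact: Ze.
apply: equivariant_mx_eq; [exact: cP | by move=> g; apply: central_comm |].
apply: coef_inj => y; rewrite -/(h y) hE eE mulmx_sumr coef_sum.
rewrite [RHS](reindex_inj (mulIg y)) /= [LHS]big_mkcond /=; apply: eq_bigr => b _.
rewrite -scalemxAr bvec_act mul1g coefZ coef_bvec conjgM eq_sym.
rewrite (inj_eq (@conjg_inj _ y)).
by case: eqP => _; rewrite ?mulr1 ?mulr0.
Qed.

End FoulkesBasis.

Lemma fpf_involution_conj (T : finType) (s t : {perm T}) :
    involutive s -> involutive t -> (forall x, s x != x) -> (forall x, t x != x) ->
  exists u, (t = s ^ u)%g.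
Proof.
move=> sK tK s_fpf t_fpf; apply: conj_of_orbit_sizes => k.
have card2 (w : {perm T}) : involutive w -> (forall x, w x != x) ->
    forall x, #|porbit w x| = 2%N.
  move=> wK w_fpf x; have -> : porbit w x = [set x; w x].
    apply/eqP; rewrite eqEsubset; apply/andP; split.
      apply: porbit_sub => [y|]; last by rewrite !inE eqxx.
      by rewrite !inE => /orP[]/eqP->; rewrite ?wK eqxx ?orbT.
    by rewrite subUset !sub1set porbit_id porbit_step.
  by rewrite cards2 eq_sym w_fpf.
by apply: eq_card => x; rewrite !inE !card2.
Qed.

(** Such an s is the product of its restriction to A and the t-conjugate of that restriction, two
    factors of equal parity. *)
Lemma even_perm_of_swap (T : finType) (A : {set T}) (t s : {perm T}) :
    involutive t -> (forall x, (t x \in A) = (x \notin A)) ->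
    (forall x, (s x \in A) = (x \in A)) -> (t ^ s)%g = t ->
  odd_perm s = false.
Proof.
move=> tK tA sA ts; have st x : s (t x) = t (s x) by rewrite -{2}ts conjgE !permM permK.
have s1_inj : injective (fun x => if x \in A then s x else x).
  move=> x y; case: ifP => Ax; case: ifP => Ay //; first exact: perm_inj.
    by move=> e; move: Ay; rewrite -e sA Ax.
  by move=> e; move: Ax; rewrite e sA Ay.
pose s1 := perm s1_inj.
suff -> : s = (s1 * s1 ^ t)%g by rewrite odd_permM odd_permJ addbb.
have tV : t^-1%g = t.
  by apply/permP=> x; apply: (@perm_inj _ t); rewrite permKV tK.
apply/permP=> x; rewrite permM conjgE !permM tV !permE.
have [Ax|nAx] := boolP (x \in A); first by rewrite tA sA Ax /= tK.
by rewrite tA nAx st tK.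
Qed.

(** * Eigenvectors of the Foulkes module attached to an even partition *)

Section EvenPartition.
Variables (m : nat) (la : partition_of (2 * m)).
Hypothesis even_la : even_partition la.
Variable t : {ffun 'I_(2 * m) -> 'I_(2 * m) * 'I_(2 * m)}.
Hypotheses (tab_t : is_tableau la t) (col_t : column_filled t).
Implicit Types (i j x : 'I_(2 * m)) (r s g z : 'S_(2 * m)).

Lemma diagram_flip i j : (i, j) \in diagram la -> (i, flip m j) \in diagram la.
Proof.
rewrite !inE /= permE /= => lt; have := forallP even_la i; move: lt.
by have := odd_double_half j; case: (odd j) => /=; have := odd_double_half (part la i);
   case: (odd (part la i)) => //=; lia.
Qed.

(** Pairs neighbouring entries within each row; rows have even length, so the default x is never
    taken. *)
Definition horizontal_fun x : 'I_(2 * m) :=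
  odflt x [pick y | t y == ((t x).1, flip m (t x).2)].

Lemma horizontal_funE x : t (horizontal_fun x) = ((t x).1, flip m (t x).2).
Proof.
rewrite /horizontal_fun; case: pickP => [y /eqP //|no].
have := tableau_mem tab_t x; rewrite [t x]surjective_pairing => /diagram_flip.
by case/(tableauP tab_t) => y /eqP; rewrite -surjective_pairing no.
Qed.

Lemma horizontal_funK : involutive horizontal_fun.
Proof.
move=> x; apply: (tableau_inj tab_t); rewrite !horizontal_funE /= flipK.
by rewrite -surjective_pairing.
Qed.

Definition horizontal : 'S_(2 * m) := perm (can_inj horizontal_funK).

Lemma horizontalE x : t (horizontal x) = ((t x).1, flip m (t x).2).
Proof. by rewrite permE horizontal_funE. Qed.

Lemma horizontalK : involutive horizontal.
Proof. by move=> x; rewrite !permE horizontal_funK. Qed.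

Lemma horizontal_fpf x : horizontal x != x.
Proof.
apply/eqP=> /(congr1 t); rewrite horizontalE => /(congr1 snd) /= /eqP.
by rewrite (negPf (flip_fpf _)).
Qed.

Lemma exists_horizontal : exists z, horizontal = (flip m ^ z)%g.
Proof.
exact: fpf_involution_conj (@flipK m) horizontalK (@flip_fpf m) horizontal_fpf.
Qed.

Definition row_stabiliser : {set 'S_(2 * m)} :=
  [set r : 'S_(2 * m) | [forall x, (t (r x)).1 == (t x).1]].

Lemma row_stabP r : reflect (forall x, (t (r x)).1 = (t x).1) (r \in row_stabiliser).
Proof. by rewrite inE; apply: (iffP forallP) => rt x; apply/eqP. Qed.

(** Rules out cancellation: every term contributing to the coordinate at the horizontal matching has
    sign +1. *)
Lemma horizontal_stab_even r s : r \in row_stabiliser -> s \in column_stabiliser t ->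
  (horizontal ^ (r * s))%g = horizontal -> odd_perm s = false.
Proof.
move=> /row_stabP rR /column_stabP sC e.
have e1 : (horizontal ^ r)%g = (horizontal ^ s^-1)%g by rewrite -[in RHS]e conjgM conjgK.
(* Conjugation by r keeps partners in the same row; conjugation by the inverse of s puts them in
   paired columns. The common conjugate is therefore the horizontal matching. *)
have e2 : (horizontal ^ r)%g = horizontal.
  apply/permP=> x; apply: (tableau_inj tab_t).
  rewrite horizontalE [LHS]surjective_pairing; congr (_, _).
    rewrite -[x](permKV r) conjgE !permM permK rR horizontalE /=.
    by rewrite -rR.
  rewrite e1 -{1}[x](permK s) conjgE !permM invgK permK.
  have sV y : (t ((s^-1)%g y)).2 = (t y).2 by rewrite -sC permKV.
  by rewrite sV horizontalE /= sC.
have hs : (horizontal ^ s)%g = horizontal by rewrite -{1}e2 e1 conjgKV.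
apply: (@even_perm_of_swap _ [set x | odd (t x).2] horizontal) => // [|x|x].
- exact: horizontalK.
- by rewrite !inE horizontalE /= permE flip_fun_odd.
- by rewrite !inE sC.
Qed.

Section OverField.
Variable F : fieldType.

Definition row_sum z : 'rV[F]_#|rcosets (wreath m) (SymGroup (2 * m))| :=
  \sum_(r in row_stabiliser) bvec F (z * r)%g.

Lemma row_sum_fix z g : (forall x, (t (g x)).1 = (t x).1) ->
  row_sum z *m foulkes F m g = row_sum z.
Proof.
move=> gR; rewrite /row_sum mulmx_suml [RHS](reindex_inj (mulIg g)) /=.
apply: eq_big => [r|r _]; last by rewrite bvec_act mulgA.
apply/row_stabP/row_stabP=> rR x; first by rewrite permM gR.
by rewrite -gR -permM.
Qed.

Definition foulkes_vector z := column_sum t (foulkes F m) (row_sum z).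

Lemma coef_foulkes_vector z y : coef (foulkes_vector z) y =
  \sum_(s in column_stabiliser t) \sum_(r in row_stabiliser)
     (-1) ^+ s * ((flip m ^ y)%g == (flip m ^ (z * r * s))%g)%:R.
Proof.
rewrite /foulkes_vector /column_sum coef_sum; apply: eq_bigr => s _.
rewrite coefZ mulmx_suml coef_sum mulr_sumr; apply: eq_bigr => r _.
by rewrite bvec_act coef_bvec.
Qed.

Lemma foulkes_vector_eigen z : (2%:R : F) != 0 ->
  jm_eigen (foulkes F m) (foulkes_vector z) (fun k => (node_content t k)%:~R).
Proof. by move=> F2; apply: (column_sum_eigen tab_t col_t F2); apply: row_sum_fix. Qed.

End OverField.

(** The coordinate at z is a positive integer N counting pairs of row and column permutations;
    modulo p it may vanish. *)
Lemma foulkes_vector_rat_neq0 z : horizontal = (flip m ^ z)%g ->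
  foulkes_vector rat z != 0.
Proof.
move=> e0; apply/eqP=> v0.
have : coef (foulkes_vector rat z) z = 0 by rewrite v0 /coef mxE.
pose N := (\sum_(s in column_stabiliser t) \sum_(r in row_stabiliser)
   ((flip m ^ z)%g == (flip m ^ (z * r * s))%g))%N.
have -> : coef (foulkes_vector rat z) z = N%:R.
  rewrite coef_foulkes_vector natr_sum; apply: eq_bigr => s st.
  rewrite natr_sum; apply: eq_bigr => r rt.
  case: eqP => [e|_]; last by rewrite mulr0.
  have -> : odd_perm s = false; last by rewrite mul1r.
  by apply: (horizontal_stab_even rt st); rewrite e0 -conjgM mulgA -e.
move/eqP; rewrite Num.Theory.pnatr_eq0 /N (bigD1 1%g) /=; last first.
  by apply/column_stabP=> x; rewrite perm1.
rewrite (bigD1 1%g) /=; last by apply/row_stabP=> x; rewrite perm1.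
by rewrite !mulg1 eqxx.
Qed.

Section ModularReduction.
Variables (p : nat) (F : fieldType).
Hypothesis charF : p \in [pchar F].
Local Notation S := (rcosets (wreath m) (SymGroup (2 * m))).

Definition coset_mx (R : pzRingType) g : 'M[R]_#|S| :=
  \matrix_(i, j) (enum_val j == enum_val i :* g)%:R.

Lemma coset_mxE (K : fieldType) g : foulkes K m g = coset_mx K g.
Proof. by apply/matrixP=> i j; rewrite !mxE /= rcosetE. Qed.

Lemma map_coset_mx (K : fieldType) g : map_mx intr (coset_mx int g) = foulkes K m g.
Proof. by rewrite coset_mxE; apply/matrixP=> i j; rewrite !mxE; case: (_ == _). Qed.

Definition coset_jm (k : 'I_(2 * m)) : 'M[int]_#|S| :=
  \sum_(a : 'I_(2 * m) | (a < k)%N) coset_mx int (tperm a k).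

Lemma map_coset_jm (K : fieldType) k : map_mx intr (coset_jm k) = jm (foulkes K m) k.
Proof. by rewrite raddf_sum; apply: eq_bigr => a _; apply: map_coset_mx. Qed.

Lemma integral_eigenvector : exists2 u : 'rV[int]_#|S|, u != 0 &
  forall k, u *m coset_jm k = node_content t k *: u.
Proof.
have [z ez] := exists_horizontal.
pose u : 'rV[int]_#|S| := \row_j \sum_(s in column_stabiliser t)
  \sum_(r in row_stabiliser) (-1) ^+ s * (enum_val j == wreath m :* (z * r * s))%:R.
have uE : map_mx intr u = foulkes_vector rat z.
  apply/rowP=> j; have [y ey] := enum_val_coset j.
  rewrite [RHS](coefE _ ey) coef_foulkes_vector !mxE rmorph_sum; apply: eq_bigr => s _.
  rewrite rmorph_sum; apply: eq_bigr => r _.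
  by rewrite rmorphM rmorph_sign rmorph_nat ey rcoset_wreathP.
have intr_inj : injective (map_mx (intr : int -> rat) : 'rV_#|S| -> 'rV_#|S|).
  by move=> w1 w2 /rowP e; apply/rowP=> j; have := e j; rewrite !mxE => /intr_inj.
exists u => [|k].
  apply: contra (foulkes_vector_rat_neq0 ez) => /eqP u0.
  by rewrite -uE u0 map_mx0.
have two : (2%:R : rat) != 0 by [].
apply: intr_inj; rewrite map_mxM map_mxZ uE map_coset_jm.
exact: foulkes_vector_eigen.
Qed.

(** Starting from a nonzero integral eigenvector, p is divided out as long as the reduction is zero.
    The eigenvalue equations survive and the sum of absolute values of the coordinates drops. *)
Lemma modular_eigenvector : exists2 u : 'rV[F]_#|S|, u != 0 &
  jm_eigen (foulkes F m) u (fun k => (node_content t k)%:~R).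
Proof.
have [u u_neq0 uJ] := integral_eigenvector.
suff [u' u'_neq0 u'J] : exists2 u' : 'rV[int]_#|S|, map_mx intr u' != 0 :> 'rV[F]_#|S| &
    forall k, u' *m coset_jm k = node_content t k *: u'.
  exists (map_mx intr u') => // k; rewrite -map_coset_jm.
  by rewrite -map_mxM u'J map_mxZ.
have [N leN] := ubnP (\sum_j absz (u 0%R j))%N.
elim: N => // N IHN in u u_neq0 uJ leN *.
have [u0|nz] := eqVneq (map_mx intr u : 'rV[F]_#|S|) 0; last by exists u.
have dv (j : 'I_#|S|) : (p %| u 0%R j)%Z.
  have := congr1 (fun w : 'rV[F]_#|S| => w 0 j) u0; rewrite !mxE => /eqP.
  by rewrite -(dvdz_pcharf charF).
pose u1 := \row_j (u 0%R j %/ p)%Z : 'rV[int]_#|S|.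
have uE : u = p%:Z *: u1 by apply/rowP=> j; rewrite !mxE mulrC divzK.
have p_gt0 : (p != 0)%N by rewrite -lt0n prime_gt0 // (pcharf_prime charF).
apply: (IHN u1).
- by apply: contra u_neq0 => /eqP e; rewrite uE e scaler0.
- move=> k; have := uJ k; rewrite uE -scalemxAl scalerA mulrC -scalerA.
  move=> /rowP e; apply/rowP=> j; have := e j; rewrite [LHS]mxE [RHS]mxE.
  by apply: mulfI.
- have [j nj] : exists j : 'I_#|S|, u 0 j != 0.
    apply/existsP; apply: contraNT u_neq0 => /existsPn h; apply/eqP/rowP=> j.
    by have := h j; rewrite negbK mxE => /eqP.
  have absE (i : 'I_#|S|) : absz (u 0%R i) = (p * absz (u1 0%R i))%N.
    by rewrite uE [X in absz X]mxE abszM absz_nat.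
  have p_gt1 : (1 < p)%N by rewrite prime_gt1 // (pcharf_prime charF).
  move: nj; rewrite -absz_eq0 absE muln_eq0 negb_or => /andP[_ nj].
  rewrite -ltnS; apply: leq_trans leN; rewrite ltnS.
  rewrite (bigD1 j) //= [X in (_ < X)%N](bigD1 j) //= -addSn leq_add //.
    by rewrite absE ltn_Pmull // lt0n.
  by apply: leq_sum => i _; rewrite absE leq_pmull // ltnW.
Qed.

End ModularReduction.
End EvenPartition.

Lemma tableau_choice n : exists tab : partition_of n -> {ffun 'I_n -> 'I_n * 'I_n},
  forall la, is_tableau la (tab la) /\ column_filled (tab la).
Proof.
apply: (@fin_all_exists _ _ (fun la t => is_tableau la t /\ column_filled t)) => la.
by have [t] := exists_column_filled la; exists t.
Qed.

Lemma mulmx_prod_eigen (F : fieldType) d (I : Type) (r : seq I) (P : pred I)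
    (A : I -> 'M[F]_d) (a : I -> F) (v : 'rV[F]_d) :
    (forall i, P i -> v *m A i = a i *: v) ->
  v *m (\prod_(i <- r | P i) A i) = (\prod_(i <- r | P i) a i) *: v.
Proof.
move=> vA; elim: r => [|i r IH]; first by rewrite !big_nil scale1r mulmx1.
rewrite !big_cons; case: ifP => // Pi.
by rewrite mulmxA vA // -scalemxAl IH scalerA.
Qed.

(** * Central characters on the Foulkes module *)

Section EvenCharacters.
Variables (m : nat) (tab : partition_of (2 * m) -> {ffun 'I_(2 * m) -> 'I_(2 * m) * 'I_(2 * m)}).
Hypothesis tabP : forall la, is_tableau la (tab la) /\ column_filled (tab la).
Local Notation n := (2 * m)%N.
Local Notation G := (SymGroup n).
Local Notation S := (rcosets (wreath m) G).
Local Notation E := [set la : partition_of n | even_partition la].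
Implicit Types (la mu : partition_of n) (g x b : 'S_n).

Local Notation contents := (tableau_contents tab).

Section Rational.
Local Notation H := (foulkes rat m).

Definition wreath_sum : 'M[rat]_#|S| := \sum_(b in wreath m) H b.

Lemma wreath_sum_fix b : b \in wreath m -> wreath_sum *m H b = wreath_sum.
Proof.
move=> Bb; rewrite /wreath_sum mulmx_suml [RHS](reindex_inj (mulIg b)).
apply: eq_big => [x|x _]; last by rewrite repr_mxM ?in_setT.
by rewrite groupMr.
Qed.

(** An eigenvector is translated until its coordinate at the base coset is nonzero and then summed
    over the wreath product. The result need no longer be an eigenvector of the J_k, but equivariant
    matrices act on it by the same scalars. *)
Lemma exists_wreath_fixed la : even_partition la ->
  exists2 w : 'rV[rat]_#|S|, w != 0 &
    [/\ forall b, b \in wreath m -> w *m H b = w &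
    forall y : 'M[rat]_#|S|, (forall g, H g *m y = y *m H g) -> forall a,
      (forall v, jm_eigen H v (contents rat la) -> v *m y = a *: v) -> w *m y = a *: w].
Proof.
move=> even_la; have [tab_t col_t] := tabP la.
have [z ez] := exists_horizontal even_la tab_t.
have u_neq0 := foulkes_vector_rat_neq0 ez.
have two : (2%:R : rat) != 0 by [].
have uJ := foulkes_vector_eigen tab_t col_t z two.
set u := foulkes_vector (tab la) rat z in u_neq0 uJ.
have [x ux] : exists x, coef u x != 0.
  apply/existsP; apply: contraNT u_neq0 => /existsPn h; apply/eqP/coef_inj => x.
  by have := h x; rewrite negbK => /eqP->; rewrite /coef mxE.
exists (u *m H x^-1%g *m wreath_sum).
  apply: contraNneq ux => w0.
  have : coef (u *m H x^-1%g *m wreath_sum) 1 = 0 by rewrite w0 /coef mxE.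
  rewrite /wreath_sum mulmx_sumr coef_sum (eq_bigr (fun=> coef u x)) => [|b Bb].
    rewrite sumr_const => /eqP; rewrite -mulr_natr mulf_eq0 => /orP[//|].
    by rewrite Num.Theory.pnatr_eq0 eqn0Ngt cardG_gt0.
  rewrite !coef_act mul1g invgK; apply: coef_matching; rewrite conjgM.
  by have /wreathP-> : (b^-1)%g \in wreath m by rewrite groupV.
split=> [b Bb|y cy a ya]; first by rewrite -[LHS]mulmxA wreath_sum_fix.
have cS : wreath_sum *m y = y *m wreath_sum.
  by rewrite mulmx_suml mulmx_sumr; apply: eq_bigr => b _; apply: cy.
by rewrite -[LHS]mulmxA cS mulmxA -[X in X *m _ = _]mulmxA cy mulmxA ya // -!scalemxAl.
Qed.

(** Fixed vectors are constant on double cosets, so they lie in a space spanned by one indicator for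
    each even partition; independent fixed vectors in that number span it. *)
Lemma wreath_fixed_type (W : 'M[rat]_(#|E|, #|S|)) :
    row_free W -> (forall i b, b \in wreath m -> row i W *m H b = row i W) ->
  forall v : 'rV[rat]_#|S|, (forall b, b \in wreath m -> v *m H b = v) -> (v <= W)%MS.
Proof.
move=> freeW fixW.
have [ty even_ty tyP] := matching_types (@flipK m) (@flip_fpf m).
pose cty (j : 'I_#|S|) := ty (repr (enum_val j)).
have cosetP (j : 'I_#|S|) : enum_val j = wreath m :* repr (enum_val j).
  have [x ->] := enum_val_coset j; exact/esym/rcoset_repr.
pose D : 'M[rat]_(#|E|, #|S|) := \matrix_(i, j) (cty j == enum_val i)%:R.
have fixD (v : 'rV[rat]_#|S|) : (forall b, b \in wreath m -> v *m H b = v) -> (v <= D)%MS.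
  move=> fv; have same j j' : cty j = cty j' -> v 0 j = v 0 j'.
    move=> /tyP[b /wreathP Bb e].
    rewrite (coefE _ (cosetP j)) (coefE _ (cosetP j')) -(coef_matching v e).
    by rewrite -{2}(fv _ Bb) coef_act mulgK.
  apply/submxP; exists (\row_i (if [pick j | cty j == enum_val i] is Some j then v 0 j else 0)).
  apply/rowP=> j; rewrite !mxE.
  have Ej : cty j \in E by rewrite inE even_ty.
  rewrite (bigD1 (enum_rank_in Ej (cty j))) //= !mxE enum_rankK_in // eqxx mulr1.
  rewrite big1 ?addr0 => [|i ni]; last first.
    rewrite !mxE; case: eqP => [e|_]; last by rewrite mulr0.
    by case/eqP: ni; apply: enum_val_inj; rewrite enum_rankK_in.
  by case: pickP => [j' /eqP/same-> //|/(_ j)]; rewrite eqxx.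
have WD : (W <= D)%MS by apply/row_subP=> i; apply: fixD; apply: fixW.
have /eqmxP DW : (W == D)%MS.
  have [_ <-] := mxrank_leqif_eq WD; rewrite eqn_leq mxrankS //.
  by rewrite (eqnP freeW) rank_leq_row.
by move=> v /fixD; rewrite DW.
Qed.

Lemma separating_index la mu : la != mu -> exists k : 'I_n.+1,
  poly_eval (elementary_coefs k) (contents rat la)
    != poly_eval (elementary_coefs k) (contents rat mu).
Proof.
move=> ne; apply/existsP; apply: contraNT ne => /existsPn h.
have [k|s es] := @perm_of_elementary n rat (contents rat la) (contents rat mu).
  by have := h k; rewrite negbK => /eqP.
apply/eqP; have [tab_la _] := tabP la; have [tab_mu _] := tabP mu.
apply: (node_content_inj (s := s) tab_la tab_mu) => k.
by apply: intr_inj (es k).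
Qed.

(** The fixed vectors for distinct even partitions are separated by elementary symmetric central
    elements, hence independent. By counting they span the base coset vector, which generates the
    module. *)
Lemma rational_faithful (y : 'M[rat]_#|S|) : (forall g, H g *m y = y *m H g) ->
    (forall la, even_partition la -> forall v,
       jm_eigen H v (contents rat la) -> v *m y = 0) ->
  y = 0.
Proof.
move=> cy y0; pose c (i : 'I_#|E|) := contents rat (enum_val i).
pose pe (k : 'I_n.+1) i := poly_eval (elementary_coefs k) (c i).
have ev (i : 'I_#|E|) : even_partition (enum_val i) by have := enum_valP i; rewrite inE.
have [w w_neq0 wP] := fin_all_exists2 (fun i : 'I_#|E| => exists_wreath_fixed (ev i)).
have [Z ZP] : exists Z : 'I_n.+1 -> 'M[rat]_#|S|, forall k,
    (forall g, H g *m Z k = Z k *m H g) /\ forall i, w i *m Z k = pe k i *: w i.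
  apply: (@fin_all_exists _ _ (fun k Z => (forall g, H g *m Z = Z *m H g) /\
    forall i, w i *m Z = pe k i *: w i)) => k.
  have [e [Ze _] eE] := central_of_symmetric rat (@elementary_coefs_sym n k).
  exists (gring_op H e); split=> [g|i]; first exact: central_comm.
  have [_ wE] := wP i; apply: wE => [g|v vc]; first exact: central_comm.
  exact: eE.
have [ix ixP] : exists ix : 'I_#|E| -> 'I_#|E| -> 'I_n.+1,
    forall i j, i != j -> pe (ix i j) i != pe (ix i j) j.
  exists (fun i j => odflt ord0 [pick k | pe k i != pe k j]) => i j ne.
  case: pickP => [k //|no]; have [|k] := @separating_index (enum_val i) (enum_val j).
    by rewrite (inj_eq enum_val_inj).
  by rewrite -[_ != _]/(pe k i != pe k j) no.
pose W := \matrix_i w i; have WE i : row i W = w i by rewrite rowK.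
have freeW : row_free W.
  rewrite -kermx_eq0; apply/rowV0P=> r /sub_kermxP; rewrite mulmx_sum_row => r0.
  apply/rowP=> i; rewrite [RHS]mxE.
  (* An interpolation product: Q kills every [w l] with l different from i and multiplies [w i] by a
     nonzero scalar. *)
  pose Q := \prod_(l | l != i) (Z (ix i l) - (pe (ix i l) l)%:M).
  have wQ j : w j *m Q = (\prod_(l | l != i) (pe (ix i l) j - pe (ix i l) l)) *: w j.
    apply: mulmx_prod_eigen => l _; rewrite mulmxBr mul_mx_scalar.
    by have [_ ->] := ZP (ix i l); rewrite scalerBl.
  have := congr1 (mulmx^~ Q) r0; rewrite /= mul0mx mulmx_suml (bigD1 i) //=.
  rewrite big1 ?addr0 => [|j ji]; last first.
    by rewrite -scalemxAl WE wQ (bigD1 j) //= subrr mul0r scale0r scaler0.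
  rewrite -scalemxAl WE wQ scalerA => /eqP; rewrite scaler_eq0 (negPf (w_neq0 i)) orbF.
  rewrite mulf_eq0 => /orP[/eqP //|/prodf_eq0[l li]].
  by rewrite subr_eq0 (negPf (ixP i l _)) // eq_sym.
apply: equivariant_mx_eq; [exact: cy | by move=> g; rewrite mulmx0 mul0mx |].
rewrite mulmx0; have /submxP[r ->] : (bvec rat 1 <= W)%MS.
  apply: wreath_fixed_type freeW _ _ _ => [i b Bb|b /wreathP Bb].
    by rewrite WE; have [-> ] := wP i.
  by rewrite bvec_act mul1g; apply: bvec_eq; rewrite Bb conjg1.
rewrite -mulmxA (_ : W *m y = 0) ?mulmx0 //; apply/row_matrixP=> i.
rewrite row_mul WE row0 -[RHS](scale0r (w i)); have [_ wE] := wP i.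
by apply: wE => // v vc; rewrite scale0r; apply: y0 vc.
Qed.

End Rational.

Section Modular.
Variable F : fieldType.
Local Notation H := (foulkes F m).

Lemma class_sum_eigen (K0 : fieldType) d (rG : mx_representation K0 G d)
    (W : {set 'S_n} -> {ffun 'I_n -> 'I_n.+1} -> int) K v c :
    (forall w, word_coef (W K) w = (w \in K)%:R) -> jm_eigen rG v c ->
  v *m class_sum rG K = poly_eval (W K) c *: v.
Proof.
move=> WK vc; rewrite -(jm_eigen_poly (W K) vc); congr (_ *m _).
rewrite /class_sum big_mkcond /=; apply: eq_bigr => g _.
by rewrite WK; case: (g \in K); rewrite ?mulr1z ?mulr0z.
Qed.

Lemma class_sum_comm (K0 : fieldType) d (rG : mx_representation K0 G d) K g :
  K \in classes G -> rG g *m class_sum rG K = class_sum rG K *m rG g.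
Proof.
move=> /imsetP[x _ ->]; rewrite mulmx_sumr mulmx_suml.
rewrite [LHS](reindex_inj (@conjg_inj _ g)); apply: eq_big => [h|h _].
  by rewrite memJ_norm // (subsetP (class_norm _ _)) ?in_setT.
by rewrite -!repr_mxM ?in_setT // -conjgC.
Qed.

Lemma prod_scale_mx d (I : Type) (r : seq I) (a : I -> F) (A : I -> 'M[F]_d) :
  \prod_(i <- r) (a i *: A i) = (\prod_(i <- r) a i) *: \prod_(i <- r) A i.
Proof.
elim: r => [|i r IH]; first by rewrite !big_nil scale1r.
rewrite !big_cons IH -[LHS]/(_ *m _) -scalemxAl -scalemxAr scalerA.
by [].
Qed.

(** For each even partition the element can be rewritten as a combination of class sums minus their
    eigenvalues there. Multiplying these expressions over all even partitions leaves only products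
    that vanish already over the integers. *)
Theorem foulkes_central_nilpotent (e : 'M[F]_#|G|) : (e \in 'Z(group_ring F G))%MS ->
    (forall la, even_partition la -> exists2 u, u != 0 &
       jm_eigen H u (contents F la) /\ u *m gring_op H e = 0) ->
  gring_op H e ^+ #|E| = 0.
Proof.
move=> /class_function_of_central[z zJ ez] e0; have [W WP] := class_weights n.
pose KI (K : {set 'S_n}) : 'M[int]_#|S| := \sum_(g in K) coset_mx int g.
have KIE (K0 : fieldType) K : map_mx intr (KI K) = class_sum (foulkes K0 m) K.
  by rewrite raddf_sum; apply: eq_bigr => g _; apply: map_coset_mx.
pose X (i : 'I_#|E|) K : 'M[int]_#|S| :=
  KI K - (poly_eval (W K) (contents int (enum_val i)))%:M.
have XE (K0 : fieldType) i K : map_mx intr (X i K) = class_sum (foulkes K0 m) K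
    - (poly_eval (W K) (contents K0 (enum_val i)))%:M.
  rewrite map_mxB KIE map_scalar_mx; congr (_ - _%:M).
  rewrite (rmorph_poly_eval intr); apply: eq_poly_eval => k.
  by rewrite /tableau_contents intz.
(* On an eigenvector for an even partition the factor with that index is zero, and rational
   faithfulness applies; integral matrices embed in rational ones. *)
have X0 (ka : {ffun 'I_#|E| -> {set 'S_n}}) : (forall i, ka i \in classes G) ->
    \prod_i X i (ka i) = 0.
  move=> kaP; have map_inj (M N : 'M[int]_#|S|) :
      map_mx intr M = map_mx intr N :> 'M[rat]_#|S| -> M = N.
    move=> /matrixP e'; apply/matrixP=> i j; have := e' i j.
    by rewrite !mxE => /intr_inj.
  apply: map_inj; rewrite map_mx0.
  have mapP : map_mx intr (\prod_i X i (ka i)) = \prod_i map_mx intr (X i (ka i)) :> 'M[rat]_#|S|.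
    by apply: (big_morph (map_mx intr)); [apply: map_mxM | apply: map_mx1].
  rewrite mapP; apply: rational_faithful => [g|la even_la v vc].
    have: GRing.comm (foulkes rat m g : 'M_#|S|) (\prod_i map_mx intr (X i (ka i))); last by [].
    apply: commr_prod => i _; rewrite XE; apply: commrB; last first.
      by rewrite /GRing.comm -[LHS]/(_ *m _) -[RHS]/(_ *m _) scalar_mxC.
    rewrite /GRing.comm -[LHS]/(_ *m _) -[RHS]/(_ *m _).
    exact: class_sum_comm (kaP i).
  have la_E : la \in E by rewrite inE.
  rewrite (@mulmx_prod_eigen _ _ _ _ predT _ (fun i =>
    poly_eval (W (ka i)) (contents rat la)
      - poly_eval (W (ka i)) (contents rat (enum_val i)))) => [|i _].
    rewrite (bigD1 (enum_rank_in la_E la)) //= enum_rankK_in // subrr mul0r.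
    by rewrite scale0r.
  have [_ WK] := WP _ (kaP i).
  by rewrite XE mulmxBr mul_mx_scalar (class_sum_eigen WK vc) scalerBl.
(* Extending by 0 lets K range over a finite type, as the distribution of the product of sums below
   requires. *)
pose zk K := if K \in classes G then z (repr K) else 0.
pose y := gring_op H e.
have yE : y = \sum_(K : {set 'S_n}) zk K *: class_sum H K.
  rewrite /y ez class_function_sum // [LHS]big_mkcond /=; apply: eq_bigr => K _.
  by rewrite /zk; case: ifP => _; rewrite ?scale0r.
(* Subtracting the eigenvalues changes nothing: their combination is the scalar by which y acts on
   u, namely 0. *)
have yX i : y = \sum_(K : {set 'S_n}) zk K *: map_mx intr (X i K).
  have [|u u_neq0 [uc uy]] := e0 (enum_val i); first by have := enum_valP i; rewrite inE.
  have: u *m y = (\sum_(K : {set 'S_n}) zk K * poly_eval (W K) (contents F (enum_val i))) *: u.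
    rewrite yE mulmx_sumr scaler_suml; apply: eq_bigr => K _.
    rewrite -scalemxAr -scalerA /zk; case: (boolP (K \in classes G)) => [KG|_].
      by have [_ WK] := WP _ KG; rewrite (class_sum_eigen WK uc).
    by rewrite !scale0r.
  rewrite /y uy => /esym/eqP; rewrite scaler_eq0 (negPf u_neq0) orbF => /eqP s0.
  rewrite [LHS]yE; under [RHS]eq_bigr do rewrite XE scalerBr scale_scalar_mx.
  by rewrite sumrB -raddf_sum /= s0 raddf0 subr0.
rewrite -/y -[#|E|]card_ord -prodr_const.
rewrite (eq_bigr (fun i => \sum_(K : {set 'S_n}) zk K *: map_mx intr (X i K))) => [|i _]; last exact: yX.
rewrite bigA_distr_bigA big1 //= => ka _; rewrite prod_scale_mx.
case: (boolP [forall i, ka i \in classes G]) => [/forallP kaP|/forallPn[i ni]].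
  have -> : \prod_i map_mx intr (X i (ka i)) = map_mx intr (\prod_i X i (ka i)) :> 'M[F]_#|S|.
    by apply/esym/(big_morph (map_mx intr)); [apply: map_mxM | apply: map_mx1].
  by rewrite X0 // map_mx0 scaler0.
by rewrite (bigD1 i) //= /zk (negPf ni) mul0r scale0r.
Qed.

End Modular.
End EvenCharacters.

(** * Blocks *)

Section CentralAlgebra.
Variables (F : fieldType) (gT : finGroupType) (G : {group gT}).
Implicit Types (e f : 'M[F]_#|G|).
Local Notation Z := ('Z(group_ring F G))%MS.

Lemma centralP e : reflect ((e \in group_ring F G)%MS /\
    forall g, g \in G -> e *m regular_repr F G g = regular_repr F G g *m e) (e \in Z)%MS.
Proof.
rewrite sub_capmx memmx_cent_envelop.
by apply: (iffP andP) => -[Re /centgmxP ce]; split => //; apply/centgmxP.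
Qed.

Lemma central1 : (1%:M \in Z)%MS.
Proof.
apply/centralP; split=> [|g _]; last by rewrite mulmx1 mul1mx.
by rewrite -(repr_mx1 (regular_repr F G)) envelop_mx_id.
Qed.

Lemma centralM e f : (e \in Z)%MS -> (f \in Z)%MS -> (e *m f \in Z)%MS.
Proof.
move=> /centralP[Re ce] /centralP[Rf cf]; apply/centralP; split=> [|g Gg].
  exact: envelop_mxM.
by rewrite -mulmxA cf // mulmxA ce // mulmxA.
Qed.

Lemma centralB e f : (e \in Z)%MS -> (f \in Z)%MS -> (e - f \in Z)%MS.
Proof. by move=> Ze Zf; rewrite linearB addmx_sub // eqmx_opp. Qed.

Lemma centralZ a e : (e \in Z)%MS -> (a *: e \in Z)%MS.
Proof. by move=> Ze; rewrite linearZ scalemx_sub. Qed.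

Lemma central_sum (I : eqType) (r : seq I) (E : I -> 'M[F]_#|G|) :
  (forall i, i \in r -> (E i \in Z)%MS) -> (\sum_(i <- r) E i \in Z)%MS.
Proof. by move=> ZE; rewrite linear_sum big_seq summx_sub. Qed.

Lemma centralX e k : (e \in Z)%MS -> (e ^+ k \in Z)%MS.
Proof.
by move=> Ze; elim: k => [|k IH]; [apply: central1 | rewrite exprS; apply: centralM].
Qed.

Lemma centralC e f : (e \in Z)%MS -> (f \in Z)%MS -> e *m f = f *m e.
Proof.
rewrite sub_capmx => /andP[Re _]; rewrite sub_capmx => /andP[_ /cent_mxP cf].
exact: cf.
Qed.

Lemma central_gring_opM e f d (rG : mx_representation F G d) : (f \in Z)%MS ->
  gring_op rG (e *m f) = gring_op rG e *m gring_op rG f.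
Proof. by move=> /centralP[Rf _]; rewrite gring_opM. Qed.

Lemma central_gring_opX e k d (rG : mx_representation F G d) : (e \in Z)%MS ->
  gring_op rG (e ^+ k) = gring_op rG e ^+ k.
Proof.
move=> Ze; elim: k => [|k IH]; first by rewrite !expr0 [LHS]gring_op1.
by rewrite !exprSr [LHS]central_gring_opM // IH.
Qed.

Lemma central_idempotentM e f : central_idempotent e -> central_idempotent f ->
  central_idempotent (e *m f).
Proof.
move=> [Ze ee] [Zf ff]; split; first exact: centralM.
by rewrite mulmxA -[e *m f *m e]mulmxA (centralC Zf Ze) mulmxA ee -mulmxA ff.
Qed.

Lemma central_idempotentB e f : central_idempotent e -> central_idempotent f ->
  f *m e = f -> central_idempotent (e - f).
Proof.
move=> [Ze ee] [Zf ff] fe; split; first exact: centralB.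
by rewrite mulmxBl !mulmxBr ee ff fe (centralC Ze Zf) fe subrr subr0.
Qed.

Lemma block_orthogonal e f : is_block e -> is_block f -> e != f -> e *m f = 0.
Proof.
move=> [[Ze ee] _ eP] [[Zf ff] _ fP] ne.
have cef : central_idempotent (e *m f) by apply: central_idempotentM.
have [|//|ef] := eP _ cef; first by rewrite -mulmxA (centralC Zf Ze) mulmxA ee.
have [|//|fe] := fP _ cef; first by rewrite -mulmxA ff.
by move: ne; rewrite -ef fe eqxx.
Qed.

(** Descent on the rank of a central idempotent fixing v. If it splits as f plus e - f, then f acts
    on v by a scalar equal to its square, so one of the two summands still fixes v. *)
Lemma exists_block d (rG : mx_representation F G d) (v : 'rV[F]_d) : v != 0 ->
    (forall e, (e \in Z)%MS -> exists a, v *m gring_op rG e = a *: v) ->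
  exists2 e, is_block e & v *m gring_op rG e = v.
Proof.
move=> v_neq0 vZ.
have [e ce ve] : exists2 e, central_idempotent e & v *m gring_op rG e = v.
  exists 1%:M; last by rewrite gring_op1 mulmx1.
  by split; [apply: central1 | rewrite mulmx1].
have [N leN] := ubnP (\rank e); elim: N => // N IHN in e ce ve leN *.
have [Ze ee] := ce; have e_neq0 : e != 0.
  by apply: contraNneq v_neq0 => e0; rewrite -ve e0 linear0 mulmx0.
have [be|nbe] := boolp.EM (is_block e); first by exists e.
have [f [cf fe f_neq0 nfe]] : exists f,
    [/\ central_idempotent f, f *m e = f, f != 0 & f != e].
  apply: boolp.contrapT => no; apply: nbe; split=> // f cf fe.
  have [->|f0] := eqVneq f 0; first by left.
  have [->|nfe] := eqVneq f e; first by right.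
  by case: no; exists f.
have [Zf ff] := cf; have ef : e *m f = f by rewrite (centralC Ze Zf).
have rk h : h *m e = h -> (e *m h = e -> False) -> h *m h = h -> (\rank h < N)%N.
  move=> he neh hh; rewrite -ltnS; apply: leq_ltn_trans leN; rewrite ltnNge.
  apply/negP=> le; have sub : (h <= e)%MS by rewrite -he submxMl.
  have /submxP[D eD] : (e <= h)%MS.
    by have [_ <-] := mxrank_leqif_sup sub; rewrite eqn_leq le mxrankS.
  by apply: neh; rewrite {1}eD -mulmxA hh.
have [a va] := vZ f Zf.
have a2 : a * a = a.
  have := congr1 (mulmx v) (congr1 (gring_op rG) ff).
  rewrite central_gring_opM // mulmxA va -scalemxAl va scalerA => /eqP.
  by rewrite -subr_eq0 -scalerBl scaler_eq0 (negPf v_neq0) orbF subr_eq0 => /eqP.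
have [a0|na0] := eqVneq a 0; last first.
  have a1 : a = 1 by apply: (mulfI na0); rewrite a2 mulr1.
  apply: (IHN f) => //; first by rewrite va a1 scale1r.
  by apply: rk => //; rewrite ef => /eqP; rewrite (negPf nfe).
apply: (IHN (e - f)); first exact: central_idempotentB.
  by rewrite linearB mulmxBr ve va a0 scale0r subr0.
apply: rk; first by rewrite mulmxBl ee fe.
  rewrite mulmxBr ee ef => /eqP; rewrite -subr_eq0 addrAC subrr sub0r oppr_eq0.
  by rewrite (negPf f_neq0).
by rewrite mulmxBl !mulmxBr ee ff fe ef subrr subr0.
Qed.

End CentralAlgebra.

Lemma idempotent_nilpotent (F : fieldType) d (Q : 'M[F]_d) N :
  Q *m Q = Q -> Q ^+ N = 0 -> Q = 0.
Proof.
move=> QQ QN; have e k : Q ^+ k.+1 = Q.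
  by elim: k => [|k IH]; rewrite ?expr1 // exprS IH.
by case: N QN => [|N]; rewrite ?e // expr0 => Q1; rewrite -[Q]mulmx1 [1%:M]Q1 mulmx0.
Qed.

Section IdempotentPower.
Variables (p : nat) (F : fieldType).
Hypothesis charF : p \in [pchar F].

(* The powers of a matrix over the prime field are eventually periodic. *)
Lemma idempotent_power d (B : 'M[int]_d) (A : 'M[F]_d) : A = map_mx intr B ->
  exists2 k, (0 < k)%N & A ^+ k *m A ^+ k = A ^+ k.
Proof.
move=> AB; have p_pr := pcharf_prime charF.
have charFp : p \in [pchar 'F_p] by apply: pchar_Fp.
pose M k : 'M['F_p]_d := map_mx intr (B ^+ k).
have AX k : A ^+ k = map_mx intr (B ^+ k).
  rewrite AB; elim: k => [|k IH]; first by rewrite !expr0 map_mx1.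
  by rewrite !exprS IH [RHS]map_mxM.
have MA i j : M i = M j -> A ^+ i = A ^+ j.
  move=> /matrixP e; rewrite !AX; apply/matrixP=> r s; have /eqP := e r s.
  rewrite !mxE (intr_eq_mod charFp) => h; apply/eqP.
  by rewrite (intr_eq_mod charF).
have [i [j lt_ij Mij]] : exists i, exists2 j, (i < j)%N & M i = M j.
  have /injectivePn[i [j nij e]] : ~~ injectiveb (fun i : 'I_#|{: 'M['F_p]_d}|.+1 => M i).
    apply/negP=> /injectiveP/leq_card; rewrite card_ord ltnn //.
  case: (ltngtP i j) => [lt|lt|/val_inj eij]; last by rewrite eij eqxx in nij.
    by exists i, j.
  by exists j, i.
have per s t : (i <= s)%N -> A ^+ (s + t * (j - i)) = A ^+ s.
  move=> le; elim: t => [|t IH]; first by rewrite mul0n addn0.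
  rewrite mulSn addnCA exprD IH -exprD -(subnKC le) addnA subnK; last exact: ltnW.
  by rewrite !exprD (MA _ _ Mij).
(* A positive multiple of the period j - i that lies beyond the preperiod i. *)
exists (i.+1 * (j - i))%N; first by rewrite muln_gt0 subn_gt0.
have d_gt0 : (0 < j - i)%N by rewrite subn_gt0.
rewrite -[LHS]/(_ * _) -exprD per // mulSn.
exact: leq_trans (leq_pmulr i d_gt0) (leq_addl _ _).
Qed.

End IdempotentPower.

(** * Blocks of the symmetric group and Nakayama's conjecture *)

Section Blocks.
Variables (n p : nat) (F : fieldType).
Hypotheses (charF : p \in [pchar F]) (p_odd : odd p).
Variable tab : partition_of n -> {ffun 'I_n -> 'I_n * 'I_n}.
Hypothesis tabP : forall la, is_tableau la (tab la) /\ column_filled (tab la).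
Local Notation G := (SymGroup n).
Implicit Types (la mu : partition_of n).

Local Notation contents := (tableau_contents tab).

Lemma char_neq2 : (2%:R : F) != 0.
Proof.
rewrite -(dvdn_pcharf charF) dvdn_prime2 ?(pcharf_prime charF) //.
by apply: contraTneq p_odd => ->.
Qed.

Lemma content_perm la mu : content p la = content p mu <->
  exists s : 'S_n, forall k, contents F mu k = contents F la (s k).
Proof. by apply: content_eqP => //; have [] := tabP la; have [] := tabP mu. Qed.

(* A suitable power of a central element over the prime field on which the two
   central characters differ, shifted to vanish at la. *)
Lemma separating_idempotent la mu : content p la != content p mu ->
  exists2 f : 'M[F]_#|G|, central_idempotent f &
    forall d (rG : mx_representation F G d) v,
      (jm_eigen rG v (contents F la) -> v *m gring_op rG f = 0) /\
      (jm_eigen rG v (contents F mu) -> v != 0 -> v *m gring_op rG f = v).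
Proof.
move=> ne; pose a k := elementary_coefs k : {ffun 'I_n -> 'I_n.+1} -> int.
pose pe (R : comPzRingType) k nu := poly_eval (a k) (contents R nu).
have /existsP[k nk] : [exists k : 'I_n.+1, pe F k la != pe F k mu].
  apply: contraNT ne => /existsPn h; apply/eqP/content_perm.
  apply: perm_of_elementary => k.
  by have := h k; rewrite negbK => /eqP.
have peE nu : pe F k nu = (pe int k nu)%:~R.
  by rewrite (rmorph_poly_eval intr); apply: eq_poly_eval => i; rewrite /tableau_contents intz.
have sym_a : symmetric_coefs (a k) := elementary_coefs_sym k.
have [e [Ze [B eB]] eE] := central_of_symmetric F sym_a.
pose x := e - pe F k la *: 1%:M.
have Zx : (x \in 'Z(group_ring F G))%MS.
  by apply: centralB => //; apply/centralZ/central1.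
have xE d (rG : mx_representation F G d) v nu : jm_eigen rG v (contents F nu) ->
    v *m gring_op rG x = (pe F k nu - pe F k la) *: v.
  move=> vc; rewrite linearB linearZ /= gring_op1 mulmxBr (eE _ _ _ _ vc).
  by rewrite -scalemxAr mulmx1 scalerBl.
have xB : x = map_mx intr (B - pe int k la *: 1%:M).
  by rewrite map_mxB -eB map_mxZ map_mx1 /= -peE.
have [N N_gt0 xN] := idempotent_power charF xB.
have xNE d (rG : mx_representation F G d) v nu : jm_eigen rG v (contents F nu) ->
    v *m gring_op rG (x ^+ N) = (pe F k nu - pe F k la) ^+ N *: v.
  by move=> vc; rewrite central_gring_opX //; apply/mulmx_exp_eigen/xE.
exists (x ^+ N) => [|d rG v]; first by split; [apply: centralX | apply: xN].
split=> [vc|vc v_neq0]; first by rewrite (xNE _ _ _ _ vc) subrr expr0n gtn_eqF // scale0r.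
rewrite (xNE _ _ _ _ vc); set b := _ ^+ N.
(* A nonzero scalar by which an idempotent acts on a nonzero vector is 1. *)
have b_neq0 : b != 0 by rewrite expf_neq0 // subr_eq0 eq_sym.
have := congr1 (mulmx v) (congr1 (gring_op rG) xN).
rewrite central_gring_opM ?centralX // mulmxA !(xNE _ _ _ _ vc) -scalemxAl.
rewrite (xNE _ _ _ _ vc) scalerA -/b => /eqP; rewrite -subr_eq0 -scalerBl.
rewrite scaler_eq0 (negPf v_neq0) orbF -{3}[b]mulr1 -mulrBr mulf_eq0 (negPf b_neq0).
by rewrite subr_eq0 => /eqP->; rewrite scale1r.
Qed.

Definition bpoly la := polytabloid F la (tab la).

Lemma bpoly_eigen la : jm_eigen (young_module F la) (bpoly la) (contents F la).
Proof. by have [tab_t col_t] := tabP la; apply: polytabloid_eigen; rewrite ?char_neq2. Qed.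

Lemma bpoly_neq0 la : bpoly la != 0.
Proof. by have [tab_t _] := tabP la; apply: polytabloid_neq0. Qed.

(** A block fixing one polytabloid exists. Its scalar is symmetric in the contents, so it also fixes
    the polytabloids, and with them the Specht modules, of all partitions with the same content. *)
Lemma block_of_contentP la :
  block_label (block_of_content n F (content p la)) (content p la).
Proof.
apply: (@classical_sets.xgetPex _ 0 (fun e => block_label e (content p la))).
have [e0 Ze0|e be ve] := exists_block (bpoly_neq0 la) (rG := young_module F la).
  have [phi [_ phiE]] := central_scalar Ze0; exists (phi (contents F la)).
  exact/phiE/bpoly_eigen.
exists e; split=> //; first by exists la.
move=> mu /esym/content_perm[s es]; have [ce _ _] := be; have [Ze _] := ce.
have [tab_mu col_mu] := tabP mu; apply: (specht_lies_in_block tab_mu ce).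
have [phi [phi_sym phiE]] := central_scalar Ze.
have := phiE _ _ _ _ (bpoly_eigen mu); rewrite -/(bpoly mu) => ->.
have -> : contents F mu = fun k => contents F la (s k) by apply: boolp.funext.
rewrite phi_sym; have /eqP := phiE _ _ _ _ (bpoly_eigen la).
rewrite ve -subr_eq0 -{1}[bpoly la]scale1r -scalerBl scaler_eq0 (negPf (bpoly_neq0 la)).
by rewrite orbF subr_eq0 => /eqP <-; rewrite scale1r.
Qed.

(** The separation half of Nakayama's conjecture: for different contents, primitivity of e leaves 0
    or e for its product with a separating idempotent f. The value e is excluded at la, where f
    vanishes, and 0 makes e vanish at mu, where f is 1. *)
Lemma block_of_content_eigen la mu d (rG : mx_representation F G d) u :
    jm_eigen rG u (contents F mu) ->
  u *m gring_op rG (block_of_content n F (content p la))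
    = (content p la == content p mu)%:R *: u.
Proof.
set e := block_of_content _ _ _ => uc.
have [be _ le] := block_of_contentP la; rewrite -/e in be le.
have [[Ze ee] _ eP] := be; have [phi [phi_sym phiE]] := central_scalar Ze.
rewrite (phiE _ _ _ _ uc); congr (_ *: u).
have phi1 nu : content p la = content p nu -> phi (contents F nu) = 1.
  move=> /esym/le lnu; have [tab_nu _] := tabP nu.
  have := lies_in_block_polytabloid tab_nu lnu; rewrite -/(bpoly nu).
  rewrite (phiE _ _ _ _ (bpoly_eigen nu)) => /eqP.
  rewrite -subr_eq0 -{2}[bpoly nu]scale1r -scalerBl scaler_eq0 (negPf (bpoly_neq0 nu)).
  by rewrite orbF subr_eq0 => /eqP.
case: eqP => [/phi1 //|/eqP ne].
have [f cf fE] := separating_idempotent ne; have [Zf ff] := cf.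
have vE := phiE _ _ _ _ (bpoly_eigen mu).
have fe_e : f *m e *m e = f *m e by rewrite -mulmxA ee.
have [|fe|fe] := eP _ (central_idempotentM cf (conj Ze ee)); first exact: fe_e.
  have := congr1 (mulmx (bpoly mu)) (congr1 (gring_op (young_module F mu)) fe).
  rewrite central_gring_opM // mulmxA linear0 mulmx0.
  have [_ f1] := fE _ (young_module F mu) (bpoly mu).
  rewrite (f1 (bpoly_eigen mu) (bpoly_neq0 mu)) vE => /eqP; rewrite scaler_eq0 (negPf (bpoly_neq0 mu)) orbF => /eqP //.
have := congr1 (mulmx (bpoly la)) (congr1 (gring_op (young_module F la)) fe).
rewrite central_gring_opM // mulmxA.
have [f0 _] := fE _ (young_module F la) (bpoly la); rewrite (f0 (bpoly_eigen la)).
rewrite mul0mx (phiE _ _ _ _ (bpoly_eigen la)) phi1 // scale1r => /esym/eqP.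
by rewrite (negPf (bpoly_neq0 la)).
Qed.

End Blocks.

Lemma rank_sum_orthogonal (F : fieldType) d (I : eqType) (r : seq I) (C : I -> 'M[F]_d) :
    uniq r -> (forall i, i \in r -> C i *m C i = C i) ->
    (forall i j, i \in r -> j \in r -> i != j -> C i *m C j = 0) ->
  \rank (\sum_(i <- r) C i)%MS = (\sum_(i <- r) \rank (C i))%N.
Proof.
elim: r => [|i r IH] /=; first by rewrite !big_nil mxrank0.
move=> /andP[ir ur] CC C0; rewrite !big_cons mxrank_disjoint_sum ?IH //.
- by move=> j jr; apply: CC; rewrite inE jr orbT.
- by move=> j k jr kr; apply: C0; rewrite inE ?jr ?kr orbT.
apply/eqP; rewrite -submx0; apply/rV_subP=> v.
rewrite sub_capmx => /andP[/submxP[D vD] vr].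
have vi : v *m C i = v by rewrite vD -mulmxA CC ?inE ?eqxx.
suff : v *m C i = 0 by rewrite vi => ->; apply: sub0mx.
have /submxP[D' ->] : (v <= kermx (C i))%MS; last by rewrite -mulmxA mulmx_ker mulmx0.
apply: submx_trans vr _; rewrite big_seq; elim/big_ind: _ => [|A B hA hB|j jr].
- exact: sub0mx.
- by rewrite addsmx_sub hA.
by apply/sub_kermxP; apply: C0; rewrite ?inE ?eqxx ?jr ?orbT //; apply: contraNneq ir => <-.
Qed.

(** * Block components of the Foulkes module *)

Section FoulkesBlocks.
Variables (p m : nat) (F : fieldType).
Hypotheses (charF : p \in [pchar F]) (p_odd : odd p).
Variable tab : partition_of (2 * m) -> {ffun 'I_(2 * m) -> 'I_(2 * m) * 'I_(2 * m)}.
Hypothesis tabP : forall la, is_tableau la (tab la) /\ column_filled (tab la).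
Local Notation n := (2 * m)%N.
Local Notation G := (SymGroup n).
Local Notation H := (foulkes F m).
Local Notation S := (rcosets (wreath m) G).
Local Notation contentF := (tableau_contents tab F).
Local Notation block := (fun la : partition_of n => block_of_content n F (content p la)).
Implicit Types (la mu : partition_of n).

Lemma foulkes_eigenvector la : even_partition la ->
  exists2 u, u != 0 & jm_eigen H u (contentF la).
Proof.
move=> even_la; have [tab_t col_t] := tabP la.
by have [u] := modular_eigenvector even_la tab_t col_t charF; exists u.
Qed.

Lemma block_central la : central_idempotent (block la).
Proof. by have [[]] := block_of_contentP charF p_odd tabP la. Qed.

Lemma block_eigen la mu u : jm_eigen H u (contentF mu) ->
  u *m gring_op H (block la) = (content p la == content p mu)%:R *: u.
Proof. exact: (block_of_content_eigen charF p_odd tabP). Qed.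

Lemma blocks_orthogonal la mu : content p la != content p mu ->
  block la *m block mu = 0.
Proof.
move=> ne; have [bla _ _] := block_of_contentP charF p_odd tabP la.
have [bmu _ _] := block_of_contentP charF p_odd tabP mu.
apply: block_orthogonal => //; apply: contraNneq (bpoly_neq0 F tabP la) => e.
have va := block_of_content_eigen charF p_odd tabP la (bpoly_eigen charF p_odd tabP la).
have := block_of_content_eigen charF p_odd tabP mu (bpoly_eigen charF p_odd tabP la).
by rewrite -e va eqxx scale1r eq_sym (negPf ne) scale0r => ->.
Qed.

Lemma foulkes_nilpotent e : (e \in 'Z(group_ring F G))%MS ->
    (forall la, even_partition la -> forall u, jm_eigen H u (contentF la) ->
       u *m gring_op H e = 0) ->
  exists N, gring_op H e ^+ N = 0.
Proof.
move=> Ze e0; eexists; apply: (foulkes_central_nilpotent tabP Ze) => la even_la.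
by have [u u_neq0 uc] := foulkes_eigenvector even_la; exists u => //; split=> //; apply: e0 uc.
Qed.

(** The complementary idempotent f kills all eigenvectors attached to even partitions, so it is
    nilpotent on the module and therefore zero there. *)
Lemma foulkes_sum_blocks :
  \sum_(tau <- even_contents p m) gring_op H (block_of_content n F tau) = 1%:M.
Proof.
set f := 1%:M - \sum_(tau <- even_contents p m) block_of_content n F tau.
have evenP tau : tau \in even_contents p m -> exists la, tau = content p la.
  by rewrite mem_undup => /imageP[la _ ->]; exists la.
have Zb tau : tau \in even_contents p m -> (block_of_content n F tau \in 'Z(group_ring F G))%MS.
  by move=> /evenP[la ->]; have [] := block_central la.
have Zf : (f \in 'Z(group_ring F G))%MS by apply: centralB; [apply: central1 | apply: central_sum].
have ff : f *m f = f.
  rewrite {2}/f mulmxBr mulmx1 mulmx_sumr big_seq big1 ?subr0 // => tau tau_in.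
  have [la ela] := evenP _ tau_in; have [_ ee] := block_central la.
  rewrite mulmxBl mul1mx mulmx_suml (bigD1_seq tau) ?undup_uniq //= {2 3}ela ee -ela.
  rewrite big_seq_cond big1 ?addr0 ?subrr // => tau' /andP[/evenP[mu ->] ne].
  by rewrite ela; apply: blocks_orthogonal; rewrite -ela.
have fE : gring_op H f = 1%:M - \sum_(tau <- even_contents p m) gring_op H (block_of_content n F tau).
  by rewrite /f linearB /= gring_op1 linear_sum.
have [la even_la u uc|N fN] := foulkes_nilpotent Zf.
  rewrite fE mulmxBr mulmx1 mulmx_sumr.
  have la_in : content p la \in even_contents p m by rewrite mem_undup; apply: image_f.
  rewrite (bigD1_seq (content p la)) ?undup_uniq //= (block_eigen _ uc) eqxx scale1r.
  rewrite big_seq_cond big1 ?addr0 ?subrr // => tau' /andP[/evenP[mu ->] ne].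
  by rewrite (block_eigen _ uc) (negPf ne) scale0r.
have f0 : gring_op H f = 0.
  by apply: (idempotent_nilpotent _ fN); rewrite -central_gring_opM // ff.
by apply/esym/eqP; rewrite -subr_eq0 -fE f0.
Qed.

Lemma foulkes_block_indecomposable la : even_partition la ->
  indecomposable H (gring_op H (block la)).
Proof.
move=> even_la; set e := block la; set C := gring_op H e.
have ce : central_idempotent e := block_central la; have [Ze ee] := ce.
have CC : C *m C = C by rewrite -central_gring_opM // ee.
have [u u_neq0 uc] := foulkes_eigenvector even_la.
have uC : u *m C = u by rewrite (block_eigen _ uc) eqxx scale1r.
split=> [||V W modV modW VW dVW].
- exact: block_component_module.
- by apply: contraNneq u_neq0 => C0; rewrite -uC C0 mulmx0.
have VW0 : (V :&: W = 0)%MS by apply/mxdirect_addsP.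
have VC : (V <= C)%MS by rewrite -VW addsmxSl.
have WC : (W <= C)%MS by rewrite -VW addsmxSr.
have CVW : (C <= V + W)%MS by rewrite VW.
have fixC d (A : 'M_(d, _)) : (A <= C)%MS -> A *m C = A.
  by move=> /submxP[D ->]; rewrite -mulmxA CC.
(* The projection onto V along W is defined on the block component; composing it with C extends it
   by zero to the rest of the module. *)
pose P := C *m proj_mx V W.
have PV : (P <= V)%MS by apply: proj_mx_sub.
have CP : C *m P = P by rewrite mulmxA CC.
have PC : P *m C = P by apply: fixC; apply: submx_trans PV VC.
have PP : P *m P = P.
  by rewrite {2}/P mulmxA PC proj_mx_id.
have cP g : H g *m P = P *m H g.
  have Gg : g \in G by rewrite in_setT.
  (* Write C as P plus C - P. After g, the first part stays in V and the second in W, so projecting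
     keeps the former and kills the latter. *)
  have e1 : P *m H g *m proj_mx V W = P *m H g.
    apply: (proj_mx_id VW0); apply: submx_trans (submxMr _ PV) _.
    exact: (mxmoduleP modV).
  have e2 : (C - P) *m H g *m proj_mx V W = 0.
    apply: (proj_mx_0 VW0); apply: submx_trans (submxMr _ (proj_mx_compl_sub CVW)) _.
    exact: (mxmoduleP modW).
  have cC : H g *m C = C *m H g by apply/esym/gring_op_central.
  rewrite {1}/P mulmxA cC -[RHS]e1 -[RHS]addr0 -[in RHS]e2 -!mulmxDl.
  by congr (_ *m _ *m _); rewrite subrKC.
have [x Zx Px] := foulkes_endomorphism_central (char_neq2 charF p_odd) cP.
have [phi [phi_sym phiE]] := central_scalar Zx.
pose a := phi (contentF la).
have uP : u *m P = a *: u by rewrite Px; apply: phiE.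
(* Eigenvectors of other contents are killed by C, hence by P; on those of the same content P acts
   by a, since phi is symmetric. *)
have nilp : exists N, (P - a *: C) ^+ N = 0.
  have Zy : (x - a *: e \in 'Z(group_ring F G))%MS by apply: centralB => //; apply: centralZ.
  have yE : gring_op H (x - a *: e) = P - a *: C by rewrite linearB linearZ /= -Px.
  rewrite -yE; apply: foulkes_nilpotent => // mu even_mu v vc; rewrite yE mulmxBr -scalemxAr.
  have vC := block_eigen la vc; rewrite -/e -/C in vC.
  have [econt|ncont] := eqVneq (content p la) (content p mu); last first.
    by rewrite -CP mulmxA vC (negPf ncont) scale0r mul0mx scaler0 subrr.
  have [s es] := (content_perm charF tabP la mu).1 econt.
  rewrite vC econt eqxx scale1r Px (phiE _ _ _ _ vc).
  have -> : contentF mu = fun k => contentF la (s k) by apply: boolp.funext.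
  by rewrite phi_sym subrr.
case: nilp => N nilp.
have a2 : a * a = a.
  have := congr1 (mulmx u) PP; rewrite mulmxA uP -scalemxAl uP scalerA => /eqP.
  by rewrite -subr_eq0 -scalerBl scaler_eq0 (negPf u_neq0) orbF subr_eq0 => /eqP.
(* For a = 0 the idempotent P is nilpotent and V vanishes; for a = 1 so is C - P, and W vanishes. *)
have [a0|na0] := eqVneq a 0.
  left; move: nilp; rewrite a0 scale0r subr0 => /(idempotent_nilpotent PP) P0.
  have VP : V *m P = V by rewrite mulmxA fixC // proj_mx_id.
  by rewrite -VP P0 mulmx0.
have a1 : a = 1 by apply: (mulfI na0); rewrite a2 mulr1.
right; move: nilp; rewrite a1 scale1r => nilp.
have QQ : (C - P) *m (C - P) = C - P by rewrite mulmxBl !mulmxBr CC CP PC PP subrr subr0.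
have Q0 : C - P = 0.
  by apply: (idempotent_nilpotent (N := N) QQ); rewrite -opprB exprNn nilp mulr0.
have WP : W *m P = 0 by rewrite mulmxA fixC // proj_mx_0.
by have := mulmxBr W C P; rewrite Q0 mulmx0 fixC // WP subr0.
Qed.

Lemma foulkes_blocks_direct :
  mxdirect (\sum_(tau <- even_contents p m) gring_op H (block_of_content n F tau)).
Proof.
rewrite mxdirectE /=; apply/eqP/rank_sum_orthogonal => [|tau|tau tau']; first exact: undup_uniq.
  rewrite mem_undup => /imageP[la _ ->]; have [Ze ee] := block_central la.
  by rewrite -central_gring_opM // ee.
rewrite !mem_undup => /imageP[la _ ->] /imageP[mu _ ->] ne.
have [Zmu _] := block_central mu.
by rewrite -central_gring_opM // blocks_orthogonal // linear0.
Qed.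

End FoulkesBlocks.

Theorem theorem1p6 (p m : nat) (F : fieldType) (p_prime : prime p)
    (p_odd : odd p) (charF : p \in [pchar F]) :
  (forall la : partition_of (2 * m), even_partition la ->
     indecomposable (foulkes F m)
       (content_component (foulkes F m) (content p la))) /\
  (\sum_(tau <- even_contents p m) content_component (foulkes F m) tau
     :=: 1%:M)%MS /\
  mxdirect (\sum_(tau <- even_contents p m)
              content_component (foulkes F m) tau).
Proof.
have [tab tabP] := tableau_choice (2 * m).
split; [|split].
- by move=> la; apply: (foulkes_block_indecomposable charF p_odd tabP).
- apply/eqmxP; rewrite submx1 -(foulkes_sum_blocks charF p_odd tabP).
  (* On the left matrices are added, on the right their row spaces. *)
  apply: (big_ind2 (fun A B : 'M_ _ => (A <= B)%MS)) => // A B A' B' le le'.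
  exact: addmx_sub_adds.
- exact: (foulkes_blocks_direct charF p_odd tabP).
Qed.
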